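(* Let $u$ be the solution of the parabolic problem (P) described in the context, and let $(U_h^n)_{n=0}^N\subset S_h$ be the Crank–Nicolson fully discrete approximations, i.e. $U_h^0=R_hu_0$ and, for $n=1,\dots,N$ and all $\chi\in S_h$, $$\Big(\tfrac{U_h^n-U_h^{n-1}}{k_n},\chi\Big)=\Big[\varepsilon^{n-\frac12}\,\tfrac{U_h^n(1)-U_h^{n-1}(1)}{k_n}+\delta^{n-\frac12}\,\mathcal AU_h^n(1)+g^{n-\frac12}\Big]\chi(1)-a^{n-\frac12}\mathcal B(\mathcal AU_h^n,\chi)+(\beta^{n-\frac12}\mathcal AU_h^n,\chi)+(f^{n-\frac12},\chi).$$ Assume that $\varepsilon(t)\le0$ for $t\in[0,T]$, and let $C_\star\ge0$. Then there exist constants $C_D\ge0$ and $C>0$, independent of $h$ and of the partition of $[0,T]$, such that: if the partition satisfies $$|k_{n+1}-k_n|\le C_\star\max\{k_n^2,k_{n+1}^2\},\quad n=1,\dots,N-1,\qquad\text{and}\qquad\max_{1\le n\le N}(k_nC_D)\le\tfrac13,$$ then for $\ell=0,1$ $$\max_{0\le n\le N}\|U_h^n-u(t^n,\cdot)\|_\ell\le C\,(k^2+h^{r+1-\ell})\,\Upsilon_D(u)\qquad\forall\,h\in(0,h_\star],$$ where $$\Upsilon_D(u):=\sum_{\ell=0}^1\max_{[0,T]}\|\partial_t^\ell u\|_{r+1}+\sum_{\ell=2}^3\max_{[0,T]}\|\partial_t^\ell u\|_1+\sum_{\ell=2}^4\max_{t\in[0,T]}|\partial_t^\ell u(t,1)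|.$$
   Context: Function spaces: $D=(0,1)$; functions are real-valued; $(f_1,f_2)=\int_Df_1f_2\,dx$ and $\|\cdot\|=\|\cdot\|_0$ is the $L^2(D)$ norm; $\|f\|_s=\big(\sum_{\ell=0}^s\|\partial_x^\ell f\|^2\big)^{1/2}$ is the norm of $H^s(D)$; $\mathbb H^1(D)=\{v\in H^1(D):v(0)=0\}$, $\mathbb H^s(D)=H^s(D)\cap\mathbb H^1(D)$ for $s\ge2$; $\mathcal B(v,w)=(v',w')$. Finite elements: $r\in\mathbb N$, $h_\star>0$ are fixed. For each $h\in(0,h_\star]$, $S_h$ is a finite-dimensional subspace of $\mathbb H^1(D)$ consisting of real-valued functions that are polynomials of degree at most $r$ on each interval of a (non-uniform) partition of $D$ with maximum length $h$ (in particular the function $x\mapsto x$ is in $S_h$). With a constant independent of $h$, $\inf_{\chi\in S_h}\{\|v-\chi\|+h\|v-\chi\|_1\}\le C h^{s+1}\|v\|_{s+1}$ for $v\in\mathbb H^{s+1}(D)$, $s=0,\dots,r$. (No inverse inequality is assumed.) The elliptic projection $R_h:H^1(D)\to S_h$ is defined by $\mathcal B(R_hv,\phi)=\mathcal B(v,\phi)$ for all $\phi\in S_h$. Time partition: $0=t^0<t^1<\dots<t^N=T$, $k_n=t^n-t^{n-1}$, $k=\max_{1\le n\le N}k_n$, $t^{n-\frac12}=\frac12(t^{n-1}+t^n)$; $\mathcal AV^n=\frac12(V^n+V^{n-1})$; a superscript $n-\frac12$ on $a,\varepsilon,\delta,g,\beta,f$ denotes evaluation at $t=t^{n-\frac12}$.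 Problem (P): $T>0$; $\beta,f:[0,T]\times[0,1]\to\mathbb R$, $\delta,g,\varepsilon:[0,T]\to\mathbb R$, $a:[0,T]\to(0,\infty)$ with $\inf_{[0,T]}a>0$, $u_0:[0,1]\to\mathbb R$ are given smooth functions; $u:[0,T]\times[0,1]\to\mathbb R$ satisfies $u_t=a(t)u_{xx}+\beta(t,x)u+f(t,x)$ on $[0,T]\times[0,1]$; $u(t,0)=0$ and $a(t)u_x(t,1)=\varepsilon(t)u_t(t,1)+\delta(t)u(t,1)+g(t)$ for $t\in[0,T]$; $u(0,x)=u_0(x)$ for $x\in[0,1]$. The solution $u$ is assumed sufficiently smooth for the stated estimate. *)

(* Defs.v *)
From HB Require Import structures.
From mathcomp Require Import all_boot all_order all_algebra.
From mathcomp Require Import all_classical all_reals all_analysis.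
Set Implicit Arguments.
Unset Strict Implicit.
Unset Printing Implicit Defensive.
Import Order.TTheory GRing.Theory Num.Theory.
Import numFieldNormedType.Exports.

Local Open Scope classical_set_scope.
Local Open Scope ring_scope.

(* Functions on D = (0, 1) or on [0, 1] are total functions R -> R; only their
   values on that interval matter.  Functions on [0, T] x [0, 1] are curried,
   time first. *)

Section Sobolev.
Variable R : realType.
Implicit Types (f g v w : R -> R) (s l : nat).

Definition dom : set R := `]0, 1[.

Definition inner f g : R := \int[lebesgue_measure]_(x in dom) (f x * g x).

Definition L2 f : Prop :=
  measurable_fun dom f /\
  lebesgue_measure.-integrable dom (fun x => ((f x) ^+ 2)%:E).

Definition test_fun (phi : R -> R) : Prop :=
  [/\ forall x, derivable phi x 1,
      continuous (derive1 phi)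
    & exists a b : R, [/\ 0 < a, b < 1 & forall x, x \notin `[a, b] -> phi x = 0]].

(* g is a square-integrable weak derivative of f; on an interval, C^1 test
   functions with compact support are customary and sufficient. *)
Definition weak_deriv f g : Prop :=
  L2 g /\
  forall phi : R -> R, test_fun phi -> inner f (derive1 phi) = - inner g phi.

(* Some representative of the weak derivative (unique almost everywhere), and a
   default value if there is none. *)
Definition wder f : R -> R := xget (fun=> 0) [set g | weak_deriv f g].

(* H^s(D) for s >= 1, whose elements are identified with their representative
   that is continuous on [0, 1]: this is what gives a meaning to v(0), v(1). *)
Definition sobolev s v : Prop :=
  [/\ {within `[0, 1], continuous v}, L2 v
    & forall l, (l < s)%N -> weak_deriv (iter l wder v) (wder (iter l wder v))].

Definition sobolev0 s v : Prop := sobolev s v /\ v 0 = 0.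

Definition Hnorm s v : R :=
  Num.sqrt (\sum_(l < s.+1) inner (iter l wder v) (iter l wder v)).

Definition bform v w : R := inner (wder v) (wder w).

End Sobolev.

Section Partitions.
Variable R : realType.
Implicit Types (L : R) (N n : nat) (t : nat -> R).

Definition is_partition L N t : Prop :=
  [/\ t 0%N = 0, t N = L & forall n, (n < N)%N -> t n < t n.+1].

Definition step t n : R := t n - t n.-1.

Definition mesh N t : R := \big[Num.max/0]_(1 <= n < N.+1) step t n.

Definition midpoint t n : R := (t n.-1 + t n) / 2.

End Partitions.

Section FiniteElements.
Variable R : realType.
Implicit Types (r : nat) (h : R) (Sh : set (R -> R)).

Definition fin_dim Sh : Prop :=
  exists (d : nat) (b : 'I_d -> R -> R),
    (forall i, Sh (b i)) /\
    forall v, Sh v -> exists c : 'I_d -> R,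
      forall x, x \in `[0, 1] -> v x = \sum_(i < d) c i * b i x.

Definition piecewise_poly r (M : nat) (y : nat -> R) (v : R -> R) : Prop :=
  forall j, (j < M)%N -> exists2 p : {poly R}, (size p <= r.+1)%N &
    forall x, x \in `[y j, y j.+1] -> v x = p.[x].

Definition fe_space r h Sh : Prop :=
  [/\ Sh (fun=> 0) /\
        (forall (c : R) v w, Sh v -> Sh w -> Sh (fun x => c * v x + w x)),
      fin_dim Sh,
      (forall v, Sh v -> sobolev0 1 v),
      (exists (M : nat) (y : nat -> R),
         [/\ is_partition 1 M y, mesh M y = h
           & forall v, Sh v -> piecewise_poly r M y v])
    & Sh (fun x => x)].

Definition approximation_property r (hstar : R) (S : R -> set (R -> R)) : Prop :=
  exists C : R, forall h, 0 < h <= hstar ->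
    forall s, (s <= r)%N -> forall v, sobolev0 s.+1 v ->
      inf [set Hnorm 0 (v \- chi) + h * Hnorm 1 (v \- chi) | chi in S h]
        <= C * h ^+ s.+1 * Hnorm s.+1 v.

Definition fe_family r (hstar : R) (S : R -> set (R -> R)) : Prop :=
  (forall h, 0 < h <= hstar -> fe_space r h (S h)) /\
  approximation_property r hstar S.

(* w = R_h v *)
Definition is_elliptic_projection Sh (v w : R -> R) : Prop :=
  Sh w /\ forall phi, Sh phi -> bform w phi = bform v phi.

End FiniteElements.

Section Smoothness.
Variable R : realType.

(* Derivatives relative to A: one-sided at the endpoints of an interval. *)
Definition quot_in (f : R -> R) (x : R) : R -> R :=
  fun y => (f y - f x) / (y - x).

Definition is_deriv_in (A : set R) (f : R -> R) (x l : R) : Prop :=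
  quot_in f x @ within A x^' --> l.

Definition deriv_in (A : set R) (f : R -> R) (x : R) : R :=
  lim (quot_in f x @ within A x^').

(* C^oo on A, with w n the n-th derivative *)
Definition smooth1 (A : set R) (f : R -> R) : Prop :=
  exists w : nat -> R -> R,
    (forall x, A x -> w 0%N x = f x) /\
    forall n x, A x -> is_deriv_in A (w n) x (w n.+1 x).

Definition rect (T : R) : set (R * R) := `[0, T] `*` `[0, 1].

(* The mixed partials w l m = d_t^l d_x^m u with (l, m) in I (a set closed
   downwards) exist, irrespective of the order of differentiation, and are
   continuous on the closed rectangle. *)
Definition smooth2_in (I : nat -> nat -> bool) (T : R) (u : R -> R -> R) : Prop :=
  exists w : nat -> nat -> R -> R -> R,
    (forall t x, rect T (t, x) -> w 0%N 0%N t x = u t x) /\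
    forall l m, I l m ->
      [/\ {within rect T, continuous (fun p => w l m p.1 p.2)},
          I l.+1 m -> forall t x, rect T (t, x) ->
            is_deriv_in `[0, T] (fun s => w l m s x) t (w l.+1 m t x)
        & I l m.+1 -> forall t x, rect T (t, x) ->
            is_deriv_in `[0, 1] (w l m t) x (w l m.+1 t x)].

Definition smooth2 : R -> (R -> R -> R) -> Prop :=
  smooth2_in (fun _ _ => true).

Definition dt (T : R) (u : R -> R -> R) : R -> R -> R :=
  fun t x => deriv_in `[0, T] (fun s => u s x) t.

Definition dx (u : R -> R -> R) : R -> R -> R :=
  fun t x => deriv_in `[0, 1] (u t) x.

Definition dtn (l : nat) (T : R) (u : R -> R -> R) : R -> R -> R :=
  iter l (dt T) u.

End Smoothness.

Section Problem.
Variable R : realType.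
Implicit Types (T : R) (a eps delta g : R -> R) (beta f u : R -> R -> R).

Definition coefficients T a beta eps delta : Prop :=
  [/\ 0 < T,
      smooth1 `[0, T] a /\ smooth2 T beta,
      smooth1 `[0, T] eps /\ smooth1 `[0, T] delta,
      (forall t, t \in `[0, T] -> 0 < a t)
    & 0 < inf [set a t | t in `[0, T]]].

Definition sources T f g (u0 : R -> R) : Prop :=
  [/\ smooth2 T f, smooth1 `[0, T] g & smooth1 `[0, 1] u0].

Definition solution T a beta eps delta f g (u0 : R -> R) u : Prop :=
  [/\ forall t x, t \in `[0, T] -> x \in `[0, 1] ->
        dt T u t x = a t * dx (dx u) t x + beta t x * u t x + f t x,
      forall t, t \in `[0, T] -> u t 0 = 0,
      forall t, t \in `[0, T] ->
        a t * dx u t 1 = eps t * dt T u t 1 + delta t * u t 1 + g t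
    & forall x, x \in `[0, 1] -> u 0 x = u0 x].

(* All derivatives occurring in the equation and in Upsilon exist and are
   continuous. *)
Definition regular (r : nat) T u : Prop :=
  smooth2_in (fun l m => (l <= 1)%N && (m <= r.+1)%N
                         || (l <= 3)%N && (m <= 1)%N) T u /\
  (forall t, t \in `[0, T] ->
     is_deriv_in `[0, T] (fun s => dtn 3 T u s 1) t (dtn 4 T u t 1)) /\
  {within `[0, T], continuous (fun t => dtn 4 T u t 1)}.

Definition Upsilon (r : nat) T u : R :=
  \sum_(0 <= l < 2) sup [set Hnorm r.+1 (dtn l T u t) | t in `[0, T]] +
  \sum_(2 <= l < 4) sup [set Hnorm 1 (dtn l T u t) | t in `[0, T]] +
  \sum_(2 <= l < 5) sup [set `|dtn l T u t 1| | t in `[0, T]].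

Definition CN_scheme (Sh : set (R -> R)) (N : nat) (t : nat -> R)
    a beta eps delta f g (u0 : R -> R) (U : nat -> R -> R) : Prop :=
  [/\ forall n, (n <= N)%N -> Sh (U n),
      is_elliptic_projection Sh u0 (U 0%N)
    & forall n, (1 <= n <= N)%N -> forall chi, Sh chi ->
        let k := step t n in
        let tm := midpoint t n in
        let dU x := (U n x - U n.-1 x) / k in
        let AU x := (U n x + U n.-1 x) / 2 in
        inner dU chi =
          (eps tm * dU 1 + delta tm * AU 1 + g tm) * chi 1
          - a tm * bform AU chi
          + inner (fun x => beta tm x * AU x) chi
          + inner (f tm) chi].

End Problem.

(* Main.v *)
Require Import Defs.
From HB Require Import structures.
From mathcomp Require Import all_boot all_order all_algebra.
From mathcomp Require Import all_classical all_reals all_analysis.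
From mathcomp Require Import measurable_realfun lebesgue_integral_under ring lra.
Import Order.TTheory GRing.Theory Num.Theory.
Import numFieldNormedType.Exports.
Local Open Scope classical_set_scope.
Local Open Scope ring_scope.

(** The error is split as [U n - u (t n) = theta n - (u (t n) - P n)], where
   [P n] is the elliptic projection of [u (t n)] and [theta n = U n - P n] lies
   in the finite element space. The projection error is of order h^r in H^1 by
   optimality of the projection and of order h^(r+1) in L^2 by a duality
   argument (lemmas [elliptic_error], [aubin_nitsche]). It remains to show
   |theta n|_1 <= C (k^2 + h^(r+1)) Upsilon (lemma [theta_bound]): the Poincare
   inequality turns this into the same bound in L^2.

   The function x belongs to the finite element space, so that the projection
   reproduces the value at 1 (lemma [projection_at1]). The boundary terms of
   the equation for [theta] thus contain no projection error, only residuals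
   of the time discretization. This equation is divided by [a] and tested with
   the difference quotient of [theta] (lemma [energy_identity]): the square of
   |theta|_1 telescopes, [eps <= 0] gives the quotient at the boundary a good
   sign, and the L^2 norm of the quotient absorbs the load, which does contain
   the projection error but only measured in L^2.

   Two kinds of terms are not absorbed: the boundary residuals, multiplied by
   the increment of [theta] at 1, and the residual of the average in the
   bilinear form, tested with the increment of [theta]. They are O(k^2), but
   come without the factor k_n, and the increments are not controlled. They are
   therefore summed by parts in time, which costs the increments of the
   residuals. By Taylor expansion a residual is a multiple of k_n^2 H(midpoint)
   with a smooth H, up to O(k_n^3); as |k_(n+1) - k_n| <= C k^2, two consecutive
   residuals differ by O(k_n k^2) only (lemma [residual_difference]). The term
   with [delta] is summed by parts as well. The energy modified by these
   boundary terms stays coercive by a trace inequality with a small coefficient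
   of the derivative (lemma [trace_ineq]), and Gronwall's lemma concludes
   (lemma [discrete_energy]).

   Residuals that are functions of x are estimated by duality: for a fixed
   square-integrable phi the number (u(t, .), phi) is a scalar function of t,
   differentiable under the integral sign, so that the scalar Taylor expansion
   applies (lemmas [inner_curve], [le_nrm_inner]).

   All that is needed about weak derivatives comes from one integration by parts
   on subintervals (lemma [weak_deriv_ibp]): it yields their uniqueness, the
   pointwise bound by the energy norm, the trace inequality and the weak form of
   the equation. *)

Set Implicit Arguments.
Unset Strict Implicit.
Unset Printing Implicit Defensive.

(** * The space L2 of the unit interval *)

Section L2_theory.
Variable R : realType.
Implicit Types (f g v w phi : R -> R) (c : R).
Local Notation mu := (@lebesgue_measure R).
Local Notation dom := (@dom R).

Lemma measurable_dom : measurable (dom : set (g_sigma_algebraType R.-ocitv.-measurable)).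
Proof. exact: measurable_itv. Qed.

Lemma mu_dom : mu dom = 1%E.
Proof. by rewrite /Defs.dom lebesgue_measure_itv /= lte_fin ltr01 oppr0 adde0. Qed.

Local Hint Resolve measurable_dom : core.

Lemma integrable_cst_dom c : mu.-integrable dom (EFin \o (cst c)).
Proof.
apply: measurable_bounded_integrable => //.
- by move: mu_dom => /= ->; exact: ltry.
- by exists `|c|; split; [exact: num_real|move=> M /ltW cM x _].
Qed.

Lemma L2_integrable_mul f g : L2 f -> L2 g ->
  mu.-integrable dom (EFin \o (fun x => f x * g x)).
Proof.
move=> [mf f2] [mg g2].
apply: (@le_integrable _ _ _ mu dom _ _ (fun x => ((f x ^+ 2)%:E + (g x ^+ 2)%:E)%E)) => //.
- by apply/measurable_EFinP; apply: measurable_funM.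
- move=> x _ /=; rewrite lee_fin normrM (@ger0_norm _ (_ + _)) ?addr_ge0 ?sqr_ge0 //.
  rewrite -(real_normK (num_real (f x))) -(real_normK (num_real (g x))).
  by have := sqr_ge0 (`|f x| - `|g x|); have := normr_ge0 (f x); have := normr_ge0 (g x); nra.
- exact: integrableD.
Qed.

Lemma L2_cst c : L2 (fun=> c).
Proof. by split; [exact: measurable_cst|exact: (integrable_cst_dom (c ^+ 2))]. Qed.

Lemma L2_integrable f : L2 f -> mu.-integrable dom (EFin \o f).
Proof.
move=> /L2_integrable_mul/(_ (L2_cst 1)).
by under [X in EFin \o X]eq_fun do rewrite mulr1.
Qed.

Lemma L2_mul_bounded (b f : R -> R) (M : R) : measurable_fun dom b ->
  (forall x, dom x -> `|b x| <= M) -> L2 f -> L2 (fun x => b x * f x).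
Proof.
move=> mb bM [mf f2]; split; first exact: measurable_funM.
apply: (@le_integrable _ _ _ mu dom _ _ (fun x => ((M ^+ 2)%:E * (f x ^+ 2)%:E)%E)) => //.
- by apply/measurable_EFinP; apply: measurable_funX; apply: measurable_funM.
- move=> x dx; rewrite -EFinM /= lee_fin exprMn.
  rewrite !ger0_norm; do ?[by rewrite mulr_ge0 ?sqr_ge0].
  apply: ler_wpM2r; first exact: sqr_ge0.
  have := bM _ dx => bx; have M0 := le_trans (normr_ge0 _) bx.
  by rewrite -(real_normK (num_real (b x))) lerXn2r ?nnegrE.
- exact: integrableZl.
Qed.

Lemma L2_lin c f g : L2 f -> L2 g -> L2 (fun x => c * f x + g x).
Proof.
move=> Lf Lg; have [mf f2] := Lf; have [mg g2] := Lg; split.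
  by apply: measurable_funD => //; apply: measurable_funM.
apply: (@le_integrable _ _ _ mu dom _ _
   (fun x => ((2 * c ^+ 2)%:E * (f x ^+ 2)%:E + 2%:E * (g x ^+ 2)%:E)%E)) => //.
- apply/measurable_EFinP; apply: measurable_funX; apply: measurable_funD => //.
  exact: measurable_funM.
- move=> x dx; rewrite -!EFinM -EFinD /= lee_fin ger0_norm ?sqr_ge0 // ger0_norm.
    by have := sqr_ge0 (c * f x - g x); nra.
  by have := sqr_ge0 (c * f x); have := sqr_ge0 (g x); nra.
- have i1 := integrableZl measurable_dom (2 * c ^+ 2) f2.
  have i2 := integrableZl measurable_dom 2%R g2.
  apply: eq_integrable (integrableD measurable_dom i1 i2) => //.
Qed.

Lemma L2Z c f : L2 f -> L2 (fun x => c * f x).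
Proof.
move=> Lf; have := L2_lin c Lf (L2_cst 0).
by under eq_fun do rewrite addr0.
Qed.

Lemma L2B f g : L2 f -> L2 g -> L2 (fun x => f x - g x).
Proof.
move=> Lf Lg; have := L2_lin (-1) Lg Lf.
by under eq_fun do rewrite mulN1r addrC.
Qed.

Lemma L2D f g : L2 f -> L2 g -> L2 (fun x => f x + g x).
Proof.
move=> Lf Lg; have := L2_lin 1 Lf Lg.
by under eq_fun do rewrite mul1r.
Qed.

Lemma within_bounded (a b : R) f : {within `[a, b], continuous f} ->
  exists2 M, 0 <= M & forall x, x \in `[a, b] -> `|f x| <= M.
Proof.
move=> cf.
have [M [_ HM]] := compact_bounded (continuous_compact cf (@segment_compact R a b)).
exists (`|M| + 1) => [|x x01]; first by rewrite addr_ge0.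
by apply: (HM (`|M| + 1)); [rewrite ltr_pwDr // ler_norm|exists x].
Qed.

Lemma within01_measurable f : {within `[0, 1], continuous f} -> measurable_fun dom f.
Proof.
move=> cf; have h : measurable_fun (`[0, 1]%classic : set R) f.
  by apply: subspace_continuous_measurable_fun => //; exact: measurable_itv.
apply: measurable_funS h; first exact: measurable_itv.
by move=> x; rewrite /Defs.dom /= !in_itv /= => /andP[/ltW -> /ltW ->].
Qed.

Lemma L2_within f : {within `[0, 1], continuous f} -> L2 f.
Proof.
move=> cf; have [M M0 HM] := within_bounded cf.
have := @L2_mul_bounded f _ M (within01_measurable cf) _ (L2_cst 1).
under eq_fun do rewrite mulr1.
by apply=> x; rewrite /Defs.dom /= in_itv /= => /andP[/ltW x0 /ltW x1]; apply: HM; rewrite in_itv /= x0.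
Qed.

Lemma L2_continuous f : continuous f -> L2 f.
Proof. by move=> cf; apply: L2_within; apply: continuous_subspaceT. Qed.

Lemma innerC f g : inner f g = inner g f.
Proof. by rewrite /inner; under eq_Rintegral do rewrite mulrC. Qed.

Lemma eq_innerl f f' g : {in dom, f =1 f'} -> inner f g = inner f' g.
Proof. by move=> ff'; apply: eq_Rintegral => x dx; rewrite ff'. Qed.

Lemma eq_innerr f g g' : {in dom, g =1 g'} -> inner f g = inner f g'.
Proof. by move=> ff'; apply: eq_Rintegral => x dx; rewrite ff'. Qed.

Lemma inner_linl c f g phi : L2 f -> L2 g -> L2 phi ->
  inner (fun x => c * f x + g x) phi = c * inner f phi + inner g phi.
Proof.
move=> Lf Lg Lp; rewrite /inner.
have i1 := L2_integrable_mul Lf Lp; have i2 := L2_integrable_mul Lg Lp.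
have i3 := L2_integrable_mul (L2Z c Lf) Lp.
rewrite -RintegralZl // -RintegralD //.
  by apply: eq_Rintegral => x _; rewrite mulrDl mulrA.
by move: i3; under [X in EFin \o X]eq_fun do rewrite -mulrA.
Qed.

Lemma inner_linr c f g phi : L2 f -> L2 g -> L2 phi ->
  inner phi (fun x => c * f x + g x) = c * inner phi f + inner phi g.
Proof. by move=> *; rewrite innerC inner_linl // !(innerC _ phi). Qed.

Lemma innerZl c f phi : L2 f -> L2 phi -> inner (fun x => c * f x) phi = c * inner f phi.
Proof.
move=> Lf Lp; have := inner_linl c Lf (L2_cst 0) Lp.
rewrite (_ : (fun x => c * f x + 0) = (fun x => c * f x)); last by apply/funext => x; rewrite addr0.
move=> ->; rewrite [inner (fun=> 0) _](_ : _ = 0) ?addr0 // /inner.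
under eq_Rintegral do rewrite mul0r.
by rewrite Rintegral_cst // mul0r.
Qed.

Lemma innerZr c f phi : L2 f -> L2 phi -> inner phi (fun x => c * f x) = c * inner phi f.
Proof. by move=> *; rewrite innerC innerZl // innerC. Qed.

Lemma innerDl f g phi : L2 f -> L2 g -> L2 phi ->
  inner (fun x => f x + g x) phi = inner f phi + inner g phi.
Proof.
move=> Lf Lg Lp; have := inner_linl 1 Lf Lg Lp; rewrite mul1r => <-.
by under eq_fun do rewrite -[f _]mul1r.
Qed.

Lemma innerDr f g phi : L2 f -> L2 g -> L2 phi ->
  inner phi (fun x => f x + g x) = inner phi f + inner phi g.
Proof. by move=> *; rewrite innerC innerDl // !(innerC _ phi). Qed.

Lemma innerBl f g phi : L2 f -> L2 g -> L2 phi ->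
  inner (fun x => f x - g x) phi = inner f phi - inner g phi.
Proof.
move=> Lf Lg Lp; have := inner_linl (-1) Lg Lf Lp; rewrite mulN1r addrC => <-.
by under eq_fun do rewrite addrC -mulN1r.
Qed.

Lemma inner_ge0 f : 0 <= inner f f.
Proof. by apply: Rintegral_ge0 => x _; rewrite -expr2 sqr_ge0. Qed.

Definition nrm f := Num.sqrt (inner f f).

Lemma nrm_ge0 f : 0 <= nrm f.
Proof. exact: sqrtr_ge0. Qed.

Lemma nrm_sqr f : nrm f ^+ 2 = inner f f.
Proof. by rewrite sqr_sqrtr // inner_ge0. Qed.

Lemma inner_sqr_lin c f g : L2 f -> L2 g ->
  inner (fun x => c * f x + g x) (fun x => c * f x + g x) =
  c ^+ 2 * inner f f + 2 * c * inner f g + inner g g.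
Proof.
move=> Lf Lg; rewrite inner_linl ?inner_linr //; last exact: L2_lin.
by rewrite (innerC g f); ring.
Qed.

(** The quadratic polynomial [c |-> inner (c f + g) (c f + g)] is nonnegative. *)
Lemma cauchy_schwarz f g : L2 f -> L2 g -> `|inner f g| <= nrm f * nrm g.
Proof.
move=> Lf Lg.
suff H : inner f g ^+ 2 <= inner f f * inner g g.
  rewrite -(@ler_pXn2r _ 2) ?nnegrE ?mulr_ge0 ?nrm_ge0 //.
  by rewrite exprMn !nrm_sqr real_normK ?num_real.
have H c : 0 <= c ^+ 2 * inner f f + 2 * c * inner f g + inner g g.
  by rewrite -inner_sqr_lin // inner_ge0.
have := inner_ge0 f; rewrite le_eqVlt => /orP[/eqP f0|f0].
- have [->|n0] := eqVneq (inner f g) 0; first by rewrite expr0n /= -f0 mul0r.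
  have := H (- (inner g g + 1) / (2 * inner f g)); rewrite -f0 mulr0 add0r.
  have -> : 2 * (- (inner g g + 1) / (2 * inner f g)) * inner f g = - (inner g g + 1).
    by field.
  by lra.
- have := H (- inner f g / inner f f).
  have -> : (- inner f g / inner f f) ^+ 2 * inner f f +
     2 * (- inner f g / inner f f) * inner f g + inner g g =
     (inner f f * inner g g - inner f g ^+ 2) / inner f f by field; rewrite gt_eqF.
  by rewrite pmulr_lge0 ?invr_gt0 // subr_ge0.
Qed.

Lemma nrmZ c f : L2 f -> nrm (fun x => c * f x) = `|c| * nrm f.
Proof.
move=> Lf; rewrite /nrm innerZl ?innerZr //; last exact: L2Z.
by rewrite mulrA -expr2 sqrtrM ?sqr_ge0 // sqrtr_sqr.
Qed.

Lemma nrmD f g : L2 f -> L2 g -> nrm (fun x => f x + g x) <= nrm f + nrm g.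
Proof.
move=> Lf Lg; rewrite -(@ler_pXn2r _ 2) ?nnegrE ?addr_ge0 ?nrm_ge0 //.
rewrite nrm_sqr innerDl ?innerDr //; last exact: L2D.
have := cauchy_schwarz Lf Lg; rewrite ler_norml => /andP[_ h].
by rewrite (innerC g f) sqrrD !nrm_sqr mulr2n; lra.
Qed.

(** The converse of the Cauchy-Schwarz inequality reduces norms of residuals to
   scalar functions of time. *)
Lemma le_nrm_inner f M : L2 f -> 0 <= M ->
  (forall phi, L2 phi -> `|inner f phi| <= M * nrm phi) -> nrm f <= M.
Proof.
move=> Lf M0 /(_ _ Lf); rewrite -nrm_sqr ger0_norm ?sqr_ge0 // expr2.
have := nrm_ge0 f; rewrite le_eqVlt => /orP[/eqP <- //|f0].
by rewrite ler_pM2r.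
Qed.

Lemma nrm_bounded f M : 0 <= M -> measurable_fun dom f ->
  (forall x, dom x -> `|f x| <= M) -> nrm f <= M.
Proof.
move=> M0 mf fM.
rewrite -(@ler_pXn2r _ 2) ?nnegrE ?nrm_ge0 // nrm_sqr.
have Lf : L2 f.
  by have := L2_mul_bounded mf fM (L2_cst 1); under eq_fun do rewrite mulr1.
have : inner f f <= inner (fun=> M) (fun=> M).
  apply: le_Rintegral => //; try exact: L2_integrable_mul.
    by apply: L2_integrable_mul; exact: L2_cst.
  move=> x dx; have := fM x dx; rewrite ler_norml => /andP[]; nra.
by rewrite {2}/inner Rintegral_cst //; move: (mu_dom) => /= ->; rewrite /= mulr1 -expr2.
Qed.

End L2_theory.
#[global] Hint Resolve measurable_dom : core.

(** * Smooth cutoff functions *)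

Section continuity.
Variable R : realType.
Implicit Types (f g p q : R -> R).

Lemma cont_comp f g : continuous f -> continuous g -> continuous (fun x => f (g x)).
Proof. by move=> cf cg x; apply: (@continuous_comp _ _ _ g f); [exact: cg|exact: cf]. Qed.
Lemma cont_id : continuous (fun x : R => x). Proof. by move=> x; exact: cvg_id. Qed.
Lemma cont_cst (c : R) : continuous (fun x : R => c). Proof. by move=> x; exact: cvg_cst. Qed.
Lemma contD f g : continuous f -> continuous g -> continuous (fun x => f x + g x).
Proof. by move=> cf cg x; apply: cvgD; [exact: cf|exact: cg]. Qed.
Lemma contN f : continuous f -> continuous (fun x => - f x).
Proof. by move=> cf x; apply: cvgN; exact: cf. Qed.
Lemma contM f g : continuous f -> continuous g -> continuous (fun x => f x * g x).
Proof. by move=> cf cg x; apply: cvgM; [exact: cf|exact: cg]. Qed.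
Lemma contX f n : continuous f -> continuous (fun x => f x ^+ n).
Proof. by move=> cf; apply: (@cont_comp (fun x => x ^+ n) f) => // x; exact: exprn_continuous. Qed.
Lemma cont_max f g : continuous f -> continuous g -> continuous (fun x => Num.max (f x) (g x)).
Proof. by move=> cf cg x; apply: continuous_max; [exact: cf|exact: cg]. Qed.
Lemma cont_min f g : continuous f -> continuous g -> continuous (fun x => Num.min (f x) (g x)).
Proof. by move=> cf cg x; apply: continuous_min; [exact: cf|exact: cg]. Qed.

(** The retraction of the line onto [[a, b]]. Composition with it extends a
   function continuous on the interval to a continuous one on the line, which
   spares one-sided limits at the endpoints. *)
Definition clamp (a b x : R) := Num.max a (Num.min b x).

Lemma clamp_cont a b : continuous (clamp a b).
Proof. by apply: cont_max; [exact: cont_cst|apply: cont_min; [exact: cont_cst|exact: cont_id]]. Qed.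

Lemma clamp_id a b x : x \in `[a, b] -> clamp a b x = x.
Proof. by rewrite in_itv /= /clamp => /andP[ax xb]; rewrite min_r // max_r. Qed.

Lemma clamp_in a b x : a <= b -> clamp a b x \in `[a, b].
Proof.
by move=> ab; rewrite in_itv /= /clamp le_max lexx /= ge_max ab ge_min lexx.
Qed.

Lemma clamp_within_cont a b f : a <= b ->
  {within `[a, b], continuous f} -> continuous (fun x => f (clamp a b x)).
Proof.
move=> ab /subspace_continuousP cf x.
apply: (@cvg_comp _ _ _ (clamp a b) f _ (within `[a, b] (nbhs (clamp a b x)))); last first.
  by apply: cf; rewrite /= clamp_in.
move=> A; rewrite /within /= => wA.
have h : nbhs x (clamp a b @^-1` [set z | z \in `[a, b] -> A z]) := @clamp_cont a b x _ wA.
suff : nbhs x (clamp a b @^-1` A) by [].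
apply: filterS h => y h; exact: (h (clamp_in y ab)).
Qed.

End continuity.

Ltac cts1 :=
  lazymatch goal with |- forall x, @continuous_at _ _ x ?f =>
  lazymatch f with
  | (fun x => x) => exact: cont_id
  | (fun _ => ?c) => exact: cont_cst
  | (fun x => @?a x + @?b x) => apply: (@contD _ a b)
  | (fun x => - @?a x) => apply: (@contN _ a)
  | (fun x => @?a x * @?b x) => apply: (@contM _ a b)
  | (fun x => @?a x ^+ ?n) => apply: (@contX _ a n)
  | (fun x => Num.max (@?a x) (@?b x)) => apply: (@cont_max _ a b)
  | (fun x => Num.min (@?a x) (@?b x)) => apply: (@cont_min _ a b)
  | (fun x => ?h (@?a x)) => apply: (@cont_comp _ h a)
  end end.
Ltac cts := repeat first [assumption | cts1].

Section cutoff.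
Variable R : realType.
Implicit Types (f g p q : R -> R) (x y z s N : R).
Local Notation mu := (@lebesgue_measure R).
Local Notation dom := (@dom R).

Lemma domE x : dom x = (0 < x < 1).
Proof. by rewrite /Defs.dom /= in_itv. Qed.

Lemma dom_cc x : dom x -> x \in `[0, 1].
Proof. by rewrite domE in_itv /= => /andP[/ltW -> /ltW ->]. Qed.

Lemma near_lt x y : x < y -> \forall s \near x, s < y.
Proof. by move=> xy; exact: lt_nbhsl. Qed.

Lemma near_gt x y : y < x -> \forall s \near x, y < s.
Proof. by move=> xy; exact: lt_nbhsr. Qed.

Lemma is_deriveMf f g x a b : is_derive x 1 f a -> is_derive x 1 g b ->
  is_derive x 1 (fun s => f s * g s) (f x * b + a * g x).
Proof.
move=> d1 d2; have := is_deriveM d1 d2; rewrite /GRing.scale /= (mulrC (g x)).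
by [].
Qed.

Lemma is_derive_ramp z : is_derive z 1 (fun s => (Num.max 0 s) ^+ 2) (2 * Num.max 0 z).
Proof.
have [z0|z0|->] := ltgtP z 0.
- rewrite mulr0.
  apply: (@near_eq_is_derive _ _ _ (cst 0)).
  near=> s; rewrite max_l ?expr0n //.
  by apply: ltW; near: s; exact: near_lt.
- have d : is_derive z 1 ((id : R -> R) ^+ 2) (2 * z).
    by apply: is_derive_eq; rewrite /GRing.scale /=; ring.
  apply: near_eq_is_derive d; near=> s.
  rewrite max_r; first by [].
  by apply: ltW; near: s; exact: near_gt.
- rewrite mulr0.
  have H : (h^-1 *: ((fun s : R => (Num.max 0 s) ^+ 2) (h *: 1 + 0) - (Num.max 0 0 : R) ^+ 2)) @[h --> 0^'] --> (0 : R).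
    apply/cvgrPdist_le => e e0; near=> h.
    rewrite maxxx expr0n subr0 sub0r normrN addr0 /GRing.scale /= mulr1.
    have h0 : h != 0 by near: h; exact: nbhs_dnbhs_neq.
    have he : `|h| <= e.
      near: h; apply: dnbhs0_le => //.
    have [hn|hp] := leP h 0; first by rewrite expr0n /= mulr0 normr0 ltW.
    by rewrite expr2 mulrA mulVf // mul1r.
  split; first by apply/cvg_ex; exists 0.
  exact/cvg_lim.
Unshelve. all: by end_near. Qed.

(** A C^1 function equal to 0 before 1 and to 1 after 2: the second primitive of
   the step function of height 4 on [[1, 3/2]] and -4 on [[3/2, 2]]. *)
Definition smooth_step z : R :=
  2 * ((Num.max 0 (z - 1)) ^+ 2 - 2 * (Num.max 0 (z - 3 / 2)) ^+ 2 + (Num.max 0 (z - 2)) ^+ 2).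

Definition dsmooth_step z : R :=
  4 * (Num.max 0 (z - 1) - 2 * Num.max 0 (z - 3 / 2) + Num.max 0 (z - 2)).

Lemma maxP0 z : (0 <= z /\ Num.max 0 z = z) \/ (z <= 0 /\ Num.max 0 z = 0).
Proof. by have [z0|z0] := leP 0 z; [left|right; split => //; exact: ltW]. Qed.

Lemma smooth_step_le1 z : z <= 1 -> smooth_step z = 0 /\ dsmooth_step z = 0.
Proof. by move=> z1; rewrite /smooth_step /dsmooth_step !max_l; [split; ring|lra..]. Qed.

Lemma smooth_step_ge2 z : 2 <= z -> smooth_step z = 1 /\ dsmooth_step z = 0.
Proof. by move=> z1; rewrite /smooth_step /dsmooth_step !max_r; [split; field|lra..]. Qed.

Lemma smooth_step_itv z : 0 <= smooth_step z <= 1.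
Proof.
have [/smooth_step_le1[-> _]|z1] := leP z 1; first by rewrite lexx ler01.
have [/smooth_step_ge2[-> _]|z2] := leP 2 z; first by rewrite lexx ler01.
rewrite /smooth_step (@max_r _ _ 0 (z - 1)) ?(@max_l _ _ 0 (z - 2)) ?subr_ge0 ?subr_le0 ?(ltW z1) ?(ltW z2) //.
have [[h ->]|[h ->]] := maxP0 (z - 3 / 2); apply/andP; split; nra.
Qed.

Lemma dsmooth_step_ge0 z : 0 <= dsmooth_step z.
Proof.
rewrite /dsmooth_step.
have [[h ->]|[h ->]] := maxP0 (z - 3 / 2); have [[h' ->]|[h' ->]] := maxP0 (z - 1);
have [[h'' ->]|[h'' ->]] := maxP0 (z - 2); lra.
Qed.

Lemma dsmooth_step_cont : continuous dsmooth_step.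
Proof. by rewrite /dsmooth_step; cts. Qed.

Lemma smooth_step_cont : continuous smooth_step.
Proof. by rewrite /smooth_step; cts. Qed.

Lemma is_derive_affine N x c s F d : is_derive (N * (s - x) + c) 1 F d ->
  is_derive s 1 (fun s => F (N * (s - x) + c)) (N * d).
Proof.
move=> dF.
have dg : is_derive s 1 (fun s => N * (s - x) + c) N.
  have -> : (fun s => N * (s - x) + c) = N \*: (id - cst x) + cst c by [].
  by apply: is_derive_eq; rewrite /GRing.scale /= subr0 mulr1 addr0.
by rewrite mulrC; exact: (@is_derive1_comp R F _ s d N dF dg).
Qed.

Lemma is_derive_smooth_step z : is_derive z 1 smooth_step (dsmooth_step z).
Proof.
have H c : is_derive z 1 (fun z => (Num.max 0 (z - c)) ^+ 2) (2 * Num.max 0 (z - c)).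
  have := @is_derive_affine 1 c 0 z _ _ (is_derive_ramp _).
  by rewrite !mul1r addr0; under eq_fun do rewrite mul1r addr0.
have -> : smooth_step = 2 \*: ((fun z => (Num.max 0 (z - 1)) ^+ 2)
    - 2 \*: (fun z => (Num.max 0 (z - 3 / 2)) ^+ 2) + (fun z => (Num.max 0 (z - 2)) ^+ 2)) by [].
have h1 := H 1; have h2 := H (3/2); have h3 := H 2.
by apply: is_derive_eq; rewrite /dsmooth_step /GRing.scale /=; ring.
Qed.

(** Rises from 0 to 1 between x + 1/N and x + 2/N, and falls back to 0 between
   y - 2/N and y - 1/N; hence the shifts 0 and 3. *)
Definition cutoff N x y s := smooth_step (N * (s - x) + 0) - smooth_step (N * (s - y) + 3).
Definition dcutoff N x y s := N * dsmooth_step (N * (s - x) + 0) - N * dsmooth_step (N * (s - y) + 3).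

Lemma is_derive_cutoff N x y s : is_derive s 1 (cutoff N x y) (dcutoff N x y s).
Proof.
have h1 := is_derive_affine (is_derive_smooth_step (N * (s - x) + 0)).
have h2 := is_derive_affine (is_derive_smooth_step (N * (s - y) + 3)).
exact: is_deriveB.
Qed.

Lemma dcutoff_cont N x y : continuous (dcutoff N x y).
Proof. by rewrite /dcutoff; cts; exact: dsmooth_step_cont. Qed.

Lemma cutoff_cont N x y : continuous (cutoff N x y).
Proof. by rewrite /cutoff; cts; exact: smooth_step_cont. Qed.

Lemma cutoff_le N x y s : N * (s - x) <= 1 -> 3 <= N * (y - x) ->
  cutoff N x y s = 0 /\ dcutoff N x y s = 0.
Proof.
move=> h1 h2; have /smooth_step_le1[e1 d1] : N * (s - x) + 0 <= 1 by lra.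
have /smooth_step_le1[e2 d2] : N * (s - y) + 3 <= 1 by nra.
by rewrite /cutoff /dcutoff e1 d1 e2 d2 !mulr0 !subrr.
Qed.

Lemma cutoff_ge N x y s : 2 <= N * (s - y) + 3 -> 3 <= N * (y - x) ->
  cutoff N x y s = 0 /\ dcutoff N x y s = 0.
Proof.
move=> h1 h2; have /smooth_step_ge2[e1 d1] : 2 <= N * (s - x) + 0 by nra.
have [e2 d2] := smooth_step_ge2 h1.
by rewrite /cutoff /dcutoff e1 d1 e2 d2 !mulr0 !subrr.
Qed.

Lemma cutoff_mid N x y s : 2 <= N * (s - x) -> N * (s - y) + 3 <= 1 ->
  cutoff N x y s = 1.
Proof.
move=> h1 h2; have /smooth_step_ge2[e1 _] : 2 <= N * (s - x) + 0 by lra.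
by have [e2 _] := smooth_step_le1 h2; rewrite /cutoff e1 e2 subr0.
Qed.

Lemma cutoff_norm N x y s : `|cutoff N x y s| <= 1.
Proof.
rewrite /cutoff ler_norml; have := smooth_step_itv (N * (s - x) + 0).
have := smooth_step_itv (N * (s - y) + 3); move=> /andP[? ?] /andP[? ?]; apply/andP; split; lra.
Qed.

(** Differentiability is required in the open interval only, so that a function
   frozen outside of [[0, 1]] qualifies. *)
Definition C1pair p q := [/\ continuous p, continuous q &
  forall x, 0 < x < 1 -> is_derive x 1 p (q x)].

Lemma Rintegral_dom_cc f : mu.-integrable dom (EFin \o f) ->
  \int[mu]_(x in dom) f x = \int[mu]_(x in `[0, 1]) f x.
Proof.
move=> fi; rewrite /Rintegral; congr fine; apply/esym/integral_itv_bndoo.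
exact: (measurable_int mu).
Qed.

Lemma integral_C1pair p q : C1pair p q -> \int[mu]_(x in dom) q x = p 1 - p 0.
Proof.
move=> [cp cq dpq]; rewrite Rintegral_dom_cc; last first.
  exact/L2_integrable/L2_continuous.
rewrite /Rintegral (@continuous_FTC2 _ q p 0 1) //.
- exact: continuous_subspaceT.
- split => //.
  + by move=> x; rewrite in_itv /= => /dpq[].
  + by apply: cvg_at_right_filter; exact: cp.
  + by apply: cvg_at_left_filter; exact: cp.
- by move=> x; rewrite in_itv /= derive1E => /dpq h; rewrite derive_val.
Qed.

End cutoff.

(** * Integration by parts for weak derivatives *)

Section weak.
Variable R : realType.
Implicit Types (f g p q : R -> R) (x y z s N : R).
Local Notation mu := (@lebesgue_measure R).
Local Notation dom := (@dom R).

(** The pointwise limit of the cutoff functions. *)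
Definition itv_ind x y s : R := if x < s < y then 1 else 0.

Lemma cutoff_cvg x y s : x < y ->
  cutoff n%:R x y s @[n --> \oo] --> itv_ind x y s.
Proof.
move=> xy; suff H : \forall n \near \oo, cutoff n%:R x y s = itv_ind x y s.
  apply: (@cvg_trans _ ((fun=> itv_ind x y s) @ \oo)); last exact: cvg_cst.
  by apply: near_eq_cvg; near do apply/esym.
rewrite /itv_ind; have [sx|xs] /= := leP s x.
  near=> n; apply: (proj1 (cutoff_le _ _)).
    by apply: (@le_trans _ _ 0) => //; rewrite mulr_ge0_le0 ?subr_le0.
  rewrite -ler_pdivrMr ?subr_gt0 //; near: n; exact: nbhs_infty_ger.
have [ys|sy] /= := leP y s.
  near=> n; apply: (proj1 (cutoff_ge _ _)).
    by rewrite -[2]add0r lerD ?mulr_ge0 ?subr_ge0 ?ler_nat.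
  rewrite -ler_pdivrMr ?subr_gt0 //; near: n; exact: nbhs_infty_ger.
near=> n; apply: cutoff_mid.
  rewrite -ler_pdivrMr ?subr_gt0 //; near: n; exact: nbhs_infty_ger.
suff : 2 <= n%:R * (y - s) by lra.
rewrite -ler_pdivrMr ?subr_gt0 //; near: n; exact: nbhs_infty_ger.
Unshelve. all: by end_near. Qed.

Lemma itv_ind_measurable x y : measurable_fun dom (itv_ind x y).
Proof.
have -> : itv_ind x y = \1_(`]x, y[%classic).
  by apply/funext => s; rewrite /itv_ind indicE; rewrite mem_setE in_itv /=; case: ifP.
by apply: measurable_indic.
Qed.

Lemma itv_ind_norm x y s : `|itv_ind x y s| <= 1.
Proof. by rewrite /itv_ind; case: ifP; rewrite ?normr1 ?normr0 ?ler01. Qed.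

Lemma itv_ind_L2 x y : L2 (itv_ind x y).
Proof.
have := L2_mul_bounded (itv_ind_measurable x y) (fun s _ => itv_ind_norm x y s) (L2_cst 1).
by under eq_fun do rewrite mulr1.
Qed.

Lemma dominated_cutoff (h : R -> R) x y : x < y -> mu.-integrable dom (EFin \o h) ->
  \int[mu]_(s in dom) (h s * cutoff n%:R x y s) @[n --> \oo] -->
  \int[mu]_(s in dom) (h s * itv_ind x y s).
Proof.
move=> xy ih; have /measurable_EFinP mh := measurable_int mu ih.
have mc n : measurable_fun dom (cutoff n%:R x y).
  by apply: measurable_funTS; apply: continuous_measurable_fun; exact: cutoff_cont.
have mhc n : measurable_fun dom (fun s => (h s * cutoff n%:R x y s)%:E).
  by apply/measurable_EFinP; exact: measurable_funM.
have mhi : measurable_fun dom (fun s => (h s * itv_ind x y s)%:E).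
  by apply/measurable_EFinP; apply: measurable_funM => //; exact: itv_ind_measurable.
have cv : forall s, dom s ->
   (h s * cutoff n%:R x y s)%:E @[n --> \oo] --> (h s * itv_ind x y s)%:E.
  move=> s _; apply: cvg_EFin; first by near=> n.
  by apply: cvgM; [exact: cvg_cst|exact: cutoff_cvg].
have ii : mu.-integrable dom (fun s => (h s * itv_ind x y s)%:E).
  apply: (@le_integrable _ _ _ mu dom _ _ (EFin \o h)) => // s _ /=.
  by rewrite lee_fin normrM ler_piMr // itv_ind_norm.
have := @dominated_convergence _ _ R mu dom (@measurable_dom R)
  (fun n s => (h s * cutoff n%:R x y s)%:E) (fun s => (h s * itv_ind x y s)%:E)
  (fun s => `|h s|%:E) mhc mhi _ _ _.
case.
- by apply: aeW => s ds; exact: cv.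
- exact: integrable_norm.
- by apply: aeW => s n _ /=; rewrite lee_fin normrM ler_piMr // cutoff_norm.
move=> _ _ H; apply: fine_cvg; rewrite fineK //.
exact: integrable_fin_num.
Unshelve. all: by end_near. Qed.

(** [n * dsmooth_step (n * (s - x) + c)] is an approximate identity at [x]: it is
   nonnegative, supported within O(1/n) of [x], and of integral 1 as soon as the
   whole transition of the step takes place in the unit interval. *)
Lemma concentrate q x c : continuous q ->
  (\forall n \near \oo, n%:R * (0 - x) + c <= 1) ->
  (\forall n \near \oo, 2 <= n%:R * (1 - x) + c) ->
  \int[mu]_(s in dom) (q s * (n%:R * dsmooth_step (n%:R * (s - x) + c))) @[n --> \oo] --> q x.
Proof.
move=> cq H1 H2; apply/cvgrPdist_le => e e0.
have /cvgrPdist_le/(_ e e0) /= := cq x; case=> d /= d0 Hd.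
near=> n.
pose w s : R := n%:R * dsmooth_step (n%:R * (s - x) + c).
have w0 s : 0 <= w s by rewrite mulr_ge0 ?dsmooth_step_ge0.
have cw : continuous w by rewrite /w; cts; exact: dsmooth_step_cont.
have iw : \int[mu]_(s in dom) (w s) = 1.
  rewrite (@integral_C1pair _ (fun s => smooth_step (n%:R * (s - x) + c))).
    have -> : smooth_step (n%:R * (1 - x) + c) = 1.
      by apply: (proj1 (smooth_step_ge2 _)); near: n.
    have -> : smooth_step (n%:R * (0 - x) + c) = 0.
      by apply: (proj1 (smooth_step_le1 _)); near: n.
    by rewrite subr0.
  split => //; first by cts; exact: smooth_step_cont.
  by move=> s _; apply: is_derive_affine; exact: is_derive_smooth_step.
have close s : `|q x - q s| * w s <= e * w s.
  have [->|ws] := eqVneq (w s) 0; first by rewrite !mulr0.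
  rewrite ler_wpM2r //; apply: Hd => /=.
  have n0 : 0 < n%:R :> R by near: n; exact: nbhs_infty_gtr.
  have b1 : 1 < n%:R * (s - x) + c.
    by rewrite ltNge; apply: contra ws => /smooth_step_le1[_ h]; rewrite /w h mulr0.
  have b2 : n%:R * (s - x) + c < 2.
    by rewrite ltNge; apply: contra ws => /smooth_step_ge2[_ h]; rewrite /w h mulr0.
  suff : n%:R * `|x - s| < n%:R * d by rewrite ltr_pM2l.
  apply: (@le_lt_trans _ _ (2 + `|c|)).
    rewrite -(@ger0_norm _ n%:R) // -normrM ler_norml.
    by have := ler_norm c; have := ler_norm (- c); rewrite normrN => ? ?; apply/andP; split; lra.
  rewrite -ltr_pdivrMr //; near: n; exact: nbhs_infty_gtr.
have icts f : continuous f -> mu.-integrable dom (EFin \o f).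
  by move=> cf; exact/L2_integrable/L2_continuous.
have -> : q x = \int[mu]_(s in dom) (q x * w s) by rewrite RintegralZl ?iw ?mulr1 //; exact: icts.
rewrite -RintegralB //; [|by apply: icts; cts|by apply: icts; cts].
apply: le_trans (le_normr_Rintegral _ _) _ => //.
  by apply: icts; cts.
rewrite -[leRHS]mulr1 -[X in _ <= _ * X]iw -RintegralZl //; last exact: icts.
apply: le_Rintegral => //.
- by apply: integrable_norm; apply: icts; cts.
- by apply: icts; cts.
- move=> s _; rewrite -/(w s) -mulrBl.
  by rewrite normrM (ger0_norm (w0 s)).
Unshelve. all: by end_near. Qed.

Lemma C1_cutoff p q N x y s : C1pair p q -> 0 < N -> 0 <= x -> y <= 1 -> 3 <= N * (y - x) ->
  is_derive s 1 (fun s => p s * cutoff N x y s) (p s * dcutoff N x y s + q s * cutoff N x y s).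
Proof.
move=> [cp cq dpq] N0 x0 y1 Nxy.
have [s0|s0] := leP s 0.
  have h s' : s' < N^-1 -> cutoff N x y s' = 0 /\ dcutoff N x y s' = 0.
    move=> sN; apply: cutoff_le => //; rewrite -ler_pdivlMl // mulr1.
    by apply: le_trans (ltW sN); rewrite gerBl.
  have sN : s < N^-1 by rewrite (le_lt_trans s0) // invr_gt0.
  have [-> ->] := h _ sN; rewrite !mulr0 addr0.
  apply: (@near_eq_is_derive _ _ _ (cst 0)).
  near=> s'; rewrite (proj1 (h s' _)) ?mulr0 //.
  by near: s'; exact: near_lt.
have [s1|s1] := leP 1 s.
  have h s' : 1 - N^-1 < s' -> cutoff N x y s' = 0 /\ dcutoff N x y s' = 0.
    move=> sN; apply: cutoff_ge => //.
    suff : 1 - N^-1 - y < s' - y by rewrite -(@ltr_pM2l _ N) // !mulrBr divff ?gt_eqF //; nra.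
    by rewrite ltrD2r.
  have sN : 1 - N^-1 < s by rewrite (lt_le_trans _ s1) // gtrBl invr_gt0.
  have [-> ->] := h _ sN; rewrite !mulr0 addr0.
  apply: (@near_eq_is_derive _ _ _ (cst 0)).
  near=> s'; rewrite (proj1 (h s' _)) ?mulr0 //.
  by near: s'; exact: near_gt.
have d1 := dpq s; rewrite s0 s1 in d1; have {}d1 := d1 isT.
have d2 := is_derive_cutoff N x y s.
exact: is_deriveMf d1 d2.
Unshelve. all: by end_near. Qed.

Lemma C1_cutoff_test p q N x y : C1pair p q -> 0 < N -> 0 <= x -> y <= 1 -> 3 <= N * (y - x) ->
  test_fun (fun s => p s * cutoff N x y s).
Proof.
move=> pq N0 x0 y1 Nxy; have d s := C1_cutoff s pq N0 x0 y1 Nxy.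
have [cp cq _] := pq; split.
- by move=> s; have [] := d s.
- have -> : derive1 (fun s => p s * cutoff N x y s) =
    (fun s => p s * dcutoff N x y s + q s * cutoff N x y s).
    by apply/funext => s; rewrite derive1E derive_val.
  by cts; [exact: dcutoff_cont|exact: cutoff_cont].
- have Ni : 0 < N^-1 by rewrite invr_gt0.
  exists (x + N^-1), (y - N^-1); split; [lra|lra|].
  move=> s; rewrite in_itv /= negb_and -!ltNge => /orP[h|h].
    rewrite (proj1 (@cutoff_le _ N x y s _ _)) ?mulr0 //.
    by rewrite -ler_pdivlMl // mulr1; lra.
  rewrite (proj1 (@cutoff_ge _ N x y s _ _)) ?mulr0 //.
  suff : - N^-1 < s - y by rewrite -(@ltr_pM2l _ N) // mulrN divff ?gt_eqF //; lra.
  lra.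
Qed.

(** The product of [p] with the cutoff of ]x, y[ is a test function. When the
   cutoff tends to the indicator of the interval, the terms with [q] and [g]
   converge by dominated convergence, and the term with the derivative of the
   cutoff concentrates at [x] and [y], where it leaves the boundary values. *)
Lemma weak_deriv_ibp f g p q x y : {within `[0, 1], continuous f} -> weak_deriv f g ->
  C1pair p q -> 0 <= x -> x < y -> y <= 1 ->
  inner f (fun s => q s * itv_ind x y s) + inner g (fun s => p s * itv_ind x y s) =
  f y * p y - f x * p x.
Proof.
move=> cf [Lg wd] pq x0 xy y1; have [cp cq _] := pq.
pose fc s := f (clamp 0 1 s).
have cfc : continuous fc by apply: clamp_within_cont.
have fE s : s \in `[0, 1] -> fc s = f s by move=> h; rewrite /fc clamp_id.
have Lf : L2 f by exact: L2_within.
have Lp := L2_continuous cp; have Lq := L2_continuous cq.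
have ind_L2 h : L2 h -> L2 (fun s => h s * itv_ind x y s).
  move=> Lh; have := L2_mul_bounded (itv_ind_measurable x y) (fun s _ => itv_ind_norm x y s) Lh.
  by under eq_fun do rewrite mulrC.
pose h s := f s * q s + g s * p s.
have ifq := L2_integrable_mul Lf Lq; have igp := L2_integrable_mul Lg Lp.
have ih : mu.-integrable dom (EFin \o h) by exact: (integrableD _ ifq igp).
have -> : inner f (fun s => q s * itv_ind x y s) + inner g (fun s => p s * itv_ind x y s) =
   \int[mu]_(s in dom) (h s * itv_ind x y s).
  rewrite /inner -RintegralD //; try by apply: L2_integrable_mul => //; exact: ind_L2.
  by apply: eq_Rintegral => s _; rewrite /h; ring.
have := dominated_cutoff xy ih => L1.
have L2 : \int[mu]_(s in dom) ((fc s * p s) * (n%:R * dsmooth_step (n%:R * (s - y) + 3)))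
  - \int[mu]_(s in dom) ((fc s * p s) * (n%:R * dsmooth_step (n%:R * (s - x) + 0)))
   @[n --> \oo] --> fc y * p y - fc x * p x.
  apply: cvgB.
  - apply: (@concentrate (fun s => fc s * p s)); first by cts.
    + near=> n; suff : 2 <= n%:R * y by lra.
      have y0 : 0 < y by lra.
      by rewrite -ler_pdivrMr //; near: n; exact: nbhs_infty_ger.
    + near=> n; suff : 0 <= n%:R * (1 - y) by lra.
      by rewrite mulr_ge0 // subr_ge0.
  - apply: (@concentrate (fun s => fc s * p s)); first by cts.
    + near=> n; suff : 0 <= n%:R * x by lra.
      by rewrite mulr_ge0.
    + near=> n; suff : 2 <= n%:R * (1 - x) by lra.
      have x1 : 0 < 1 - x by lra.
      by rewrite -ler_pdivrMr //; near: n; exact: nbhs_infty_ger.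
have fcE z : 0 <= z <= 1 -> fc z = f z by move=> hz; rewrite fE // in_itv.
rewrite -(fcE y) -?(fcE x); [|lra..].
apply: (cvg_unique _ L1); rewrite //.
apply: cvg_trans L2; apply: near_eq_cvg; near=> n.
have n0 : 0 < n%:R :> R by near: n; exact: nbhs_infty_gtr.
have nxy : 3 <= n%:R * (y - x).
  by rewrite -ler_pdivrMr ?subr_gt0 //; near: n; exact: nbhs_infty_ger.
have tf := C1_cutoff_test pq n0 x0 y1 nxy.
have := wd _ tf.
have -> : derive1 (fun s => p s * cutoff n%:R x y s) =
    (fun s => p s * dcutoff n%:R x y s + q s * cutoff n%:R x y s).
  by apply/funext => s; rewrite derive1E; have h' := C1_cutoff s pq n0 x0 y1 nxy; rewrite derive_val.
have cc := @cutoff_cont R n%:R x y; have cd := @dcutoff_cont R n%:R x y.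
have L_ k : continuous k -> Defs.L2 k := @L2_continuous R k.
rewrite innerDr //; [|by apply: L_; cts|by apply: L_; cts].
have -> : \int[mu]_(s in dom) (h s * cutoff n%:R x y s) =
  inner f (fun s => q s * cutoff n%:R x y s) + inner g (fun s => p s * cutoff n%:R x y s).
  rewrite /inner -RintegralD //; try by apply: L2_integrable_mul => //; apply: L_; cts.
  by apply: eq_Rintegral => s _; rewrite /h; ring.
have E : inner f (fun s => p s * dcutoff n%:R x y s) =
  \int[mu]_(s in dom) ((fc s * p s) * (n%:R * dsmooth_step (n%:R * (s - x) + 0)))
  - \int[mu]_(s in dom) ((fc s * p s) * (n%:R * dsmooth_step (n%:R * (s - y) + 3))).
  have cds := @dsmooth_step_cont R.
  rewrite -RintegralB //; [|by apply: L2_integrable; apply: L_; cts|by apply: L2_integrable; apply: L_; cts].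
  apply: eq_Rintegral => s /set_mem ds; rewrite fE ?dom_cc // /dcutoff; ring.
rewrite E; lra.
Unshelve. all: by end_near. Qed.

End weak.

(** * Weak derivatives, the Poincare inequality and traces *)

Section sobolev_facts.
Variable R : realType.
Implicit Types (f g p q v w phi : R -> R) (x y z s c : R).
Local Notation mu := (@lebesgue_measure R).
Local Notation dom := (@dom R).

Lemma integrable_restrict_dom f : mu.-integrable dom (EFin \o f) ->
  mu.-integrable setT (EFin \o (f \_ dom)).
Proof.
move=> /(integrable_mkcond _ (@measurable_dom R)).1.
by rewrite restrict_EFin.
Qed.

(** The primitive of [d], extended by 0, is constant on the whole line, so that
   its derivative, which is [d] almost everywhere, vanishes. *)
Lemma ae0_of_itv_integrals (d : R -> R) : mu.-integrable dom (EFin \o d) ->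
  (forall x y, 0 <= x -> x < y -> y <= 1 -> \int[mu]_(s in dom) (d s * itv_ind x y s) = 0) ->
  {ae mu, forall s, dom s -> d s = 0}.
Proof.
move=> di d0; have iT := integrable_restrict_dom di.
have iy (y : R) : mu.-integrable `]-oo, y] (EFin \o (d \_ dom)).
  exact: (integrableS _ _ _ iT).
have loc : locally_integrable [set: R] (d \_ dom) by exact: (integrable_locally_restrict (@measurable_dom R) di).
have := FTC1Ny iy loc.
have F0 : (fun x => \int[mu]_(t in `]-oo, x]) (d \_ dom) t) = cst 0.
  apply/funext => x.
  rewrite -Rintegral_itv_bndo_bndc; last exact: (integrableS _ _ _ iT).
  rewrite Rintegral_mkcond.
  have [x0|x0] := leP x 0.
    rewrite (@eq_Rintegral _ _ _ _ _ (cst 0)); last first.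
      move=> s _; rewrite !patchE /= !mem_setE !in_itv /=.
      case: ifP => // sx; case: ifP => // /andP[s0 _].
      by have := lt_le_trans (lt_trans s0 sx) x0; rewrite ltxx.
    by rewrite Rintegral_cst // mul0r.
  have [x1|x1] := leP x 1.
    rewrite -[RHS](d0 0 x) // [RHS]Rintegral_mkcond; apply: eq_Rintegral => s _.
    rewrite !patchE /= !mem_setE !in_itv /= /itv_ind.
    have [s0|s0] := ltP 0 s; last by case: ifP.
    have [sx|sx] /= := ltP s x; last by case: ifP; rewrite ?mulr0.
    by rewrite (lt_le_trans sx x1) mulr1.
  rewrite -[RHS](d0 0 1) // [RHS]Rintegral_mkcond; apply: eq_Rintegral => s _.
  rewrite !patchE /= !mem_setE !in_itv /= /itv_ind.
  have [s0|s0] := ltP 0 s; last by case: ifP.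
  have [s1|s1] /= := ltP s 1; last by case: ifP.
  by rewrite (lt_trans s1 x1) mulr1.
rewrite /= F0; apply: filterS; first exact: (ae_filter_ringOfSetsType mu).
move=> s [_]; rewrite derive1_cst => h ds.
by rewrite [RHS]h patchE mem_set.
Qed.

(** Equality almost everywhere, in the weak form in which it is used: the
   representative of a weak derivative only ever occurs in inner products. *)
Definition weq f g := forall phi, L2 phi -> inner f phi = inner g phi.

Lemma weq_sym f g : weq f g -> weq g f. Proof. by move=> h phi Lp; rewrite h. Qed.

Lemma weq_inner f g : L2 f -> L2 g -> weq f g -> inner f f = inner g g.
Proof. by move=> Lf Lg h; rewrite h // innerC h. Qed.

Lemma weq_nrm f g : L2 f -> L2 g -> weq f g -> nrm f = nrm g.
Proof. by move=> Lf Lg h; rewrite /nrm (weq_inner Lf Lg h). Qed.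

Lemma eq_dom_weq f g : {in dom, f =1 g} -> weq f g.
Proof. by move=> fg phi _; exact: eq_innerl. Qed.

Lemma test_fun_L2 phi : test_fun phi -> L2 (derive1 phi) /\ L2 phi.
Proof.
move=> [d cd _]; split; first exact: L2_continuous.
by apply: L2_continuous => x; apply: differentiable_continuous; apply/derivable1_diffP/d.
Qed.

Lemma weak_deriv_weq f f' g : weq f f' -> weak_deriv f g -> weak_deriv f' g.
Proof.
move=> ff' [Lg h]; split => // phi tp; rewrite -h //.
by have [Ld _] := test_fun_L2 tp; rewrite ff'.
Qed.

(** Functions equal almost everywhere have the same set of weak derivatives, hence
   the same chosen one: this is an equality of representatives. *)
Lemma wder_weq f f' : weq f f' -> wder f = wder f'.
Proof.
move=> h; rewrite /wder; congr (xget _); apply/seteqP; split=> g /=; apply: weak_deriv_weq => //.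
exact: weq_sym.
Qed.

Lemma wderP f g : weak_deriv f g -> weak_deriv f (wder f).
Proof. by move=> h; rewrite /wder; case: xgetP => [y _ //|/(_ g)/(_ h)]. Qed.

Lemma C1pair_cst c : C1pair (fun=> c) (fun=> 0).
Proof. by split=> [||x _]; [exact: cont_cst|exact: cont_cst|exact: is_derive_cst]. Qed.

(** Integration by parts against the constant 1 gives two weak derivatives the
   same integrals over all subintervals. *)
Lemma weak_deriv_unique f g1 g2 : {within `[0, 1], continuous f} ->
  weak_deriv f g1 -> weak_deriv f g2 -> weq g1 g2.
Proof.
move=> cf w1 w2; have [L1 _] := w1; have [L2_ _] := w2.
have Ld : L2 (fun x => g1 x - g2 x) by exact: L2B.
have Hd : {ae mu, forall s, dom s -> g1 s - g2 s = 0}.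
  apply: (@ae0_of_itv_integrals (fun s => g1 s - g2 s)); first exact: L2_integrable.
  move=> x y x0 xy y1.
  have := weak_deriv_ibp cf w1 (C1pair_cst 1) x0 xy y1.
  rewrite -(weak_deriv_ibp cf w2 (C1pair_cst 1) x0 xy y1) => /addrI.
  have Li := L2Z 1 (itv_ind_L2 x y).
  move=> e; have := innerBl L1 L2_ Li; rewrite e subrr => <-.
  by apply: eq_Rintegral => s _; rewrite mul1r.
move=> phi Lp; apply/eqP; rewrite -subr_eq0 -innerBl //; apply/eqP.
rewrite /inner /Rintegral (ae_eq_integral (cst 0%E)) ?integral0 //.
- exact: (measurable_int mu (L2_integrable_mul Ld Lp)).
- apply: filterS Hd; first exact: (ae_filter_ringOfSetsType mu).
  by move=> s h ds /=; rewrite h // mul0r.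
Qed.

Lemma test_fun_out phi x : test_fun phi -> (x <= 0) || (1 <= x) -> phi x = 0.
Proof.
move=> [_ _ [a [b [a0 b1 h]]]] hx; apply: h; rewrite in_itv /= negb_and -!ltNge.
by case/orP: hx => hx; [rewrite (le_lt_trans hx a0)|rewrite (lt_le_trans b1 hx) orbT].
Qed.

Lemma C1pair_weak_deriv p q : C1pair p q -> weak_deriv p q.
Proof.
move=> [cp cq dpq]; split; first exact: L2_continuous.
move=> phi tp; have [Ld Lp] := test_fun_L2 tp; have [d cd _] := tp.
have cphi : continuous phi.
  by move=> x; apply: differentiable_continuous; apply/derivable1_diffP/d.
have pq : C1pair (fun s => p s * phi s) (fun s => p s * derive1 phi s + q s * phi s).
  split; [by cts|by cts|].
  move=> x /dpq d1; have d2 : is_derive x 1 phi (derive1 phi x) by rewrite derive1E; exact: derivableP.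
  exact: is_deriveMf d1 d2.
have := integral_C1pair pq.
rewrite !(test_fun_out tp) ?lexx ?orbT // !mulr0 subrr RintegralD //.
- by move/eqP; rewrite addr_eq0 => /eqP.
- exact: (L2_integrable_mul (L2_continuous cp) Ld).
- exact: (L2_integrable_mul (L2_continuous cq) Lp).
Qed.

Lemma C1pair_within p q : C1pair p q -> {within `[0, 1], continuous p}.
Proof. by move=> [cp _ _]; exact: continuous_subspaceT. Qed.

Lemma C1pair_wder p q : C1pair p q -> weq (wder p) q.
Proof.
move=> pq; have wd := C1pair_weak_deriv pq.
exact: weak_deriv_unique (C1pair_within pq) (wderP wd) wd.
Qed.

(** The iterates of [wder] are taken on chosen representatives; a chain of
   classical derivatives identifies each of them almost everywhere. *)
Lemma chain_wder (P : nat -> R -> R) (s : nat) :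
  (forall l, (l < s)%N -> C1pair (P l) (P l.+1)) ->
  forall l, (l <= s)%N -> weq (iter l (@wder R) (P 0)) (P l).
Proof.
move=> H; elim=> [//|l IH] ls.
by rewrite iterS (wder_weq (IH (ltnW ls))); apply: C1pair_wder; exact: H.
Qed.

Lemma chain_sobolev (P : nat -> R -> R) (s : nat) :
  (forall l, (l < s)%N -> C1pair (P l) (P l.+1)) -> (0 < s)%N ->
  sobolev s (P 0).
Proof.
move=> H s0; have [c0 c1 d01] := H _ s0; split.
- exact: continuous_subspaceT.
- exact: L2_continuous.
- move=> l ls; apply: (@wderP _ (P l.+1)).
  apply: weak_deriv_weq (C1pair_weak_deriv (H l ls)).
  by apply: weq_sym; apply: (chain_wder H); exact: ltnW.
Qed.

Lemma sobolev_iter_L2 (s : nat) v (l : nat) : sobolev s v -> (l <= s)%N -> L2 (iter l (@wder R) v).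
Proof. by case=> _ Lv h; case: l => [|l ls]; [by []|by have [] := h _ ls]. Qed.

Lemma chain_inner (P : nat -> R -> R) (s l : nat) :
  (forall l, (l < s)%N -> C1pair (P l) (P l.+1)) -> (0 < s)%N -> (l <= s)%N ->
  inner (iter l (@wder R) (P 0)) (iter l (@wder R) (P 0)) = inner (P l) (P l).
Proof.
move=> H s0 ls; apply: weq_inner; last exact: (chain_wder H).
- exact: (sobolev_iter_L2 (chain_sobolev H s0)).
- case: l ls => [|l] ls; apply: L2_continuous; first by have [] := H _ s0.
  by have [] := H _ ls.
Qed.

Lemma chain_Hnorm (P : nat -> R -> R) (s : nat) :
  (forall l, (l < s)%N -> C1pair (P l) (P l.+1)) -> (0 < s)%N ->
  Hnorm s (P 0) = Num.sqrt (\sum_(l < s.+1) inner (P l) (P l)).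
Proof.
move=> H s0; rewrite /Hnorm; congr Num.sqrt; apply: eq_bigr => l _.
by apply: (chain_inner H s0); rewrite -ltnS.
Qed.

Definition H1 v := sobolev 1 v.

Lemma H1P v : H1 v -> [/\ {within `[0, 1], continuous v}, L2 v, L2 (wder v) &
  weak_deriv v (wder v)].
Proof. by case=> c L /(_ 0%N isT) /= h; split => //; case: h. Qed.

Lemma H1_intro v g : {within `[0, 1], continuous v} -> weak_deriv v g ->
  H1 v /\ weq (wder v) g.
Proof.
move=> cv wg; have wd := wderP wg; split; last exact: weak_deriv_unique cv wd wg.
split; [exact: cv|exact: L2_within|].
move=> l; rewrite ltnS leqn0 => /eqP ->.
exact: wd.
Qed.

Lemma H1_C1 p q : C1pair p q -> H1 p.
Proof. by move=> pq; have [] := H1_intro (C1pair_within pq) (C1pair_weak_deriv pq). Qed.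

Lemma within_lin c v w : {within `[0, 1], continuous v} -> {within `[0, 1], continuous w} ->
  {within `[0, 1], continuous (fun x => c * v x + w x)}.
Proof.
move=> /subspace_continuousP cv /subspace_continuousP cw.
apply/subspace_continuousP => x hx; apply: cvgD; last exact: cw.
by apply: cvgM; [exact: cvg_cst|exact: cv].
Qed.

Lemma H1_lin_pair c v w : H1 v -> H1 w -> H1 (fun x => c * v x + w x) /\
  weq (wder (fun x => c * v x + w x)) (fun x => c * wder v x + wder w x).
Proof.
move=> /H1P[cv Lv Ldv wv] /H1P[cw Lw Ldw ww].
apply: H1_intro; first exact: within_lin.
split; first exact: L2_lin.
move=> phi tp; have [Ld Lp] := test_fun_L2 tp.
by rewrite (inner_linl c Lv Lw Ld) (inner_linl c Ldv Ldw Lp) (proj2 wv _ tp) (proj2 ww _ tp) mulrN -opprD.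
Qed.

Lemma H1_lin c v w : H1 v -> H1 w -> H1 (fun x => c * v x + w x).
Proof. by move=> hv hw; have [] := H1_lin_pair c hv hw. Qed.

Lemma H1_wder_L2 v : H1 v -> L2 (wder v).
Proof. by move/H1P=> []. Qed.
Lemma H1_L2 v : H1 v -> L2 v.
Proof. by move/H1P=> []. Qed.

Lemma wder_lin c v w phi : H1 v -> H1 w -> L2 phi ->
  inner (wder (fun x => c * v x + w x)) phi = c * inner (wder v) phi + inner (wder w) phi.
Proof.
move=> hv hw Lp; have [_ ->] // := H1_lin_pair c hv hw.
by rewrite inner_linl //; exact: H1_wder_L2.
Qed.

Lemma bformC v w : bform v w = bform w v. Proof. exact: innerC. Qed.

Lemma bform_linl c v w phi : H1 v -> H1 w -> H1 phi ->
  bform (fun x => c * v x + w x) phi = c * bform v phi + bform w phi.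
Proof. by move=> hv hw hp; apply: wder_lin => //; exact: H1_wder_L2. Qed.

Lemma H1_ibp v p q : H1 v -> C1pair p q ->
  inner v q + inner (wder v) p = v 1 * p 1 - v 0 * p 0.
Proof.
move=> /H1P[cv _ _ wv] pq; rewrite -(weak_deriv_ibp cv wv pq (lexx 0) ltr01 (lexx 1)).
by congr (_ + _); apply: eq_innerr => s /set_mem; rewrite domE /itv_ind => ->; rewrite mulr1.
Qed.

(** [v x] is the integral of the weak derivative over ]0, x[. *)
Lemma H1_bound v x : H1 v -> v 0 = 0 -> 0 <= x <= 1 -> `|v x| <= nrm (wder v).
Proof.
move=> /H1P[cv _ Ld wv] v0 /andP[]; rewrite le_eqVlt => /orP[/eqP <- _|x0 x1].
  by rewrite v0 normr0 nrm_ge0.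
have := weak_deriv_ibp cv wv (C1pair_cst 1) (lexx 0) x0 x1.
rewrite v0 mulr1 mul0r subr0 => <-.
rewrite [X in X + _](_ : _ = 0) ?add0r; last first.
  rewrite /inner; under eq_Rintegral do rewrite mul0r mulr0.
  by rewrite Rintegral_cst // mul0r.
rewrite (_ : (fun s => 1 * itv_ind 0 x s) = itv_ind 0 x); last by apply/funext => s; rewrite mul1r.
apply: (le_trans (cauchy_schwarz Ld (itv_ind_L2 0 x))).
rewrite ler_piMr ?nrm_ge0 //; apply: nrm_bounded => //; first exact: itv_ind_measurable.
by move=> s _; exact: itv_ind_norm.
Qed.

Lemma poincare v : H1 v -> v 0 = 0 -> nrm v <= nrm (wder v).
Proof.
move=> hv v0; apply: nrm_bounded; [exact: nrm_ge0| |].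
  by apply: within01_measurable; have [] := H1P hv.
by move=> x; rewrite domE => /andP[/ltW x0 /ltW x1]; apply: H1_bound => //; rewrite x0.
Qed.

Lemma C1pair_exp (m : nat) : C1pair (fun x : R => x ^+ m.+1) (fun x => m.+1%:R * x ^+ m).
Proof.
have cX k : continuous (fun x : R => x ^+ k) by move=> x; exact: exprn_continuous.
split; [exact: cX|by cts; exact: cX|].
move=> x _; have -> : (fun x : R => x ^+ m.+1) = (id : R -> R) ^+ m.+1.
  by apply/funext => y; rewrite fctE.
by apply: is_derive_eq; rewrite /GRing.scale /= mulr1 mulr_natl.
Qed.

Lemma nrm_exp (m : nat) : nrm (fun x : R => x ^+ m) ^+ 2 = (m.*2.+1%:R)^-1.
Proof.
rewrite nrm_sqr /inner; have [c1 c2 d] := C1pair_exp m.*2.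
have := integral_C1pair (And3 c1 c2 d).
rewrite expr1n expr0n subr0 RintegralZl //; last first.
  by apply/L2_integrable/L2_continuous => x; exact: exprn_continuous.
move=> h; apply: (@mulfI _ m.*2.+1%:R); first by rewrite pnatr_eq0.
rewrite divff ?pnatr_eq0 // -[RHS]h; congr (_ * _); apply: eq_Rintegral => s _.
by rewrite -exprD addnn.
Qed.

(** Integration by parts against [x ^+ m.+1]: the norm of a high power is small,
   which makes the coefficient of the derivative as small as desired. *)
Lemma trace_ineq v (m : nat) : H1 v ->
  v 1 ^+ 2 <= 2 * m.+1%:R ^+ 2 * nrm v ^+ 2 + 2 / (m.+1).*2.+1%:R * nrm (wder v) ^+ 2.
Proof.
move=> hv; have := H1_ibp hv (C1pair_exp m).
rewrite expr1n mulr1 expr0n mulr0 subr0 => <-.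
have cX k : L2 (fun x : R => x ^+ k) by apply: L2_continuous => x; exact: exprn_continuous.
have [_ Lv Ld _] := H1P hv.
have h1 : `|inner v (fun x => m.+1%:R * x ^+ m)| <= m.+1%:R * nrm v.
  apply: le_trans (cauchy_schwarz Lv (L2Z _ (cX m))) _.
  rewrite mulrC ler_wpM2r ?nrm_ge0 //; apply: nrm_bounded; first exact: ler0n.
    by apply: measurable_funTS; apply: continuous_measurable_fun; cts => x; exact: exprn_continuous.
  move=> x; rewrite domE => /andP[/ltW x0 /ltW x1].
  by rewrite normrM ger0_norm // ler_piMr // normrX exprn_ile1 // ger0_norm.
have := cauchy_schwarz Ld (cX m.+1).
set A := inner _ _ in h1 *; set B := inner _ _; set n1 := nrm (wder v); set n2 := nrm (fun x => x ^+ m.+1).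
move=> h2; have -> : 2 / (m.+1).*2.+1%:R * n1 ^+ 2 = 2 * (n1 * n2) ^+ 2.
  by rewrite exprMn nrm_exp; ring.
have h1' : A ^+ 2 <= (m.+1%:R * nrm v) ^+ 2.
  by rewrite -(real_normK (num_real A)) lerXn2r ?nnegrE ?mulr_ge0 ?nrm_ge0.
have h2' : B ^+ 2 <= (n1 * n2) ^+ 2.
  by rewrite -(real_normK (num_real B)) lerXn2r ?nnegrE ?mulr_ge0 ?nrm_ge0.
rewrite -mulrA -exprMn -mulrDr.
by have := sqr_ge0 (A - B); nra.
Qed.

Lemma Hnorm0E v : Hnorm 0 v = nrm v.
Proof. by rewrite /Hnorm big_ord_recl big_ord0 addr0. Qed.

Lemma Hnorm1E v : Hnorm 1 v = Num.sqrt (nrm v ^+ 2 + nrm (wder v) ^+ 2).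
Proof. by rewrite /Hnorm !big_ord_recl big_ord0 addr0 /= !nrm_sqr. Qed.

Lemma le_inner_pointwise f g : L2 f -> L2 g -> (forall x, dom x -> `|f x| <= `|g x|) ->
  inner f f <= inner g g.
Proof.
move=> Lf Lg fg; apply: le_Rintegral => //; [exact: L2_integrable_mul|exact: L2_integrable_mul|].
move=> x dx; rewrite -!expr2 -(real_normK (num_real (f x))) -(real_normK (num_real (g x))).
by rewrite lerXn2r ?nnegrE //; exact: fg.
Qed.

Lemma bformE v w : bform v w = inner (wder v) (wder w).
Proof. by []. Qed.

Lemma inner0l phi : inner (fun=> 0) phi = 0.
Proof. by rewrite /inner; under eq_Rintegral do rewrite mul0r; rewrite Rintegral_cst // mul0r. Qed.

Lemma eq_nrm f g : {in dom, f =1 g} -> nrm f = nrm g.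
Proof. by move=> fg; rewrite /nrm (eq_innerl _ fg) (eq_innerr _ fg). Qed.

Lemma eq_H1_wder v w : {in `[0, 1], v =1 w} -> wder v = wder w.
Proof.
by move=> vw; apply: wder_weq; apply: eq_dom_weq => x /set_mem /dom_cc; exact: vw.
Qed.

Lemma eq_Hnorm (s : nat) f g : {in `[0, 1], f =1 g} -> Hnorm s f = Hnorm s g.
Proof.
move=> fg; rewrite /Hnorm; congr Num.sqrt; apply: eq_bigr => -[[|l] ls] _ /=.
  have fg' : {in @Defs.dom R, f =1 g} by move=> x /set_mem /dom_cc; exact: fg.
  by rewrite (eq_innerl _ fg') (eq_innerr _ fg').
by rewrite -!iterS !iterSr (eq_H1_wder fg).
Qed.

End sobolev_facts.

(** * The elliptic projection *)

Opaque wder bform inner nrm Hnorm.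

Section projection.
Variable R : realType.
Implicit Types (f g p q v w phi psi chi : R -> R) (x y z c h : R) (Sh : set (R -> R)).
Local Notation mu := (@lebesgue_measure R).
Local Notation dom := (@dom R).

Lemma H1B v w : H1 v -> H1 w -> H1 (fun x => v x - w x).
Proof.
move=> hv hw; have := H1_lin (-1) hw hv.
by under eq_fun do rewrite mulN1r addrC.
Qed.

Lemma wderB v w phi : H1 v -> H1 w -> L2 phi ->
  inner (wder (fun x => v x - w x)) phi = inner (wder v) phi - inner (wder w) phi.
Proof.
move=> hv hw Lp; have := wder_lin (-1) hw hv Lp; rewrite mulN1r addrC => <-.
by congr (inner (wder _) phi); apply/funext => x; rewrite mulN1r addrC.
Qed.

Lemma bformBl v w phi : H1 v -> H1 w -> H1 phi ->
  bform (fun x => v x - w x) phi = bform v phi - bform w phi.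
Proof. by move=> hv hw hp; rewrite !bformE; exact: (wderB hv hw (H1_wder_L2 hp)). Qed.

Lemma bformBr v w phi : H1 v -> H1 w -> H1 phi ->
  bform phi (fun x => v x - w x) = bform phi v - bform phi w.
Proof. by move=> hv hw hp; rewrite bformC (bformBl hv hw hp) (bformC v) (bformC w). Qed.

Lemma bform_sqr v : bform v v = nrm (wder v) ^+ 2.
Proof. by rewrite bformE nrm_sqr. Qed.

Lemma bform_CS v w : H1 v -> H1 w -> `|bform v w| <= nrm (wder v) * nrm (wder w).
Proof. by move=> hv hw; rewrite bformE; apply: cauchy_schwarz; exact: H1_wder_L2. Qed.

Lemma bform0l phi : H1 phi -> bform (fun=> 0) phi = 0.
Proof.
move=> hp; rewrite bformE (C1pair_wder (C1pair_cst 0) (H1_wder_L2 hp)).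
exact: inner0l.
Qed.

Section space.
Variable Sh : set (R -> R).
Hypothesis Sh0 : Sh (fun=> 0).
Hypothesis Sh_lin : forall c v w, Sh v -> Sh w -> Sh (fun x => c * v x + w x).
Hypothesis Sh_H1 : forall v, Sh v -> sobolev0 1 v.

Lemma Sh_is_H1 v : Sh v -> H1 v. Proof. by move=> /Sh_H1[]. Qed.
Lemma Sh_at0 v : Sh v -> v 0 = 0. Proof. by move=> /Sh_H1[]. Qed.

Lemma ShB v w : Sh v -> Sh w -> Sh (fun x => v x - w x).
Proof.
move=> hv hw; have := Sh_lin (-1) hw hv.
by under eq_fun do rewrite mulN1r addrC.
Qed.

Lemma ShZ c v : Sh v -> Sh (fun x => c * v x).
Proof. by move=> hv; have := Sh_lin c hv Sh0; under eq_fun do rewrite addr0. Qed.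

Lemma comb_bform (I : Type) (s : seq I) (c : I -> R) (b : I -> R -> R) :
  (forall i, Sh (b i)) ->
  Sh (fun x => \sum_(i <- s) c i * b i x) /\
  forall phi, H1 phi ->
    bform (fun x => \sum_(i <- s) c i * b i x) phi = \sum_(i <- s) c i * bform (b i) phi.
Proof.
move=> hb; elim: s => [|i s [IH1 IH2]].
  have -> : (fun x => \sum_(i <- [::]) c i * b i x) = (fun=> 0).
    by apply/funext => x; rewrite big_nil.
  by split => // phi hp; rewrite big_nil; exact: bform0l.
have -> : (fun x => \sum_(j <- i :: s) c j * b j x) =
   (fun x => c i * b i x + \sum_(j <- s) c j * b j x).
  by apply/funext => x; rewrite big_cons.
split; first exact: (Sh_lin (c i) (hb i) IH1).
move=> phi hp; rewrite big_cons -IH2 //.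
exact: (bform_linl (c i) (Sh_is_H1 (hb i)) (Sh_is_H1 IH1) hp).
Qed.

(** The Gram system is solvable because a combination in the kernel of the Gram
   matrix has zero energy, hence is orthogonal to every function. *)
Lemma elliptic_projection_exists v : fin_dim Sh -> H1 v ->
  exists w, is_elliptic_projection Sh v w.
Proof.
move=> [d [b [hb bgen]]] hv.
pose G : 'M[R]_d := \matrix_(i, j) bform (b i) (b j).
pose rhs : 'rV[R]_d := \row_j bform v (b j).
have bH i := Sh_is_H1 (hb i).
have sub : (rhs <= G)%MS.
  (* [w] is the combination given by a vector in the kernel of the Gram matrix. *)
  rewrite submxE; apply/eqP/matrixP => i j; rewrite !mxE.
  pose y k := cokermx G k j.
  have [wS wB] := comb_bform (index_enum 'I_d) y hb.
  set w := (fun x => _) in wS wB.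
  have wH := Sh_is_H1 wS.
  have bw k : bform (b k) w = 0.
    have /matrixP/(_ k j) := mulmx_coker G; rewrite !mxE => <-.
    rewrite bformC (wB _ (bH k)); apply: eq_bigr => l _.
    by rewrite mxE bformC mulrC.
  have ww : nrm (wder w) = 0.
    apply/eqP; rewrite -sqrf_eq0 -bform_sqr (wB _ wH) big1 // => k _.
    by rewrite bw mulr0.
  have vw : bform v w = 0.
    by apply/eqP; rewrite -normr_le0 (le_trans (bform_CS hv wH)) // ww mulr0.
  rewrite -[RHS]vw bformC (wB _ hv); apply: eq_bigr => k _.
  by rewrite [rhs _ _]mxE bformC mulrC.
have [D HD] := submxP sub.
have [wS wB] := comb_bform (index_enum 'I_d) (fun k => D 0 k) hb.
set w := (fun x => _) in wS wB.
have wH := Sh_is_H1 wS.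
exists w; split; first exact: wS.
move=> phi hphi.
have [c hc] := bgen _ hphi.
have [pS pB] := comb_bform (index_enum 'I_d) c hb.
set ph := (fun x => _) in pS pB.
have E : wder phi = wder ph by apply: eq_H1_wder => x hx; rewrite hc.
have -> : bform w phi = bform w ph by rewrite !bformE E.
have -> : bform v phi = bform v ph by rewrite !bformE E.
apply: etrans (bformC w ph) _; apply: etrans (pB _ wH) _.
apply/esym; apply: etrans (bformC v ph) _; apply: etrans (pB _ hv) _; apply/esym.
apply: eq_bigr => k _.
suff -> : bform (b k) w = bform (b k) v by [].
apply: etrans (bformC (b k) w) _; apply: etrans (wB _ (bH k)) _.
apply/esym; apply: etrans (bformC (b k) v) _; apply/esym.
have /matrixP/(_ 0 k) := HD; rewrite !mxE => ->.
by apply: eq_bigr => l _; rewrite mxE.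
Qed.

Variables (v w : R -> R).
Hypotheses (vH : H1 v) (wv : is_elliptic_projection Sh v w).
Local Notation e := (fun x => v x - w x).

Lemma projection_orth phi : Sh phi -> bform e phi = 0.
Proof.
have [wS h] := wv; move=> hp.
rewrite (bformBl vH (Sh_is_H1 wS) (Sh_is_H1 hp)); apply/eqP; rewrite subr_eq0; apply/eqP/esym.
exact: h.
Qed.

Lemma projection_err_H1 : H1 e.
Proof. by have [wS _] := wv; exact: (H1B vH (Sh_is_H1 wS)). Qed.

Lemma projection_best chi : Sh chi -> nrm (wder e) <= nrm (wder (fun x => v x - chi x)).
Proof.
move=> hc; have [wS _] := wv; have eH := projection_err_H1.
have cH := Sh_is_H1 hc; have wH := Sh_is_H1 wS.
have E : bform e e = bform e (fun x => v x - chi x).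
  have -> : bform e e = bform e v - bform e w by exact: (bformBr vH wH eH).
  by rewrite (bformBr vH cH eH) (projection_orth wS) (projection_orth hc).
have := le_trans (ler_norm _) (bform_CS eH (H1B vH cH)); rewrite -E bform_sqr expr2.
have := nrm_ge0 (wder e); rewrite le_eqVlt => /orP[/eqP <- _|e0]; first exact: nrm_ge0.
by rewrite ler_pM2l.
Qed.

End space.

Lemma primitive q : continuous q -> exists2 p, C1pair p q & p 0 = 0.
Proof.
move=> cq; pose F y := \int[mu]_(t in `[0, y]) q t.
have iq (u : R) : mu.-integrable `[0, u] (EFin \o q).
  by apply: continuous_compact_integrable; [exact: segment_compact|exact: continuous_subspaceT].
have cF : {within `[0, 1], continuous F}.
  exact: (parameterized_integral_continuous ler01 (iq 1)).
exists (fun x => F (clamp 0 1 x)).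
  split; [exact: clamp_within_cont|exact: cq|].
  move=> x /andP[x0 x1]; have x2 : x < 2 by lra.
  have [dF Fx] := continuous_FTC1_closed x2 (iq 2) x0 (cq x).
  have {dF Fx} dF : is_derive x 1 F (q x) by split; [exact: dF|rewrite -derive1E; exact: Fx].
  apply: near_eq_is_derive dF; near=> s; rewrite clamp_id // in_itv /=.
  by apply/andP; split; apply: ltW; near: s; [exact: near_gt|exact: near_lt].
by rewrite clamp_id ?in_itv /= ?lexx ?ler01 // /F set_itv1 Rintegral_set1.
Unshelve. all: by end_near. Qed.

Section estimate.
Variables (r : nat) (hstar : R) (S : R -> set (R -> R)).
Hypothesis r1 : (1 <= r)%N.
Hypothesis S_fe : fe_family r hstar S.

Lemma sobolev_H1 s v : sobolev s.+1 v -> H1 v.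
Proof.
move=> [cv Lv h]; split; [exact: cv|exact: Lv|].
move=> l; rewrite ltnS leqn0 => /eqP ->; exact: (h 0%N).
Qed.

Lemma Hnorm_ge0 s v : 0 <= Hnorm s v.
Proof. exact: sqrtr_ge0. Qed.

(** The approximation property bounds an infimum that need not be attained; any
   positive [d] yields an actual element of the space. *)
Lemma approx_adherent : exists2 Ca : R, 0 <= Ca & forall h, 0 < h <= hstar ->
  forall s, (s <= r)%N -> forall v, sobolev0 s.+1 v -> forall d : R, 0 < d ->
  exists2 chi, S h chi &
    h * nrm (wder (fun x => v x - chi x)) <= Ca * h ^+ s.+1 * Hnorm s.+1 v + d.
Proof.
have [fe [C HC]] := S_fe; exists (Num.max 0 C); first by rewrite le_max lexx.
move=> h hh s sr v vs d d0; have h0 : 0 < h by case/andP: hh.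
have [[S0 _] _ _ _ _] := fe h hh.
pose E := [set Hnorm 0 (v \- chi) + h * Hnorm 1 (v \- chi) | chi in S h].
have hE : has_inf E.
  split; first by exists (Hnorm 0 (v \- (fun=> 0)) + h * Hnorm 1 (v \- (fun=> 0))), (fun=> 0).
  by exists 0 => _ [chi _ <-]; rewrite addr_ge0 ?mulr_ge0 ?Hnorm_ge0 // ltW.
have [_ [chi hchi <-] lt] := inf_adherent d0 hE.
exists chi => //; set n := nrm _.
have nH : n <= Hnorm 1 (v \- chi).
  rewrite Hnorm1E -[leLHS]ger0_norm ?nrm_ge0 // -sqrtr_sqr ler_sqrt ?addr_ge0 ?sqr_ge0 //.
  by rewrite lerDr sqr_ge0.
apply: (@le_trans _ _ (Hnorm 0 (v \- chi) + h * Hnorm 1 (v \- chi))).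
  by rewrite -[leLHS]add0r lerD ?Hnorm_ge0 // ler_wpM2l // ltW.
apply: (le_trans (ltW lt)); rewrite lerD2r (le_trans (HC h hh s sr v vs)) //.
rewrite -!mulrA ler_wpM2r ?mulr_ge0 ?Hnorm_ge0 ?exprn_ge0 ?(ltW h0) //.
by rewrite le_max lexx orbT.
Qed.

(** Duality: let psi solve - psi'' = e with psi(0) = 0 and psi'(1) = 0. Then
   |e|^2 = B(e, psi) = B(e, psi - chi) for every chi in the space; a suitable chi
   makes the energy norm of psi - chi at most C h |e|, since psi is in H^2 with
   norm at most 3 |e|. *)
Lemma aubin_nitsche Ca h e : 0 <= Ca -> 0 < h -> H1 e -> e 0 = 0 ->
  (forall v, S h v -> H1 v) ->
  (forall v, sobolev0 2 v -> forall d : R, 0 < d -> exists2 chi, S h chi &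
    h * nrm (wder (fun x => v x - chi x)) <= Ca * h ^+ 2 * Hnorm 2 v + d) ->
  (forall phi, S h phi -> bform e phi = 0) ->
  nrm e <= 3 * Ca * h * nrm (wder e).
Proof.
move=> Ca0 h0 eH e0 SH app orth.
have [ce Le Lde we] := H1P eH.
pose et x := e (clamp 0 1 x).
have cet : continuous et by exact: clamp_within_cont.
have etE : {in dom, et =1 e}.
  by move=> x /set_mem /dom_cc x01; rewrite /et clamp_id.
(* psi is built by two primitives, after [e] is extended continuously. *)
have [P CP P0] := primitive cet.
pose psi1 x := P 1 - P x.
have [cP _ dP] := CP.
have Cpsi1 : C1pair psi1 (fun x => - et x).
  split; [by rewrite /psi1; cts|by cts|] => x /dP d.
  have -> : psi1 = cst (P 1) - P by [].
  by apply: is_derive_eq; rewrite sub0r.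
have cpsi1 : continuous psi1 by case: Cpsi1.
have [psi Cpsi psi0] := primitive cpsi1.
have net : nrm et = nrm e by exact: eq_nrm.
have Pb x : 0 <= x <= 1 -> `|P x| <= nrm e.
  move=> hx; apply: le_trans (H1_bound (H1_C1 CP) P0 hx) _.
  rewrite (weq_nrm (H1_wder_L2 (H1_C1 CP)) (L2_continuous cet) (C1pair_wder CP)).
  by rewrite net.
have n1 : nrm psi1 <= 2 * nrm e.
  apply: nrm_bounded; first by rewrite mulr_ge0 ?nrm_ge0.
    by apply: measurable_funTS; exact: continuous_measurable_fun.
  move=> x; rewrite domE => /andP[/ltW x0 /ltW x1]; rewrite mulr_natl mulr2n.
  apply: le_trans (ler_normB _ _) _; apply: lerD; apply: Pb.
    by rewrite ler01 lexx.
  by rewrite x0.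
have wpsi := C1pair_wder Cpsi.
have n0 : nrm psi <= 2 * nrm e.
  apply: le_trans (poincare (H1_C1 Cpsi) psi0) _.
  by rewrite (weq_nrm (H1_wder_L2 (H1_C1 Cpsi)) (L2_continuous cpsi1) wpsi).
pose Q (l : nat) := match l with 0 => psi | 1 => psi1 | _ => fun x => - et x end.
have CQ l : (l < 2)%N -> C1pair (Q l) (Q l.+1) by case: l => [|[|]].
have psis : sobolev0 2 psi by split; [exact: (chain_sobolev CQ)|exact: psi0].
have Hpsi : Hnorm 2 psi <= 3 * nrm e.
  have -> : Hnorm 2 psi = Num.sqrt (nrm psi ^+ 2 + nrm psi1 ^+ 2 + nrm e ^+ 2).
    rewrite (chain_Hnorm CQ) // !big_ord_recl big_ord0 /= addr0 addrA -!nrm_sqr.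
    congr (Num.sqrt (_ + _ ^+ 2)); rewrite -net.
    have -> : (fun x => - et x) = (fun x => -1 * et x) by apply/funext => x; rewrite mulN1r.
    by rewrite (nrmZ _ (L2_continuous cet)) normrN1 mul1r.
  rewrite -[leRHS]ger0_norm ?mulr_ge0 ?nrm_ge0 // -sqrtr_sqr ler_sqrt ?sqr_ge0 //.
  by have := nrm_ge0 e; have := nrm_ge0 psi; have := nrm_ge0 psi1; nra.
have psiH := H1_C1 Cpsi.
have key : nrm e ^+ 2 = bform e psi.
  rewrite bformC bformE (wpsi _ Lde) innerC nrm_sqr.
  have := H1_ibp eH Cpsi1; rewrite /psi1 subrr mulr0 e0 mul0r subrr.
  have -> : (fun x => - et x) = (fun x => -1 * et x) by apply/funext => x; rewrite mulN1r.
  rewrite (innerZr _ (L2_continuous cet) Le) (eq_innerr _ etE) mulN1r.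
  by move/eqP; rewrite addrC subr_eq0 => /eqP ->.
have ene := nrm_ge0 (wder e).
have main (d : R) : 0 < d -> h * nrm e ^+ 2 <= nrm (wder e) * (3 * Ca * h ^+ 2 * nrm e) + nrm (wder e) * d.
  move=> d0; have [chi chiS hchi] := app psi psis d d0.
  have cH := SH _ chiS.
  have : nrm e ^+ 2 <= nrm (wder e) * nrm (wder (fun x => psi x - chi x)).
    have := bform_CS eH (H1B psiH cH).
    rewrite (bformBr psiH cH eH) (orth _ chiS) subr0 -key; exact: le_trans (ler_norm _).
  move=> le1; apply: (@le_trans _ _ (nrm (wder e) * (h * nrm (wder (fun x => psi x - chi x))))).
    by rewrite [leRHS]mulrCA ler_pM2l.
  rewrite -mulrDr ler_wpM2l //; apply: (le_trans hchi); rewrite lerD2r.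
  have -> : 3 * Ca * h ^+ 2 * nrm e = Ca * h ^+ 2 * (3 * nrm e) by ring.
  by rewrite ler_wpM2l // mulr_ge0 // sqr_ge0.
have {main} main : h * nrm e ^+ 2 <= nrm (wder e) * (3 * Ca * h ^+ 2 * nrm e).
  apply/ler_addgt0Pr => d d0.
  have w1 : 0 < nrm (wder e) + 1 by lra.
  apply: le_trans (main (d / (nrm (wder e) + 1)) (divr_gt0 d0 w1)) _.
  rewrite lerD2l mulrCA ler_piMr ?(ltW d0) // ler_pdivrMr // mul1r; lra.
have := nrm_ge0 e; rewrite le_eqVlt => /orP[/eqP <-|en0].
  by rewrite !mulr_ge0 // ltW.
rewrite -(@ler_pM2l _ (h * nrm e)) ?mulr_gt0 //.
by move: main; rewrite expr2; nra.
Qed.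

Lemma elliptic_error : exists2 CR : R, 0 <= CR & forall h, 0 < h <= hstar ->
  forall v w, sobolev0 r.+1 v -> is_elliptic_projection (S h) v w ->
  nrm (fun x => v x - w x) <= CR * h ^+ r.+1 * Hnorm r.+1 v /\
  nrm (wder (fun x => v x - w x)) <= CR * h ^+ r * Hnorm r.+1 v.
Proof.
have [Ca Ca0 app] := approx_adherent; have [fe _] := S_fe.
exists (Ca + 3 * Ca ^+ 2); first by have := sqr_ge0 Ca; lra.
move=> h hh v w vs wv; have h0 : 0 < h by case/andP: hh.
have [[S0 Slin] _ SH _ _] := fe h hh.
have vH := sobolev_H1 (proj1 vs).
have eH := projection_err_H1 SH vH wv.
have orth := projection_orth SH vH wv.
have best := projection_best SH vH wv.
have e0 : v 0 - w 0 = 0.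
  have [wS _] := wv.
  by rewrite (Sh_at0 SH wS) (proj2 vs) subrr.
move: eH orth best e0; set e := (fun x => v x - w x) => eH orth best e0.
have n1 : nrm (wder e) <= Ca * h ^+ r * Hnorm r.+1 v.
  rewrite -(@ler_pM2l _ h) //.
  have -> : h * (Ca * h ^+ r * Hnorm r.+1 v) = Ca * h ^+ r.+1 * Hnorm r.+1 v by rewrite exprS; ring.
  apply/ler_addgt0Pr => d d0.
  have [chi chiS hchi] := app h hh r (leqnn r) v vs d d0.
  apply: (le_trans _ hchi); rewrite (ler_pM2l h0); exact: (best chi chiS).
have n0 : nrm e <= 3 * Ca * h * nrm (wder e).
  have app2 := app h hh 1%N r1.
  have SH' := Sh_is_H1 SH.
  have an := aubin_nitsche Ca0 h0 eH e0 SH'.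
  have an2 := an app2.
  exact: (an2 orth).
have N0 := Hnorm_ge0 r.+1 v.
have hr : 0 <= h ^+ r * Hnorm r.+1 v by rewrite mulr_ge0 // exprn_ge0 // ltW.
split.
  apply: (le_trans n0); apply: (@le_trans _ _ (3 * Ca * h * (Ca * h ^+ r * Hnorm r.+1 v))).
    by rewrite ler_wpM2l // !mulr_ge0 // ltW.
  have -> : 3 * Ca * h * (Ca * h ^+ r * Hnorm r.+1 v) = 3 * Ca ^+ 2 * h * (h ^+ r * Hnorm r.+1 v) by ring.
  have -> : (Ca + 3 * Ca ^+ 2) * h ^+ r.+1 * Hnorm r.+1 v = (Ca + 3 * Ca ^+ 2) * h * (h ^+ r * Hnorm r.+1 v).
    by rewrite (exprS h r); ring.
  by rewrite ler_wpM2r // ler_pM2r // lerDr.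
apply: (le_trans n1); rewrite -!mulrA; apply: (ler_wpM2r hr); have := sqr_ge0 Ca; lra.
Qed.

End estimate.
End projection.

(** * Smooth coefficients and differentiation under the integral *)

Section one_sided.
Variable R : realType.
Implicit Types (f g : R -> R) (a b x l c : R).

(** The domain of the one-sided quotients accumulates at each of its points,
   which makes the limits unique. *)
Lemma within_proper a b x : a < b -> x \in `[a, b] -> ProperFilter (within `[a, b] x^').
Proof.
move=> ab; rewrite in_itv /= => /andP[ax xb].
apply: Build_ProperFilter_ex => P /=; rewrite /dnbhs /within /= => -[d /= d0 H].
have [xb'|xb'] := ltP x b.
  pose y := Num.min b (x + d / 2).
  have xy : x < y by rewrite lt_min xb' /= ltrDl divr_gt0.
  have yd : y - x <= d / 2 by rewrite lerBlDl ge_min lexx orbT.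
  exists y; apply: H => /=.
  - by rewrite ltr0_norm ?subr_lt0 // opprB; lra.
  - by rewrite gt_eqF.
  - by rewrite in_itv /= (le_trans ax (ltW xy)) /= ge_min lexx.
have {xb xb'} xb : x = b by apply/eqP; rewrite eq_le xb xb'.
pose y := Num.max a (x - d / 2).
have yx : y < x by rewrite gt_max xb ab /= gtrBl divr_gt0.
have yd : x - y <= d / 2 by rewrite lerBlDl -lerBlDr le_max lexx orbT.
exists y; apply: H => /=.
- by rewrite gtr0_norm ?subr_gt0 //; lra.
- by rewrite lt_eqF.
- by rewrite in_itv /= le_max lexx /= -xb (ltW yx).
Qed.

Lemma deriv_inE a b f x l : a < b -> x \in `[a, b] ->
  is_deriv_in `[a, b] f x l -> deriv_in `[a, b] f x = l.
Proof. by move=> ab xab h; have pf := within_proper ab xab; exact/cvg_lim. Qed.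

Lemma eq_is_deriv_in a b f g x l : x \in `[a, b] -> (forall y, y \in `[a, b] -> f y = g y) ->
  is_deriv_in `[a, b] f x l -> is_deriv_in `[a, b] g x l.
Proof.
move=> xab fg; rewrite /is_deriv_in; apply: cvg_trans; apply: near_eq_cvg.
near=> y; rewrite /quot_in !fg //.
near: y; exact: (withinT _ (dnbhs_filter x)).
Unshelve. all: by end_near. Qed.

Lemma is_deriv_in_interior a b f x l : a < x < b ->
  is_deriv_in `[a, b] f x l -> is_derive x 1 f l.
Proof.
move=> /andP[ax xb] H.
suff H1 : (h^-1 *: (f (h *: 1 + x) - f x)) @[h --> 0^'] --> l.
  by split; [apply/cvg_ex; exists l|exact/cvg_lim].
apply/cvgrPdist_le => e e0.
have /cvgrPdist_le/(_ e e0) HH := H; rewrite /dnbhs /within /= in HH.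
have [d /= d0 Hd] := HH.
have m0 : 0 < Num.min d (Num.min (x - a) (b - x)) by rewrite !lt_min d0 !subr_gt0 ax xb.
near=> h.
have h0 : h != 0 by near: h; exact: nbhs_dnbhs_neq.
have : `|h| < Num.min d (Num.min (x - a) (b - x)) by near: h; exact: dnbhs0_lt.
rewrite !lt_min => /and3P[hd ha hb].
have := Hd (h + x); rewrite /quot_in /GRing.scale /= mulr1 addrK mulrC; apply.
- by rewrite opprD addrCA subrr addr0 normrN.
- by rewrite -subr_eq0 addrK.
- by move: ha hb; rewrite !ltr_norml in_itv /= => /andP[? ?] /andP[? ?]; apply/andP; split; lra.
Unshelve. all: by end_near. Qed.

Lemma is_derive_clamp a b f x l : a < x < b -> is_derive x 1 f l ->
  is_derive x 1 (fun s => f (clamp a b s)) l.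
Proof.
move=> /andP[ax xb] df; apply: near_eq_is_derive df; near=> s.
rewrite clamp_id // in_itv /=; apply/andP; split; apply: ltW; near: s.
  exact: near_gt.
exact: near_lt.
Unshelve. all: by end_near. Qed.

Lemma rect_path_cont (T : R) (f : R * R -> R) (p : R -> R * R) :
  {within rect T, continuous f} -> continuous p -> (forall s, rect T (p s)) ->
  continuous (fun s => f (p s)).
Proof.
move=> /subspace_continuousP cf cp hp x.
apply: (@cvg_comp _ _ _ p f _ (within (rect T) (nbhs (p x)))); last by apply: cf.
move=> A; rewrite /within /= => wA.
have h : nbhs x (p @^-1` [set z | rect T z -> A z]) := cp x _ wA.
suff : nbhs x (p @^-1` A) by [].
apply: filterS h => y h; exact: (h (hp y)).
Qed.

Lemma rect_bounded (T : R) (f : R * R -> R) : {within rect T, continuous f} ->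
  exists2 M : R, 0 <= M & forall t x, rect T (t, x) -> `|f (t, x)| <= M.
Proof.
move=> cf.
have cr : compact (rect T) by apply: compact_setX; exact: segment_compact.
have [M [_ HM]] := compact_bounded (continuous_compact cf cr).
exists (`|M| + 1) => [|t x tx]; first by rewrite addr_ge0.
by apply: (HM (`|M| + 1)); [rewrite ltr_pwDr // ler_norm|exists (t, x)].
Qed.

(** The only properties of the coefficients of time that enter the estimate. *)
Lemma smooth1_lipschitz (T : R) f : 0 < T -> smooth1 `[0, T] f ->
  exists2 L : R, 0 <= L & (forall t, t \in `[0, T] -> `|f t| <= L) /\
    (forall s t, s \in `[0, T] -> t \in `[0, T] -> `|f t - f s| <= L * `|t - s|).
Proof.
move=> T0 [w [w0 wd]].
have cw n : {within `[0, T], continuous (w n)}.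
  apply/subspace_continuousP => x xT.
  have H := wd n x xT.
  have Hc : (fun y => w n x + quot_in (w n) x y * (y - x)) @ within `[0, T] x^' --> w n x + w n.+1 x * (x - x).
    apply: cvgD; first exact: cvg_cst.
    apply: cvgM; first exact: H.
    apply: cvgB; last exact: cvg_cst.
    by apply: cvg_trans (cvg_within _) _; exact: cvg_within.
  rewrite subrr mulr0 addr0 in Hc.
  (* The quotient is taken away from the point; the value there is added. *)
  apply/cvgrPdist_le => e e0.
  have /cvgrPdist_le/(_ e e0) HH := Hc; rewrite /dnbhs /within /= in HH.
  have [d /= d0 Hd] := HH.
  exists d => //= y yd yT.
  have [->|yx] := eqVneq y x; first by rewrite subrr normr0 ltW.
  have := Hd y yd yx yT; rewrite /quot_in divfK ?subr_eq0 //.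
  by have -> : w n x + (w n y - w n x) = w n y by ring.
have [M0 M00 HM0] := within_bounded (cw 0%N); have [M1 M10 HM1] := within_bounded (cw 1%N).
exists (M0 + M1); first lra.
split=> [t tT|s t sT tT].
  by rewrite -w0 //; have := HM0 t tT; lra.
wlog st : s t sT tT / s <= t => [H|].
  by have [/H|/ltW/H] := leP s t; [apply|rewrite distrC (distrC t); apply].
rewrite -!w0 //.
have sub y : y \in `[s, t] -> y \in `[0, T].
  move: sT tT; rewrite !in_itv /= => /andP[s0 _] /andP[_ tT] /andP[sy yt].
  by rewrite (le_trans s0 sy) (le_trans yt tT).
have dw x : x \in `]s, t[ -> is_derive x 1 (w 0%N) (w 1%N x).
  rewrite in_itv /= => /andP[sx xt]; apply: (@is_deriv_in_interior 0 T); last first.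
    by apply: wd; apply: sub; rewrite in_itv /= (ltW sx) (ltW xt).
  move: sT tT; rewrite !in_itv /= => /andP[s0 _] /andP[_ tT].
  by rewrite (le_lt_trans s0 sx) (lt_le_trans xt tT).
have [c cst ->] := MVT_segment st dw (continuous_subspaceW sub (cw 0%N)).
rewrite normrM ler_wpM2r //; have := HM1 c (sub c cst); lra.
Qed.

End one_sided.

Section under_integral.
Variable R : realType.
Implicit Types (F : R -> R -> R) (phi : R -> R) (M T t x : R).
Local Notation mu := (@lebesgue_measure R).
Local Notation dom := (@dom R).

Lemma under_integral_cont F phi M : (forall t x, `|F t x| <= M) ->
  (forall x, continuous (F ^~ x)) -> (forall t, continuous (F t)) -> L2 phi ->
  continuous (fun t => inner (F t) phi).
Proof.
move=> FM cFt cFx Lp t.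
have LF s : L2 (F s) by exact: L2_continuous.
have iF s : mu.-integrable dom (EFin \o (fun x => F s x * phi x)) := L2_integrable_mul (LF s) Lp.
have ig : mu.-integrable dom (EFin \o (fun x => M * `|phi x|)).
  have i1 := integrableZl (@measurable_dom R) M (integrable_norm (L2_integrable Lp)).
  by apply: eq_integrable i1.
apply: (@continuity_under_integral R _ _ mu (fun s x => F s x * phi x) dom (@measurable_dom R)
   (t - 1) (t + 1) (fun s _ => iF s) _ (fun x => M * `|phi x|) ig _ t).
- apply: aeW => x _ s _; apply: cvgM; [exact: cFt|exact: cvg_cst].
- move=> s _; apply: aeW => x _; rewrite normrM ler_wpM2r //.
- by rewrite inE /= in_itv /=; apply/andP; split; lra.
Qed.

Lemma under_integral_derive F (F' : R -> R -> R) phi M T : (forall t x, `|F' t x| <= M) ->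
  (forall t, continuous (F t)) -> (forall t, continuous (F' t)) -> L2 phi ->
  (forall t x, 0 < t < T -> 0 < x < 1 -> is_derive t 1 (F ^~ x) (F' t x)) ->
  forall t, 0 < t < T -> is_derive t 1 (fun t => inner (F t) phi) (inner (F' t) phi).
Proof.
move=> FM cF cF' Lp dF t tT.
have LF s : L2 (F s) by exact: L2_continuous.
have iF s : mu.-integrable dom (EFin \o (fun x => F s x * phi x)) := L2_integrable_mul (LF s) Lp.
have ig : mu.-integrable dom (EFin \o (fun x => M * `|phi x|)).
  have i1 := integrableZl (@measurable_dom R) M (integrable_norm (L2_integrable Lp)).
  by apply: eq_integrable i1.
have M0 : 0 <= M by apply: le_trans (FM 0 0).
have d s x : `]0, T[%classic s -> dom x ->
    is_derive s 1 ((fun s x => F s x * phi x) ^~ x) (F' s x * phi x).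
  rewrite /= in_itv domE /= => sT x01.
  have d1 := dF s x sT x01; have d2 := is_derive_cst (phi x) s (1 : R).
  have := is_deriveMf d1 d2; rewrite mulr0 add0r; exact.
have tI : `]0, T[%classic t by rewrite /= in_itv.
have der s x : `]0, T[%classic s -> dom x -> derivable ((fun s x => F s x * phi x) ^~ x) s 1.
  by move=> sI xd; have [] := d s x sI xd.
have val s x : `]0, T[%classic s -> dom x ->
   partial1of2 (fun s x => F s x * phi x) s x = F' s x * phi x.
  by move=> sI xd; rewrite partial1of2E; have dd := d s x sI xd; rewrite derive_val.
have g0 x : 0 <= M * `|phi x| by rewrite mulr_ge0.
have ub s x : `]0, T[%classic s -> dom x ->
  `|partial1of2 (fun s x => F s x * phi x) s x| <= M * `|phi x|.
  by move=> sI xd; rewrite val // normrM ler_wpM2r.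
have D := @derivable_under_integral R _ _ mu (fun s x => F s x * phi x) dom (@measurable_dom R)
  t 0 T tI (fun s _ => iF s) der _ g0 ig ub.
have E := @differentiation_under_integral R _ _ mu (fun s x => F s x * phi x) dom (@measurable_dom R)
  t 0 T tI (fun s _ => iF s) der _ g0 ig ub.
split; first exact: D.
rewrite -derive1E; apply: etrans E _.
by apply: eq_Rintegral => x /set_mem xd; exact: val.
Qed.

End under_integral.

(** * Taylor expansions at the midpoint of a step *)

Section taylor.
Variables (R : realType) (T : R).
Implicit Types (G : nat -> R -> R) (c x t : R) (n : nat).

(** Interior derivatives together with continuity on the line: this is what
   functions frozen outside of [[0, T]] satisfy, and enough for the mean value
   theorem on closed subintervals. *)
Definition curve n G := forall j, (j < n)%N ->
  continuous (G j) /\ forall t, 0 < t < T -> is_derive t 1 (G j) (G j.+1 t).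

Definition divpow n (y : R) : R := y ^+ n / n`!%:R.

Definition taylor_rem n G c x : R := G 0%N x - \sum_(j < n) G j c * divpow j (x - c).

Lemma is_derive_divpow n c x :
  is_derive x 1 (fun s => divpow n.+1 (s - c)) (divpow n (x - c)).
Proof.
have d0 : is_derive x 1 (fun s : R => s - c) 1.
  have -> : (fun s : R => s - c) = id - cst c by [].
  by apply: is_derive_eq; rewrite subr0.
have -> : (fun s => divpow n.+1 (s - c)) = (n.+1`!%:R^-1 : R) \*: ((fun s : R => s - c) ^+ n.+1).
  by apply/funext => s; rewrite /divpow fctE mulrC.
apply: is_derive_eq; rewrite /GRing.scale /= mulr1 /divpow.
rewrite factS natrM.
have h1 : (n.+1%:R : R) != 0 by rewrite pnatr_eq0.
have h2 : (n`!%:R : R) != 0 by rewrite pnatr_eq0 -lt0n fact_gt0.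
rewrite invfM; move: h1 h2; move: (n.+1%:R : R) (n`!%:R : R) => y z h1 h2.
by field; rewrite h2 h1.
Qed.

Lemma is_derive_taylor_sum n (u : nat -> R) c x :
  is_derive x 1 (fun s => \sum_(j < n.+1) u j * divpow j (s - c))
                (\sum_(j < n) u j.+1 * divpow j (x - c)).
Proof.
elim: n => [|n IH].
  rewrite big_ord0; have -> : (fun s => \sum_(j < 1) u j * divpow j (s - c)) = cst (u 0%N).
    by apply/funext => s; rewrite big_ord_recl big_ord0 addr0 /divpow expr0 fact0 divr1 mulr1.
  exact: is_derive_cst.
have -> : (fun s => \sum_(j < n.+2) u j * divpow j (s - c)) =
   (fun s => \sum_(j < n.+1) u j * divpow j (s - c)) + u n.+1 \*: (fun s => divpow n.+1 (s - c)).
  by apply/funext => s; rewrite big_ord_recr.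
have d := is_derive_divpow n c x.
by apply: is_derive_eq; rewrite [RHS]big_ord_recr.
Qed.

(** The remainder of [G] is a primitive of the remainder of the derivative, and
   vanishes at [c]. *)
Lemma taylor_step n G c B x : 0 <= B -> curve n.+1 G -> c \in `[0, T] -> x \in `[0, T] ->
  (forall s, 0 < s < T -> `|taylor_rem n (fun j => G j.+1) c s| <= B * `|s - c| ^+ n) ->
  `|taylor_rem n.+1 G c x| <= B * `|x - c| ^+ n.+1.
Proof.
move=> B0 cG cT xT H.
have [cG0 dG0] := cG 0%N isT.
have d s : 0 < s < T -> is_derive s 1 (taylor_rem n.+1 G c) (taylor_rem n (fun j => G j.+1) c s).
  move=> sT; have d1 := dG0 s sT; have d2 := is_derive_taylor_sum n (G ^~ c) c s.
  exact: is_deriveB.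
have cR : continuous (taylor_rem n.+1 G c).
  move=> s; apply: cvgB; first exact: cG0.
  have [/derivable1_diffP/differentiable_continuous] := is_derive_taylor_sum n (G ^~ c) c s.
  by [].
have z : taylor_rem n.+1 G c c = 0.
  rewrite /taylor_rem big_ord_recl big1 ?addr0 => [|j _]; rewrite /divpow subrr.
    by rewrite expr0 fact0 divr1 mulr1 subrr.
  by rewrite /= expr0n mul0r mulr0.
have [xc|cx|->] := ltgtP x c; last by rewrite z normr0 mulr_ge0 // exprn_ge0.
- have sT s : s \in `]x, c[ -> 0 < s < T.
    move: cT xT; rewrite !in_itv /= => /andP[_ cT] /andP[x0 _] /andP[xs sc].
    by rewrite (le_lt_trans x0 xs) (lt_le_trans sc cT).
  have [s sxc] := MVT xc (fun s h => d s (sT s h)) (continuous_subspaceT cR).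
  rewrite z sub0r => /(congr1 (fun y => `|y|)); rewrite normrN normrM => ->.
  rewrite exprSr mulrA (distrC c x); apply: ler_wpM2r => //.
  apply: (le_trans (H s (sT s sxc))); rewrite ler_wpM2l // lerXn2r ?nnegrE //.
  move: sxc; rewrite in_itv /= => /andP[xs sc].
  by rewrite !ltr0_norm ?subr_lt0 //; lra.
- have sT s : s \in `]c, x[ -> 0 < s < T.
    move: cT xT; rewrite !in_itv /= => /andP[c0 _] /andP[_ xT] /andP[cs sx].
    by rewrite (le_lt_trans c0 cs) (lt_le_trans sx xT).
  have [s sxc] := MVT cx (fun s h => d s (sT s h)) (continuous_subspaceT cR).
  rewrite z subr0 => /(congr1 (fun y => `|y|)); rewrite normrM => ->.
  rewrite exprSr mulrA; apply: ler_wpM2r => //.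
  apply: (le_trans (H s (sT s sxc))); rewrite ler_wpM2l // lerXn2r ?nnegrE //.
  move: sxc; rewrite in_itv /= => /andP[cs sx].
  by rewrite !gtr0_norm ?subr_gt0 //; lra.
Qed.

Lemma taylor n G c B x : 0 <= B -> curve n.+1 G -> c \in `[0, T] -> x \in `[0, T] ->
  (forall t, 0 < t < T -> `|G n.+1 t| <= B) ->
  `|taylor_rem n.+1 G c x| <= B * `|x - c| ^+ n.+1.
Proof.
move=> B0 cG cT xT GB; apply: taylor_step => //.
elim: n G cG GB {x xT} => [|n IH] G cG GB s sT.
  by rewrite /taylor_rem big_ord0 subr0 expr0 mulr1 GB.
apply: taylor_step => //.
- by move=> j jn; apply: (cG j.+1).
- by move: sT; rewrite in_itv /= => /andP[/ltW -> /ltW ->].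
- by move=> s' sT'; apply: (IH (fun j => G j.+1)) => // j jn; apply: (cG j.+1).
Qed.

Lemma divpow0 (y : R) : divpow 0 y = 1. Proof. by rewrite /divpow expr0 fact0 divr1. Qed.
Lemma divpow1 (y : R) : divpow 1 y = y. Proof. by rewrite /divpow expr1 divr1. Qed.
Lemma divpow2 (y : R) : divpow 2 y = y ^+ 2 / 2. Proof. by []. Qed.
Lemma divpow3 (y : R) : divpow 3 y = y ^+ 3 / 6. Proof. by []. Qed.

(** The rules are applied over a step of length [k] centred at [M], both to
   boundary values and to inner products of the exact solution. *)
Section midpoint_rules.
Variables (M k : R).
Hypotheses (k0 : 0 < k) (L0 : 0 <= M - k / 2) (RT : M + k / 2 <= T).
Variables (G : nat -> R -> R) (B : R).
Hypothesis B0 : 0 <= B.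

Let LT : M - k / 2 \in `[0, T].
Proof. by rewrite in_itv /=; move: k0 L0 RT => ? ? ?; apply/andP; split; lra. Qed.
Let RTT : M + k / 2 \in `[0, T].
Proof. by rewrite in_itv /=; move: k0 L0 RT => ? ? ?; apply/andP; split; lra. Qed.
Let MT : M \in `[0, T].
Proof. by rewrite in_itv /=; move: k0 L0 RT => ? ? ?; apply/andP; split; lra. Qed.

Let Lk : `|M - k / 2 - M| = k / 2.
Proof.
have -> : M - k / 2 - M = - (k / 2) by ring.
by rewrite normrN gtr0_norm // divr_gt0.
Qed.
Let Rk : `|M + k / 2 - M| = k / 2.
Proof.
have -> : M + k / 2 - M = k / 2 by ring.
by rewrite gtr0_norm // divr_gt0.
Qed.

Let two (n : nat) : curve n.+1 G -> (forall t, 0 < t < T -> `|G n.+1 t| <= B) ->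
  `|taylor_rem n.+1 G M (M - k / 2)| <= B * (k / 2) ^+ n.+1 /\
  `|taylor_rem n.+1 G M (M + k / 2)| <= B * (k / 2) ^+ n.+1.
Proof.
move=> cG GB; split.
  by rewrite -[in leRHS]Lk; exact: taylor.
by rewrite -[in leRHS]Rk; exact: taylor.
Qed.

Lemma average_rule : curve 2 G -> (forall t, 0 < t < T -> `|G 2%N t| <= B) ->
  `|(G 0%N (M + k / 2) + G 0%N (M - k / 2)) / 2 - G 0%N M| <= B * k ^+ 2 / 4.
Proof.
move=> cG GB; have := two cG GB; rewrite /taylor_rem !big_ord_recl !big_ord0 /=.
rewrite !divpow0 !divpow1 !ler_norml => -[/andP[h1 h2] /andP[h3 h4]].
by move: k0 B0 => ? ?; apply/andP; split; nra.
Qed.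

Lemma average_expansion : curve 3 G -> (forall t, 0 < t < T -> `|G 3%N t| <= B) ->
  `|(G 0%N (M + k / 2) + G 0%N (M - k / 2)) / 2 - G 0%N M - k ^+ 2 / 8 * G 2%N M| <= B * k ^+ 3 / 8.
Proof.
move=> cG GB; have := two cG GB; rewrite /taylor_rem !big_ord_recl !big_ord0 /=.
rewrite !divpow0 !divpow1 !divpow2 !ler_norml => -[/andP[h1 h2] /andP[h3 h4]].
by move: k0 B0 => ? ?; apply/andP; split; nra.
Qed.

Lemma difference_rule : curve 3 G -> (forall t, 0 < t < T -> `|G 3%N t| <= B) ->
  `|(G 0%N (M + k / 2) - G 0%N (M - k / 2)) / k - G 1%N M| <= B * k ^+ 2 / 4.
Proof.
move=> cG GB; have := two cG GB; rewrite /taylor_rem !big_ord_recl !big_ord0 /=.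
rewrite !divpow0 !divpow1 !divpow2 !ler_norml => -[/andP[h1 h2] /andP[h3 h4]].
have -> : (G 0%N (M + k / 2) - G 0%N (M - k / 2)) / k - G 1%N M =
   (G 0%N (M + k / 2) - G 0%N (M - k / 2) - k * G 1%N M) / k by field; rewrite gt_eqF.
rewrite ler_pdivrMr // ler_pdivlMr //.
by move: k0 B0 => ? ?; apply/andP; split; nra.
Qed.

Lemma difference_expansion : curve 4 G -> (forall t, 0 < t < T -> `|G 4%N t| <= B) ->
  `|(G 0%N (M + k / 2) - G 0%N (M - k / 2)) / k - G 1%N M - k ^+ 2 / 24 * G 3%N M| <= B * k ^+ 3 / 8.
Proof.
move=> cG GB; have := two cG GB; rewrite /taylor_rem !big_ord_recl !big_ord0 /=.
rewrite !divpow0 !divpow1 !divpow2 !divpow3 !ler_norml => -[/andP[h1 h2] /andP[h3 h4]].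
have -> : (G 0%N (M + k / 2) - G 0%N (M - k / 2)) / k - G 1%N M - k ^+ 2 / 24 * G 3%N M =
   (G 0%N (M + k / 2) - G 0%N (M - k / 2) - k * G 1%N M - k ^+ 3 / 24 * G 3%N M) / k.
  by field; rewrite gt_eqF.
rewrite ler_pdivrMr // ler_pdivlMr //.
by move: k0 B0 => ? ?; apply/andP; split; nra.
Qed.

End midpoint_rules.

Lemma curve_lipschitz G B s t : 0 <= B -> curve 1 G -> s \in `[0, T] -> t \in `[0, T] ->
  (forall t, 0 < t < T -> `|G 1%N t| <= B) -> `|G 0%N t - G 0%N s| <= B * `|t - s|.
Proof.
move=> B0 cG sT tT GB; have := taylor B0 cG sT tT GB.
by rewrite /taylor_rem !big_ord_recl !big_ord0 /= divpow0 mulr1 addr0 expr1.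
Qed.

End taylor.

(** The cancellation behind the summation by parts: the leading terms of two
   residuals at adjacent steps of nearly equal length differ by third order,
   through the factor [k ^+ 2] and through the smoothness of [H]. *)
Lemma residual_difference (R : realType) (Cs K kap k k' M M' H H' rho rho' B : R) :
  0 <= Cs -> 0 <= B -> 0 <= kap <= 1 / 8 -> 0 < k <= K -> 0 < k' <= K ->
  M' - M = (k + k') / 2 -> `|k' - k| <= Cs * K ^+ 2 ->
  `|H' - H| <= B * `|M' - M| -> `|H'| <= B ->
  `|rho - kap * k ^+ 2 * H| <= B * k ^+ 3 / 8 ->
  `|rho' - kap * k' ^+ 2 * H'| <= B * k' ^+ 3 / 8 ->
  `|rho' - rho| <= (1 + Cs) * B * K ^+ 2 * (k + k').
Proof.
move=> Cs0 B0 /andP[q0 q1] /andP[k0 kK] /andP[k0' kK'] MM dk dH HB r1 r2.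
have kk : 0 < k + k' by lra.
rewrite MM (gtr0_norm (divr_gt0 kk _)) // in dH.
have -> : rho' - rho = (rho' - kap * k' ^+ 2 * H') - (rho - kap * k ^+ 2 * H)
   + kap * (k' - k) * (k' + k) * H' + kap * k ^+ 2 * (H' - H) by ring.
have c1 : B * k ^+ 3 / 8 <= B * K ^+ 2 * k / 8.
  rewrite ler_pM2r // -mulrA ler_wpM2l // exprSr ler_pM2r // lerXn2r ?nnegrE //; lra.
have c2 : B * k' ^+ 3 / 8 <= B * K ^+ 2 * k' / 8.
  rewrite ler_pM2r // -mulrA ler_wpM2l // exprSr ler_pM2r // lerXn2r ?nnegrE //; lra.
have c3 : `|kap * (k' - k) * (k' + k) * H'| <= 1 / 8 * (Cs * K ^+ 2) * (k + k') * B.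
  rewrite !normrM (ger0_norm q0) (addrC k' k) (gtr0_norm kk).
  by rewrite !ler_pM ?mulr_ge0 // ltW.
have c4 : `|kap * k ^+ 2 * (H' - H)| <= 1 / 8 * K ^+ 2 * (B * ((k + k') / 2)).
  rewrite normrM (normrM kap) (ger0_norm q0) (ger0_norm (sqr_ge0 k)).
  apply: ler_pM => //; first by rewrite mulr_ge0 ?sqr_ge0.
  by apply: ler_pM; rewrite ?sqr_ge0 // lerXn2r ?nnegrE //; lra.
have K0 : 0 <= K ^+ 2 by exact: sqr_ge0.
have p1 : 0 <= B * K ^+ 2 * (k + k') := mulr_ge0 (mulr_ge0 B0 K0) (ltW kk).
have p2 : 0 <= Cs * (B * K ^+ 2 * (k + k')) by rewrite mulr_ge0.
apply: le_trans (ler_normD _ _) _; apply: le_trans (lerD (ler_normD _ _) (lexx _)) _.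
apply: le_trans (lerD (lerD (ler_normB _ _) (lexx _)) (lexx _)) _.
apply: le_trans (lerD (lerD (lerD r2 r1) c3) c4) _.
lra.
Qed.

(** * The discrete energy argument *)

Section energy.
Variable R : realType.

(** With x = k C <= 1/3 the hypothesis gives the ratio (1 + x) / (1 - x), which is
   at most 1 + 3 x. *)
Lemma gronwall_step (k C P0 P1 e : R) : 0 <= k -> 0 <= C -> k * C <= 3^-1 ->
  0 <= P0 -> 0 <= P1 -> 0 <= e -> P1 - P0 <= k * C * (P1 + P0 + e) ->
  P1 + e <= (1 + 3 * (k * C)) * (P0 + e).
Proof.
move=> k0 C0; have : 0 <= k * C by rewrite mulr_ge0.
move: (k * C) => x x0 x3 P00 P10 e0 H.
suff : (1 - x) * (P1 + e) <= (1 - x) * ((1 + 3 * x) * (P0 + e)).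
  by rewrite ler_pM2l //; lra.
have : 0 <= x * (1 - 3 * x) * (P0 + e) by rewrite !mulr_ge0 //; lra.
nra.
Qed.

Lemma gronwall (N : nat) (t Psi : nat -> R) (C e : R) :
  t 0%N = 0 -> 0 <= C -> 0 <= e -> (forall n, (n <= N)%N -> 0 <= Psi n) ->
  (forall n, (1 <= n <= N)%N -> 0 <= step t n /\ step t n * C <= 3^-1) ->
  (forall n, (1 <= n <= N)%N -> Psi n - Psi n.-1 <= step t n * C * (Psi n + Psi n.-1 + e)) ->
  forall n, (n <= N)%N -> Psi n + e <= expR (3 * C * t n) * (Psi 0%N + e).
Proof.
move=> t0 C0 e0 P0 kC H; elim=> [_|n IH nN].
  by rewrite t0 mulr0 expR0 mul1r.
have n1 : (1 <= n.+1 <= N)%N by [].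
have [k0 k3] := kC n.+1 n1.
have Pn := P0 n (ltnW nN); have PSn := P0 n.+1 nN.
have := gronwall_step k0 C0 k3 Pn PSn e0 (H n.+1 n1) => h.
apply: (le_trans h).
have -> : 3 * C * t n.+1 = 3 * (step t n.+1 * C) + 3 * C * t n by rewrite /step /=; ring.
rewrite expRD -mulrA; apply: ler_pM.
- by have : 0 <= step t n.+1 * C by [rewrite mulr_ge0]; lra.
- by rewrite addr_ge0.
- exact: expR_ge1Dx.
- exact: IH (ltnW nN).
Qed.

(** Young's inequality, for a bound known on the square of [a]. *)
Lemma young (a b c d : R) : 0 < d -> 0 <= b -> a ^+ 2 <= c ^+ 2 * b ->
  2 * a <= d * b + d^-1 * c ^+ 2.
Proof.
move=> d0 b0 H; rewrite leNgt; apply/negP => h.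
have i0 : 0 < d^-1 by rewrite invr_gt0.
have p : 0 <= d * b + d^-1 * c ^+ 2.
  exact: addr_ge0 (mulr_ge0 (ltW d0) b0) (mulr_ge0 (ltW i0) (sqr_ge0 c)).
have : (d * b + d^-1 * c ^+ 2) ^+ 2 < (2 * a) ^+ 2.
  by rewrite ltrXn2r // ?nnegrE // (le_trans p (ltW h)).
have : 0 <= (d * b - d^-1 * c ^+ 2) ^+ 2 by exact: sqr_ge0.
have e : (d * b) * (d^-1 * c ^+ 2) = c ^+ 2 * b by field; rewrite gt_eqF.
move: (d * b) (d^-1 * c ^+ 2) e => u v e; nra.
Qed.

(** The energy argument, stripped of functions. The sequences stand for
   X = |theta|_1^2, Y = |theta|^2, z = theta(1), D = |difference quotient|^2 and
   W = |load|^2; al = 1 / a and gam = delta / a at the midpoints, rho is the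
   boundary residual, and tau n j is the residual of the average at step n tested
   with theta j. Summation by parts moves gam, rho and tau into the modified
   energy Phi, at the price of the increments bounded in the hypotheses. The
   energy inequality does not see Y; a multiple K of Y is added, which makes Phi
   coercive, and the increase of Y is paid with the term D. *)
Lemma discrete_energy (N : nat) (t X Y z D W al gam rho : nat -> R) (tau : nat -> nat -> R)
   (al0 al1 Gam Lg tX tY bW cW c eta K C2 : R) :
  0 < al0 -> 0 <= al1 -> 0 <= Gam -> 0 <= Lg -> 0 <= tX -> 0 <= tY -> 0 <= bW -> 0 <= cW -> 0 <= c ->
  Gam * tX <= 1 / 4 -> K = Gam * tY + 1 ->
  C2 = 2 * (Lg + 2) + K ^+ 2 / al0 + al1 * bW + 2 * c ^+ 2 + al1 * cW ->
  t 0%N = 0 ->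
  (forall n, (1 <= n <= N)%N -> 0 < step t n /\ step t n * C2 <= 3^-1) ->
  X 0%N = 0 -> Y 0%N = 0 -> z 0%N = 0 -> tau 0%N 0%N = 0 ->
  (forall n, (n <= N)%N -> [/\ 0 <= X n, 0 <= Y n, z n ^+ 2 <= X n & z n ^+ 2 <= tX * X n + tY * Y n]) ->
  (forall n, (1 <= n <= N)%N -> [/\ 0 <= D n, al0 <= al n <= al1, `|gam n| <= Gam,
       rho n ^+ 2 <= c ^+ 2 * eta ^+ 2 & tau n n ^+ 2 <= (c * eta) ^+ 2 * X n]) ->
  (forall n, (1 <= n <= N)%N -> 0 <= W n <= bW * (Y n + Y n.-1) + cW * eta ^+ 2) ->
  (forall n, (1 <= n <= N)%N -> forall l, 0 < l ->
      Y n - Y n.-1 <= step t n * (l * D n + l^-1 * (Y n + Y n.-1))) ->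
  (forall n, (1 <= n <= N)%N ->
     [/\ (gam n.-1 - gam n) * z n.-1 ^+ 2 <= Lg * step t n * X n.-1,
         - 2 * (rho n - rho n.-1) * z n.-1 <= step t n * (c ^+ 2 * eta ^+ 2 + X n.-1) &
         2 * (tau n n.-1 - tau n.-1 n.-1) <= step t n * (c ^+ 2 * eta ^+ 2 + X n.-1)]) ->
  (forall n, (1 <= n <= N)%N ->
     step t n * al n * D n + X n - X n.-1 <=
       gam n * (z n ^+ 2 - z n.-1 ^+ 2) + step t n * al n * W n + 2 * rho n * (z n - z n.-1)
       - 2 * (tau n n - tau n n.-1)) ->
  forall n, (n <= N)%N -> X n <= 2 * (expR (3 * C2 * t n) * (16 * c ^+ 2 + 1) * eta ^+ 2).
Proof.
move=> al00 al10 Gam0 Lg0 tX0 tY0 bW0 cW0 c0 GtX KE C2E t0 kC X0 Y0 z0 tau0 HX HD HW HY Hdiff HE.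
pose Phi n := X n - gam n * z n ^+ 2 + K * Y n - 2 * rho n * z n + 2 * tau n n.
pose Psi n := Phi n + 16 * c ^+ 2 * eta ^+ 2.
have ee0 : 0 <= eta ^+ 2 by exact: sqr_ge0.
have cc0 : 0 <= c ^+ 2 by exact: sqr_ge0.
have ce0 : 0 <= c ^+ 2 * eta ^+ 2 by rewrite mulr_ge0.
have K1 : 1 <= K by rewrite KE lerDr mulr_ge0.
have C20 : 0 <= C2.
  have : 0 <= K ^+ 2 / al0 by rewrite divr_ge0 ?sqr_ge0 // ltW.
  have : 0 <= al1 * bW by rewrite mulr_ge0.
  have : 0 <= al1 * cW by rewrite mulr_ge0.
  by rewrite C2E; lra.
(* Coercivity: the term in gam costs X / 4 and K - 1 times Y by the trace
   inequality, the residuals cost X / 8 each and the constant added in Psi. *)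
have lower n : (n <= N)%N -> X n / 2 + Y n <= Psi n.
  move=> nN; have [Xn Yn zX ztr] := HX n nN.
  rewrite /Psi /Phi; case: n nN Xn Yn zX ztr => [|n] nN Xn Yn zX ztr.
    by rewrite X0 Y0 z0 tau0; nra.
  have [Dn al_n gamn rhon taun] := HD n.+1 nN.
  have g1 : gam n.+1 * z n.+1 ^+ 2 <= X n.+1 / 4 + Gam * tY * Y n.+1.
    apply: (@le_trans _ _ (Gam * z n.+1 ^+ 2)).
      by rewrite ler_wpM2r ?sqr_ge0 // (le_trans (ler_norm _) gamn).
    have : Gam * z n.+1 ^+ 2 <= Gam * (tX * X n.+1 + tY * Y n.+1) by rewrite ler_wpM2l.
    by have : Gam * tX * X n.+1 <= 1 / 4 * X n.+1 by [rewrite ler_wpM2r]; lra.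
  have g2 : 2 * (rho n.+1 * z n.+1) <= (8^-1 : R) * X n.+1 + (8^-1 : R)^-1 * (c * eta) ^+ 2.
    apply: young => //; have -> : (rho n.+1 * z n.+1) ^+ 2 = rho n.+1 ^+ 2 * z n.+1 ^+ 2 by ring.
    have -> : (c * eta) ^+ 2 * X n.+1 = c ^+ 2 * eta ^+ 2 * X n.+1 by ring.
    by apply: ler_pM; rewrite ?sqr_ge0.
  have g3 : 2 * (- tau n.+1 n.+1) <= (8^-1 : R) * X n.+1 + (8^-1 : R)^-1 * (c * eta) ^+ 2.
    by apply: young => //; rewrite sqrrN.
  rewrite invrK exprMn in g2 g3.
  rewrite KE mulrDl mul1r; lra.
have Psi0 n : (n <= N)%N -> 0 <= Psi n.
  by move=> nN; have [Xn Yn _ _] := HX n nN; apply: le_trans (lower n nN); lra.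
have incr n : (1 <= n <= N)%N -> Psi n - Psi n.-1 <= step t n * C2 * (Psi n + Psi n.-1 + eta ^+ 2).
  move=> nN; have [k0 _] := kC n nN.
  have nN1 : (n <= N)%N by case/andP: nN.
  have nN2 : (n.-1 <= N)%N by exact: leq_trans (leq_pred n) nN1.
  have [Dn /andP[aln1 aln2] gamn rhon taun] := HD n nN.
  have [d1 d2 d3] := Hdiff n nN.
  have /andP[W0 Wn] := HW n nN.
  (* This weight makes K times the increase of Y absorbable by al0 * D. *)
  have l0 : 0 < al0 / K by rewrite divr_gt0 //; lra.
  have Yd := HY n nN _ l0.
  have En := HE n nN.
  have [Xn Yn _ _] := HX n nN1; have [Xn' Yn' _ _] := HX _ nN2.
  have low1 := lower n nN1; have low2 := lower _ nN2.
  have [p1 p2] := (Psi0 n nN1, Psi0 _ nN2).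
  have KY : K * (Y n - Y n.-1) <= step t n * (al0 * D n + K ^+ 2 / al0 * (Y n + Y n.-1)).
    apply: (@le_trans _ _ (K * (step t n * (al0 / K * D n + (al0 / K)^-1 * (Y n + Y n.-1))))).
      by rewrite ler_wpM2l //; lra.
    rewrite le_eqVlt; apply/orP; left; apply/eqP; field.
    by rewrite !gt_eqF //; lra.
  have aD : step t n * al0 * D n <= step t n * al n * D n.
    by rewrite ler_wpM2r // ler_pM2l.
  have aW : step t n * al n * W n <= step t n * (al1 * bW * (Y n + Y n.-1) + al1 * cW * eta ^+ 2).
    rewrite -mulrA ler_pM2l //.
    apply: (@le_trans _ _ (al1 * (bW * (Y n + Y n.-1) + cW * eta ^+ 2))); last by rewrite mulrDr !mulrA.
    by apply: ler_pM => //; lra.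
  have -> : Psi n - Psi n.-1 = (X n - X n.-1 - gam n * (z n ^+ 2 - z n.-1 ^+ 2)
     - 2 * rho n * (z n - z n.-1) + 2 * (tau n n - tau n n.-1)) + K * (Y n - Y n.-1)
     + (gam n.-1 - gam n) * z n.-1 ^+ 2 + (- 2 * (rho n - rho n.-1) * z n.-1)
     + 2 * (tau n n.-1 - tau n.-1 n.-1).
    by rewrite /Psi /Phi; ring.
  apply: (@le_trans _ _ (step t n * ((Lg + 2) * X n.-1 + (K ^+ 2 / al0 + al1 * bW) * (Y n + Y n.-1)
      + (2 * c ^+ 2 + al1 * cW) * eta ^+ 2))).
    lra.
  rewrite -[leRHS]mulrA ler_pM2l //.
  have q1 : 0 <= K ^+ 2 / al0 by rewrite divr_ge0 ?sqr_ge0 // ltW.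
  have q2 : 0 <= al1 * bW by rewrite mulr_ge0.
  have q3 : 0 <= al1 * cW by rewrite mulr_ge0.
  pose S := Psi n + Psi n.-1 + eta ^+ 2.
  have S1 : X n.-1 / 2 <= S by rewrite /S; lra.
  have S2 : Y n + Y n.-1 <= S by rewrite /S; lra.
  have S3 : eta ^+ 2 <= S by rewrite /S; lra.
  have r1 : (Lg + 2) * X n.-1 <= 2 * (Lg + 2) * S.
    have : (Lg + 2) * (X n.-1 / 2) <= (Lg + 2) * S by rewrite ler_wpM2l //; lra.
    lra.
  have r2 : (K ^+ 2 / al0 + al1 * bW) * (Y n + Y n.-1) <= (K ^+ 2 / al0 + al1 * bW) * S.
    by rewrite ler_wpM2l // addr_ge0.
  have r3 : (2 * c ^+ 2 + al1 * cW) * eta ^+ 2 <= (2 * c ^+ 2 + al1 * cW) * S.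
    by rewrite ler_wpM2l // addr_ge0 // mulr_ge0.
  rewrite -/S C2E; lra.
move=> n nN.
have kC' m : (1 <= m <= N)%N -> 0 <= step t m /\ step t m * C2 <= 3^-1.
  by move=> /kC[/ltW].
have := gronwall t0 C20 ee0 Psi0 kC' incr nN.
have -> : Psi 0%N = 16 * c ^+ 2 * eta ^+ 2.
  by rewrite /Psi /Phi X0 Y0 z0 tau0 expr0n /= !mulr0 subrr !addr0 subrr add0r.
have [Xn Yn _ _] := HX n nN; have := lower n nN.
have -> : 16 * c ^+ 2 * eta ^+ 2 + eta ^+ 2 = (16 * c ^+ 2 + 1) * eta ^+ 2 by ring.
rewrite mulrA; lra.
Qed.

End energy.

(** * The derivatives of the exact solution *)

Section fields.
Variable R : realType.
Implicit Types (T t x : R) (u : R -> R -> R) (r l m : nat).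

Lemma pair_cont (f g : R -> R) : continuous f -> continuous g ->
  continuous (fun x => (f x, g x)).
Proof. by move=> cf cg x; exact: (cvg_pair (cf x) (cg x)). Qed.

(** The indices of the mixed derivatives that regularity provides. *)
Definition reg_idx r l m : bool := ((l <= 1) && (m <= r.+1) || (l <= 3) && (m <= 1))%N.

(** The mixed derivatives of [u], frozen outside of the rectangle so that they
   are defined and continuous on the whole plane. *)
Record fields r T u (W : nat -> nat -> R -> R -> R) : Prop := Fields {
  W_cont_x : forall l m, reg_idx r l m -> forall t, continuous (W l m t);
  W_cont_t : forall l m, reg_idx r l m -> forall x, continuous (W l m ^~ x);
  W_bounded : forall l m, reg_idx r l m -> exists2 M : R, 0 <= M & forall t x, `|W l m t x| <= M;
  W_dt : forall l m, reg_idx r l m -> reg_idx r l.+1 m -> forall t x, 0 < t < T ->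
     is_derive t 1 (W l m ^~ x) (W l.+1 m t x);
  W_dx : forall l m, reg_idx r l m -> reg_idx r l m.+1 -> forall t, C1pair (W l m t) (W l m.+1 t);
  W_dtn : forall l, (l <= 3)%N -> forall t x, t \in `[0, T] -> x \in `[0, 1] ->
     dtn l T u t x = W l 0%N t x;
  W_dx1 : forall t x, t \in `[0, T] -> x \in `[0, 1] -> dx u t x = W 0%N 1%N t x;
  W_dx2 : reg_idx r 0 2 -> forall t x, t \in `[0, T] -> x \in `[0, 1] ->
     dx (dx u) t x = W 0%N 2%N t x
}.

Lemma regular_fields r T u : 0 < T -> regular r T u -> exists W, fields r T u W.
Proof.
move=> T0 [[w [w0 wI]] _].
have T0' := ltW T0.
have cT t := @clamp_in R 0 T t T0'.
have c1 x := @clamp_in R 0 1 x ler01.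
have cx l m : reg_idx r l m -> forall t, continuous (fun x => w l m (clamp 0 T t) (clamp 0 1 x)).
  move=> /wI[cw _ _] t.
  apply: (@rect_path_cont R T (fun p => w l m p.1 p.2) (fun x => (clamp 0 T t, clamp 0 1 x))) => //.
  by apply: pair_cont; [exact: cont_cst|exact: clamp_cont].
  by move=> s; split; [exact: cT|exact: c1].
exists (fun l m t x => w l m (clamp 0 T t) (clamp 0 1 x)); split.
- exact: cx.
- move=> l m /wI[cw _ _] x.
  apply: (@rect_path_cont R T (fun p => w l m p.1 p.2) (fun t => (clamp 0 T t, clamp 0 1 x))) => //.
  by apply: pair_cont; [exact: clamp_cont|exact: cont_cst].
  by move=> s; split; [exact: cT|exact: c1].
- move=> l m /wI[cw _ _]; have [M M0 HM] := rect_bounded cw.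
  by exists M => // t x; apply: (HM (clamp 0 T t) (clamp 0 1 x)); split; [exact: cT|exact: c1].
- move=> l m /wI[_ dw _] /dw H t x tT; have tT' : t \in `[0, T].
    by move: tT; rewrite in_itv /= => /andP[/ltW -> /ltW ->].
  rewrite (clamp_id tT').
  have := is_deriv_in_interior tT (H t (clamp 0 1 x) (conj tT' (c1 x))).
  exact: (@is_derive_clamp R 0 T (fun s => w l m s (clamp 0 1 x)) t _ tT).
- move=> l m Ilm Ilm1 t.
  split; [exact: cx|exact: cx|] => x x01.
  have [_ _ /(_ Ilm1) H] := wI _ _ Ilm.
  have x01' : x \in `[0, 1] by move: x01; rewrite in_itv /= => /andP[/ltW -> /ltW ->].
  rewrite (clamp_id x01').
  have := is_deriv_in_interior x01 (H (clamp 0 T t) x (conj (cT t) x01')).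
  exact: is_derive_clamp.
- elim=> [|l IH] l3 t x tT x01.
    by rewrite !clamp_id // w0.
  rewrite /dtn iterS -/(dtn l T u) /dt; apply: (deriv_inE T0 tT).
  have Il : reg_idx r l 0 by rewrite /reg_idx (ltnW l3) orbT.
  have Il1 : reg_idx r l.+1 0 by rewrite /reg_idx l3 orbT.
  have [_ /(_ Il1) H _] := wI _ _ Il.
  rewrite !clamp_id //; apply: (@eq_is_deriv_in _ _ _ (fun s => w l 0%N s x)) => //.
    by move=> y yT; rewrite IH ?(ltnW l3) // !clamp_id.
  exact: H.
- move=> t x tT x01; rewrite /dx; apply: (deriv_inE ltr01 x01).
  have Il : reg_idx r 0 0 by [].
  have Il1 : reg_idx r 0 1 by rewrite /reg_idx orbT.
  have [_ _ /(_ Il1) H] := wI _ _ Il.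
  rewrite !clamp_id //; apply: (@eq_is_deriv_in _ _ _ (w 0%N 0%N t)) => //.
    by move=> y y01; rewrite w0.
  exact: H.
- move=> Il2 t x tT x01; rewrite {1}/dx; apply: (deriv_inE ltr01 x01).
  have Il : reg_idx r 0 0 by [].
  have Il1 : reg_idx r 0 1 by rewrite /reg_idx orbT.
  have [_ _ /(_ Il1) H1] := wI _ _ Il.
  have [_ _ /(_ Il2) H2] := wI _ _ Il1.
  rewrite !clamp_id //; apply: (@eq_is_deriv_in _ _ _ (w 0%N 1%N t)) => //; last exact: H2.
  move=> y y01; apply/esym; rewrite /dx; apply: (deriv_inE ltr01 y01).
  apply: (@eq_is_deriv_in _ _ _ (w 0%N 0%N t)) => //; last exact: H1.
  by move=> z z01; rewrite w0.
Qed.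

Section bounds.
Variables (r : nat) (T : R) (u : R -> R -> R) (W : nat -> nat -> R -> R -> R).
Hypotheses (T0 : 0 < T) (reg : regular r T u) (FW : fields r T u W).

Lemma W_chain s l t : (forall m, (m <= s)%N -> reg_idx r l m) ->
  forall m, (m < s)%N -> C1pair (W l m t) (W l m.+1 t).
Proof. by move=> H m ms; apply: (W_dx FW); apply: H => //; exact: ltnW. Qed.

Lemma W_L2 l m t : reg_idx r l m -> L2 (W l m t).
Proof. by move=> I; apply: L2_continuous; exact: (W_cont_x FW I). Qed.

Lemma dtn_Hnorm s l t : (0 < s)%N -> (l <= 3)%N -> (forall m, (m <= s)%N -> reg_idx r l m) ->
  t \in `[0, T] ->
  Hnorm s (dtn l T u t) = Num.sqrt (\sum_(m < s.+1) nrm (W l m t) ^+ 2).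
Proof.
move=> s0 l3 I tT.
rewrite (@eq_Hnorm R s _ (W l 0%N t)); last by move=> x x01; exact: (W_dtn FW).
have -> := chain_Hnorm (W_chain t I) s0.
by congr Num.sqrt; apply: eq_bigr => m _; rewrite nrm_sqr.
Qed.

Lemma le_sup_itv (F : R -> R) M t : (forall s, s \in `[0, T] -> 0 <= F s <= M) -> t \in `[0, T] ->
  0 <= F t <= sup [set F s | s in `[0, T]].
Proof.
move=> FM tT; have /andP[F0 _] := FM t tT; rewrite F0 /=.
apply: ub_le_sup; last by exists t.
by exists M => _ [s sT <-]; have /andP[] := FM s sT.
Qed.

Lemma nrm_W_bounded l m : reg_idx r l m -> exists2 M : R, 0 <= M & forall t, nrm (W l m t) <= M.
Proof.
move=> I; have [M M0 HM] := W_bounded FW I; exists M => // t.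
apply: nrm_bounded => //; apply: measurable_funTS; apply: continuous_measurable_fun.
exact: (W_cont_x FW I).
Qed.

Lemma dtn_Hnorm_bounded s l : (0 < s)%N -> (l <= 3)%N -> (forall m, (m <= s)%N -> reg_idx r l m) ->
  exists M : R, forall t, t \in `[0, T] -> 0 <= Hnorm s (dtn l T u t) <= M.
Proof.
move=> s0 l3 I.
have [M HM] : exists M : nat -> R, forall m, (m <= s)%N -> forall t, nrm (W l m t) <= M m.
  have H m : exists M : R, (m <= s)%N -> forall t, nrm (W l m t) <= M.
    have [ms|ms] := leqP m s; last by exists 0.
    by have [M _ HM] := nrm_W_bounded (I m ms); exists M.
  by have [M HM] := choice H; exists M.
exists (Num.sqrt (\sum_(m < s.+1) M m ^+ 2)) => t tT.
rewrite dtn_Hnorm // sqrtr_ge0 /= ler_sqrt; last by apply: sumr_ge0 => m _; exact: sqr_ge0.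
apply: ler_sum => m _; have := HM m (ltn_ord m) t => h.
by rewrite lerXn2r ?nnegrE ?nrm_ge0 // (le_trans (nrm_ge0 _) h).
Qed.

Lemma sqrt_sum_ge s (F : nat -> R) m : (forall m, 0 <= F m) -> (m <= s)%N ->
  F m <= Num.sqrt (\sum_(i < s.+1) F i ^+ 2).
Proof.
move=> F0 ms; rewrite -[leLHS]ger0_norm // -sqrtr_sqr ler_sqrt; last by apply: sumr_ge0 => i _; exact: sqr_ge0.
have ms' : (m < s.+1)%N by [].
by rewrite (bigD1 (Ordinal ms')) //= lerDl; apply: sumr_ge0 => i _; exact: sqr_ge0.
Qed.

Lemma dtn_bdry_bounded l : (2 <= l < 5)%N ->
  exists M : R, forall t, t \in `[0, T] -> 0 <= `|dtn l T u t 1| <= M.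
Proof.
move=> /andP[l2 l5]; have one_in01 : (1 : R) \in `[0, 1] by rewrite in_itv /= ler01 lexx.
move: l5; rewrite ltnS leq_eqVlt => /orP[/eqP ->|l4].
  have [_ [_ c4]] := reg.
  by have [M _ HM] := within_bounded c4; exists M => t tT; rewrite normr_ge0 HM.
have l3 : (l <= 3)%N by rewrite -ltnS.
have I : reg_idx r l 0 by rewrite /reg_idx l3 orbT.
have [M M0 HM] := W_bounded FW I; exists M => t tT.
by rewrite normr_ge0 (W_dtn FW l3 tT one_in01); exact: HM.
Qed.

(** The suprema in Upsilon are over bounded sets, hence dominate their elements,
   and a Sobolev norm dominates the norm of each of its derivatives. *)
Lemma Upsilon_parts :
  [/\ 0 <= Upsilon r T u,
      forall l m, (l <= 1)%N -> (m <= r.+1)%N -> forall t, t \in `[0, T] -> nrm (W l m t) <= Upsilon r T u,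
      forall l, (l <= 1)%N -> forall t, t \in `[0, T] -> Hnorm r.+1 (dtn l T u t) <= Upsilon r T u,
      forall l m, (2 <= l <= 3)%N -> (m <= 1)%N -> forall t, t \in `[0, T] -> nrm (W l m t) <= Upsilon r T u
    & forall l, (2 <= l <= 4)%N -> forall t, t \in `[0, T] -> `|dtn l T u t 1| <= Upsilon r T u].
Proof.
have z0 : (0 : R) \in `[0, T] by rewrite in_itv /= lexx ltW.
pose A l := sup [set Hnorm r.+1 (dtn l T u t) | t in `[0, T]].
pose B l := sup [set Hnorm 1 (dtn l T u t) | t in `[0, T]].
pose D l := sup [set `|dtn l T u t 1| | t in `[0, T]].
have IA l : (l <= 1)%N -> forall m, (m <= r.+1)%N -> reg_idx r l m by move=> h m mr; rewrite /reg_idx h mr.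
have IB l : (l <= 3)%N -> forall m, (m <= 1)%N -> reg_idx r l m by move=> h m mr; rewrite /reg_idx h mr orbT.
have l13 l : (l <= 1)%N -> (l <= 3)%N by move=> h; exact: leq_trans h _.
have hA l : (l <= 1)%N -> forall t, t \in `[0, T] -> 0 <= Hnorm r.+1 (dtn l T u t) <= A l.
  move=> l1 t tT; have [M HM] := dtn_Hnorm_bounded (ltn0Sn r) (l13 l l1) (IA l l1).
  exact: (le_sup_itv HM tT).
have hB l : (2 <= l <= 3)%N -> forall t, t \in `[0, T] -> 0 <= Hnorm 1 (dtn l T u t) <= B l.
  move=> /andP[_ l3] t tT; have [M HM] := dtn_Hnorm_bounded (ltn0Sn 0) l3 (IB l l3).
  exact: (le_sup_itv HM tT).
have hD l : (2 <= l <= 4)%N -> forall t, t \in `[0, T] -> 0 <= `|dtn l T u t 1| <= D l.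
  move=> l4 t tT; have [M HM] := dtn_bdry_bounded l4.
  exact: (le_sup_itv HM tT).
have nn (x y : R) : 0 <= x <= y -> 0 <= y by move=> /andP[]; exact: le_trans.
have A0 := nn _ _ (hA 0%N isT 0 z0); have A1 := nn _ _ (hA 1%N isT 0 z0).
have B2 := nn _ _ (hB 2%N isT 0 z0); have B3 := nn _ _ (hB 3%N isT 0 z0).
have D2 := nn _ _ (hD 2%N isT 0 z0); have D3 := nn _ _ (hD 3%N isT 0 z0).
have D4 := nn _ _ (hD 4%N isT 0 z0).
have HA l h t tT := proj2 (andP (hA l h t tT)).
have HB l h t tT := proj2 (andP (hB l h t tT)).
have HD l h t tT := proj2 (andP (hD l h t tT)).
have UE0 : Upsilon r T u = \sum_(0 <= l < 2) A l + \sum_(2 <= l < 4) B l + \sum_(2 <= l < 5) D l.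
  by [].
clear hA hB hD; clearbody A B D.
have UE : Upsilon r T u = A 0%N + A 1%N + (B 2%N + B 3%N) + (D 2%N + (D 3%N + D 4%N)).
  by rewrite UE0 unlock /= !addr0.
clear UE0; move: (Upsilon r T u) UE => U UE.
have UA l : (l <= 1)%N -> A l <= U by rewrite UE; case: l => [|[|]] // _; lra.
have UB l : (2 <= l <= 3)%N -> B l <= U by rewrite UE; case: l => [|[|[|[|]]]] // _; lra.
have UD l : (2 <= l <= 4)%N -> D l <= U by rewrite UE; case: l => [|[|[|[|[|]]]]] // _; lra.
split.
- by rewrite UE; lra.
- move=> l m l1 mr t tT; apply: le_trans (UA l l1); apply: le_trans (HA l l1 t tT).
  rewrite (dtn_Hnorm (ltn0Sn r) (l13 l l1) (IA l l1) tT).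
  exact: (sqrt_sum_ge (fun m => nrm_ge0 (W l m t)) mr).
- by move=> l l1 t tT; exact: (le_trans (HA l l1 t tT) (UA l l1)).
- move=> l m l23 m1 t tT; apply: le_trans (UB l l23); apply: le_trans (HB l l23 t tT).
  have /andP[_ l3] := l23.
  rewrite (dtn_Hnorm (ltn0Sn 0) l3 (IB l l3) tT).
  exact: (sqrt_sum_ge (fun m => nrm_ge0 (W l m t)) m1).
- by move=> l l24 t tT; exact: (le_trans (HD l l24 t tT) (UD l l24)).
Qed.

End bounds.
End fields.

(** * One time step of the scheme *)

Section combinations.
Variable R : realType.
Implicit Types (a b c : R) (f g v w phi : R -> R).

(** Averages and difference quotients over a time step are both of this form. *)
Definition comb2 a b f g : R -> R := fun x => a * f x + b * g x.

Lemma L2_comb a b f g : L2 f -> L2 g -> L2 (comb2 a b f g).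
Proof. by move=> Lf Lg; exact: (L2_lin a Lf (L2Z b Lg)). Qed.

Lemma inner_combl a b f g phi : L2 f -> L2 g -> L2 phi ->
  inner (comb2 a b f g) phi = a * inner f phi + b * inner g phi.
Proof. by move=> Lf Lg Lp; rewrite /comb2 (inner_linl a Lf (L2Z b Lg) Lp) (innerZl b Lg Lp). Qed.

Lemma inner_combr a b f g phi : L2 f -> L2 g -> L2 phi ->
  inner phi (comb2 a b f g) = a * inner phi f + b * inner phi g.
Proof. by move=> Lf Lg Lp; rewrite innerC (inner_combl a b Lf Lg Lp) (innerC f phi) (innerC g phi). Qed.

Lemma nrm_comb a b f g : L2 f -> L2 g ->
  nrm (comb2 a b f g) <= `|a| * nrm f + `|b| * nrm g.
Proof. by move=> Lf Lg; rewrite -!nrmZ //; exact: nrmD (L2Z a Lf) (L2Z b Lg). Qed.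

Lemma nrm_mul_bounded (bM f : R -> R) (b : R) : measurable_fun (@Defs.dom R) bM ->
  (forall x, Defs.dom x -> `|bM x| <= b) -> 0 <= b -> L2 f ->
  nrm (fun x => bM x * f x) <= b * nrm f.
Proof.
move=> mb hb b0 Lf; rewrite -[X in X * nrm f]ger0_norm // -(nrmZ b Lf).
rewrite -(@ler_pXn2r _ 2) ?nnegrE ?nrm_ge0 // !nrm_sqr.
apply: (le_inner_pointwise (L2_mul_bounded mb hb Lf) (L2Z b Lf)) => x dx.
by rewrite !normrM ler_wpM2r // (ger0_norm b0) hb.
Qed.

Lemma H1Z c v : H1 v -> H1 (fun x => c * v x).
Proof.
move=> hv; have := H1_lin c hv (H1_C1 (C1pair_cst 0)).
by under eq_fun do rewrite addr0.
Qed.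

Lemma wderZ c v phi : H1 v -> L2 phi -> inner (wder (fun x => c * v x)) phi = c * inner (wder v) phi.
Proof.
move=> hv Lp; have := wder_lin c hv (H1_C1 (C1pair_cst 0)) Lp.
rewrite (C1pair_wder (C1pair_cst 0) Lp) inner0l addr0 => <-.
by congr (inner (wder _) phi); apply/funext => x; rewrite addr0.
Qed.

Lemma wder_comb a b v w phi : H1 v -> H1 w -> L2 phi ->
  inner (wder (comb2 a b v w)) phi = a * inner (wder v) phi + b * inner (wder w) phi.
Proof. by move=> hv hw Lp; rewrite /comb2 (wder_lin a hv (H1Z b hw) Lp) (wderZ b hw Lp). Qed.

Lemma bform_combl a b v w phi : H1 v -> H1 w -> H1 phi ->
  bform (comb2 a b v w) phi = a * bform v phi + b * bform w phi.
Proof. by move=> hv hw hp; rewrite !bformE; exact: wder_comb (H1_wder_L2 hp). Qed.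

Lemma bform_combr a b v w phi : H1 v -> H1 w -> H1 phi ->
  bform phi (comb2 a b v w) = a * bform phi v + b * bform phi w.
Proof. by move=> hv hw hp; rewrite bformC (bform_combl a b hv hw hp) (bformC v phi) (bformC w phi). Qed.

Lemma H1_ibp_id v : H1 v -> v 0 = 0 -> bform v (fun x => x) = v 1.
Proof.
move=> hv v0.
have pid : C1pair (fun x : R => x) (fun=> 1).
  by split; [exact: cont_id|exact: cont_cst|move=> x _; exact: is_derive_id].
have := H1_ibp hv (C1pair_cst 1); rewrite v0 mul0r subr0 mulr1.
rewrite innerC inner0l add0r => <-.
by rewrite bformC bformE (C1pair_wder pid (H1_wder_L2 hv)) innerC.
Qed.

(** Testing with the function x extracts the value at 1. *)
Lemma projection_at1 (Sh : set (R -> R)) v w : Sh (fun x => x) -> H1 v -> v 0 = 0 ->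
  (forall v, Sh v -> sobolev0 1 v) -> is_elliptic_projection Sh v w -> w 1 = v 1.
Proof.
move=> Sid hv v0 SH [wS h].
by rewrite -(H1_ibp_id hv v0) -(h _ Sid) (H1_ibp_id (Sh_is_H1 SH wS) (Sh_at0 SH wS)).
Qed.

Lemma nrm_avg_sqr f g : L2 f -> L2 g ->
  nrm (comb2 2^-1 2^-1 f g) ^+ 2 <= (nrm f ^+ 2 + nrm g ^+ 2) / 2.
Proof.
move=> Lf Lg; have := nrm_comb 2^-1 2^-1 Lf Lg.
rewrite (@ger0_norm _ 2^-1) ?invr_ge0 // => h.
have := nrm_ge0 (comb2 2^-1 2^-1 f g); have := nrm_ge0 f; have := nrm_ge0 g.
move: (nrm _) (nrm f) (nrm g) h => x y z h z0 y0 x0.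
have : 0 <= (y - z) ^+ 2 by exact: sqr_ge0.
have : x ^+ 2 <= (2^-1 * y + 2^-1 * z) ^+ 2 by rewrite lerXn2r // nnegrE; lra.
nra.
Qed.

End combinations.

(** Twice the average times the difference is the difference of the squares,
   here for a symmetric bilinear form expanded into its four values. *)
Lemma average_times_difference (R : realType) (k B B1 B0 b11 b01 b10 b00 x1 x0 : R) : 0 < k ->
  B = k^-1 * B1 + (- k^-1) * B0 -> B1 = 2^-1 * b11 + 2^-1 * b01 ->
  B0 = 2^-1 * b10 + 2^-1 * b00 -> b01 = b10 -> b11 = x1 -> b00 = x0 ->
  2 * (k * B) = x1 - x0.
Proof. by move=> k0 -> -> -> -> -> ->; field; rewrite gt_eqF. Qed.

(** The arithmetic of the energy identity: [D] is the squared norm of the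
   difference quotient, [e * d ^+ 2] has the good sign, and half of [D] absorbs
   the load [I]. *)
Lemma tested_error_energy (R : realType) (k a e dl D W X1 X0 I B S S1 S0 d m z1 z0 q s : R) :
  0 < k -> 0 < a -> e <= 0 ->
  D = (e * d + e * q + dl * m + dl * s) * d - a * B - a * S + I ->
  k * S = S1 - S0 -> k * d = z1 - z0 -> 2 * m = z1 + z0 -> 2 * (k * B) = X1 - X0 ->
  2 * I <= D + W ->
  k / a * D + X1 - X0 <= dl / a * (z1 ^+ 2 - z0 ^+ 2) + k / a * W
    + 2 * ((e * q + dl * s) / a) * (z1 - z0) - 2 * (S1 - S0).
Proof.
move=> k_gt0 a_gt0 e_le0 E ER dz az EB cs.
have -> : k / a * D + X1 - X0 = 2 * (k / a * D) - k / a * D + (X1 - X0) by ring.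
rewrite {1}E -EB -ER.
have zz : z1 ^+ 2 - z0 ^+ 2 = 2 * k * d * m.
  have -> : z1 ^+ 2 - z0 ^+ 2 = (z1 - z0) * (z1 + z0) by ring.
  by rewrite -dz -az; ring.
rewrite zz -dz.
have ka : 0 <= k / a by rewrite divr_ge0 // ltW.
have p1 : k / a * (2 * I) <= k / a * (D + W) by rewrite ler_wpM2l.
have p2 : k / a * (e * d ^+ 2) <= 0.
  by apply: mulr_ge0_le0 => //; apply: mulr_le0_ge0 => //; exact: sqr_ge0.
have -> : 2 * (k / a * ((e * d + e * q + dl * m + dl * s) * d - a * B - a * S + I)) =
  2 * (k / a * (e * d ^+ 2)) + 2 * ((e * q + dl * s) / a) * (k * d) + dl / a * (2 * k * d * m)
   - 2 * (k * B) - 2 * (k * S) + k / a * (2 * I).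
  by field; rewrite gt_eqF.
lra.
Qed.

Lemma young_average (R : realType) (l x d m y z : R) : 0 < l -> 0 <= y -> 0 <= z ->
  x <= d * m -> m ^+ 2 <= (y + z) / 2 -> 2 * x <= l * d ^+ 2 + l^-1 * (y + z).
Proof.
move=> l0 y0 z0 cs av.
have i0 : 0 < l^-1 by rewrite invr_gt0.
have : 0 <= l * (d - l^-1 * m) ^+ 2 := mulr_ge0 (ltW l0) (sqr_ge0 _).
have -> : l * (d - l^-1 * m) ^+ 2 = l * d ^+ 2 - 2 * (d * m) + l^-1 * m ^+ 2 by field; rewrite gt_eqF.
have : l^-1 * m ^+ 2 <= l^-1 * ((y + z) / 2) by rewrite ler_pM2l.
have : 0 <= l^-1 * (y + z) := mulr_ge0 (ltW i0) (addr_ge0 y0 z0).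
lra.
Qed.

Lemma sqr_sum_bound (R : realType) (b Om l o f a y z : R) : 0 <= b -> l <= f + o -> f <= b * a -> o <= Om ->
  a ^+ 2 <= (y + z) / 2 -> 0 <= l -> 0 <= o -> 0 <= f -> 0 <= a ->
  l ^+ 2 <= b ^+ 2 * (y + z) + 2 * Om ^+ 2.
Proof.
move=> b0 h1 h2 hO av n0 n1 n2 n3.
have : l ^+ 2 <= (b * a + Om) ^+ 2 by rewrite lerXn2r ?nnegrE //; lra.
have : 0 <= (b * a - Om) ^+ 2 by exact: sqr_ge0.
have : b ^+ 2 * a ^+ 2 <= b ^+ 2 * ((y + z) / 2) by rewrite ler_wpM2l ?sqr_ge0.
rewrite !sqrrD sqrrN !exprMn; lra.
Qed.

Lemma subtract_equations (R : realType) (aM eM dM gM Idth IdP Bath xR xL xM IVt If Ibath IbaP IbV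
   d1 a1 c q vt vR vL vM : R) :
  Idth + IdP = (eM * (d1 + q) + dM * (a1 + (vR + vL) / 2) + gM) * c
    - aM * (Bath + (xR + xL) / 2) + (Ibath + IbaP) + If ->
  IVt = (eM * vt + dM * vM + gM) * c - aM * xM + IbV + If ->
  Idth = (eM * d1 + eM * (q - vt) + dM * a1 + dM * ((vR + vL) / 2 - vM)) * c
    - aM * Bath - aM * ((xR + xL) / 2 - xM) + (Ibath + (IVt - IdP + (IbaP - IbV))).
Proof. move=> H1 H2; lra. Qed.

Section one_step.
Variable R : realType.
Variable Sh : set (R -> R).
Hypothesis Sh0 : Sh (fun=> 0).
Hypothesis Sh_lin : forall c v w, Sh v -> Sh w -> Sh (fun x => c * v x + w x).
Hypothesis Sh_H1 : forall v, Sh v -> sobolev0 1 v.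

Lemma Sh_comb a b v w : Sh v -> Sh w -> Sh (comb2 a b v w).
Proof. by move=> hv hw; exact: (Sh_lin a hv (ShZ Sh0 Sh_lin b hw)). Qed.

(* [L], [R] and [M] mark the left end, the right end and the midpoint of the step;
   [o] and [n] mark the old and the new values of the discrete functions. *)
Variables (k aM eM dM gM b : R) (bM fM VL VR VM VtM VxL VxR VxM Uo Un Po Pn : R -> R).
Hypotheses (k0 : 0 < k) (aM0 : 0 < aM) (eM0 : eM <= 0).
Hypotheses (mb : measurable_fun (@Defs.dom R) bM) (hb : forall x, Defs.dom x -> `|bM x| <= b).
Hypotheses (LVM : L2 VM) (LVtM : L2 VtM) (LVxM : L2 VxM) (LVxL : L2 VxL) (LVxR : L2 VxR).
Hypotheses (wVL : weq (wder VL) VxL) (wVR : weq (wder VR) VxR).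
Hypotheses (UoS : Sh Uo) (UnS : Sh Un).
Hypotheses (PoP : is_elliptic_projection Sh VL Po) (PnP : is_elliptic_projection Sh VR Pn).
Hypotheses (Po1 : Po 1 = VL 1) (Pn1 : Pn 1 = VR 1).
Hypothesis scheme : forall chi, Sh chi ->
  inner (fun x => (Un x - Uo x) / k) chi =
    (eM * ((Un 1 - Uo 1) / k) + dM * ((Un 1 + Uo 1) / 2) + gM) * chi 1
    - aM * bform (fun x => (Un x + Uo x) / 2) chi
    + inner (fun x => bM x * ((Un x + Uo x) / 2)) chi + inner fM chi.
Hypothesis weak_pde : forall chi, Sh chi ->
  inner VtM chi = (eM * VtM 1 + dM * VM 1 + gM) * chi 1
    - aM * inner VxM (wder chi) + inner (fun x => bM x * VM x) chi + inner fM chi.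

Definition theta (U P : R -> R) : R -> R := fun x => U x - P x.
Let th0 := theta Uo Po.
Let th1 := theta Un Pn.
Let dth := comb2 k^-1 (- k^-1) th1 th0.
Let ath := comb2 2^-1 2^-1 th1 th0.
Let dP := comb2 k^-1 (- k^-1) Pn Po.
Let aP := comb2 2^-1 2^-1 Pn Po.

(** The part of the load that does not involve [theta]. It contains the projection
   error, but is measured in L^2 only. *)
Definition omega : R -> R := fun x => (VtM x - dP x) + bM x * (aP x - VM x).
Definition avg_residual (chi : R -> R) : R :=
  (inner VxR (wder chi) + inner VxL (wder chi)) / 2 - inner VxM (wder chi).
Definition diff_residual : R := (VR 1 - VL 1) / k - VtM 1.
Definition trace_residual : R := (VR 1 + VL 1) / 2 - VM 1.

Let PoS : Sh Po. Proof. by case: PoP. Qed.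
Let PnS : Sh Pn. Proof. by case: PnP. Qed.
Let th0S : Sh th0. Proof. exact: (ShB Sh_lin UoS PoS). Qed.
Let th1S : Sh th1. Proof. exact: (ShB Sh_lin UnS PnS). Qed.
Let dthS : Sh dth. Proof. exact: Sh_comb. Qed.
Let athS : Sh ath. Proof. exact: Sh_comb. Qed.
Let dPS : Sh dP. Proof. exact: Sh_comb. Qed.
Let aPS : Sh aP. Proof. exact: Sh_comb. Qed.
Let ShL v : Sh v -> L2 v. Proof. by move=> h; exact: H1_L2 (Sh_is_H1 Sh_H1 h). Qed.
Let ShH v : Sh v -> H1 v. Proof. by move=> h; exact: (Sh_is_H1 Sh_H1 h). Qed.

Let LbM f : L2 f -> L2 (fun x => bM x * f x).
Proof. exact: L2_mul_bounded mb hb. Qed.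

Lemma omega_L2 : L2 omega.
Proof. by apply: L2D; [exact: L2B LVtM (ShL dPS)|apply: LbM; exact: L2B (ShL aPS) LVM]. Qed.

Let load : R -> R := fun x => bM x * ath x + omega x.

Let load_L2 : L2 load. Proof. by apply: L2D omega_L2; exact: LbM (ShL athS). Qed.

(** The scheme minus the weak form at the midpoint. The projection replaces the
   bilinear form of the projected average by that of the exact one, and the
   values of the projection at 1 are exact. *)
Lemma error_equation chi : Sh chi ->
  inner dth chi = (eM * dth 1 + eM * diff_residual + dM * ath 1 + dM * trace_residual) * chi 1
    - aM * bform ath chi - aM * avg_residual chi + inner load chi.
Proof.
move=> hc; have Hs := scheme hc; have Hp := weak_pde hc.
have Lc := ShL hc; have Hc := ShH hc; have Lwc := H1_wder_L2 Hc.
have E1 : inner (fun x => (Un x - Uo x) / k) chi = inner dth chi + inner dP chi.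
  rewrite -(innerDl (ShL dthS) (ShL dPS) Lc); congr (inner _ chi).
  by apply/funext => x; rewrite /dth /dP /comb2 /th1 /th0 /theta; ring.
have E2 : bform (fun x => (Un x + Uo x) / 2) chi = bform ath chi + bform aP chi.
  have -> : (fun x => (Un x + Uo x) / 2) = (fun x => 1 * ath x + aP x).
    by apply/funext => x; rewrite /ath /aP /comb2 /th1 /th0 /theta; field.
  by rewrite (bform_linl 1 (ShH athS) (ShH aPS) Hc) mul1r.
have E3 : bform aP chi = (inner VxR (wder chi) + inner VxL (wder chi)) / 2.
  rewrite (bform_combl 2^-1 2^-1 (ShH PnS) (ShH PoS) Hc).
  have [_ ->] := PnP; last exact: hc. have [_ ->] := PoP; last exact: hc.
  rewrite !bformE (wVR Lwc) (wVL Lwc).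
  by move: (inner _ _) (inner _ _) => x y; field.
have E4 : inner (fun x => bM x * ((Un x + Uo x) / 2)) chi =
    inner (fun x => bM x * ath x) chi + inner (fun x => bM x * aP x) chi.
  rewrite -(innerDl (LbM (ShL athS)) (LbM (ShL aPS)) Lc); congr (inner _ chi).
  by apply/funext => x; rewrite /ath /aP /comb2 /th1 /th0 /theta; field.
have E5 : inner load chi = inner (fun x => bM x * ath x) chi + (inner VtM chi - inner dP chi
    + (inner (fun x => bM x * aP x) chi - inner (fun x => bM x * VM x) chi)).
  rewrite (innerDl (LbM (ShL athS)) omega_L2 Lc); congr (_ + _).
  rewrite -(innerBl LVtM (ShL dPS) Lc) -(innerBl (LbM (ShL aPS)) (LbM LVM) Lc).
  rewrite -(innerDl (L2B LVtM (ShL dPS)) (L2B (LbM (ShL aPS)) (LbM LVM)) Lc).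
  by congr (inner _ chi); apply/funext => x; rewrite /omega; ring.
have D1 : (Un 1 - Uo 1) / k = dth 1 + (VR 1 - VL 1) / k.
  by rewrite /dth /comb2 /th1 /th0 /theta Pn1 Po1; ring.
have A1 : (Un 1 + Uo 1) / 2 = ath 1 + (VR 1 + VL 1) / 2.
  by rewrite /ath /comb2 /th1 /th0 /theta Pn1 Po1; field.
rewrite E1 E2 E3 E4 D1 A1 in Hs; rewrite E5.
exact: subtract_equations Hs Hp.
Qed.

Let kV : k * k^-1 = 1. Proof. by rewrite divff // gt_eqF. Qed.

Lemma avg_residual_dth : k * avg_residual dth = avg_residual th1 - avg_residual th0.
Proof.
rewrite /avg_residual.
have E V : L2 V -> k * inner V (wder dth) = inner V (wder th1) - inner V (wder th0).
  move=> LV; rewrite innerC (wder_comb k^-1 (- k^-1) (ShH th1S) (ShH th0S) LV).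
  by rewrite (innerC (wder th1)) (innerC (wder th0)) mulNr -mulrBr mulrA kV mul1r.
rewrite mulrBr mulrA mulrDr !E //.
by move: (inner _ _) (inner _ _) (inner _ _) (inner _ _) (inner _ _) (inner _ _) => x1 x2 x3 x4 x5 x6; ring.
Qed.

(** The error equation tested with the difference quotient of [theta]; the last
   two terms are those that have to be summed by parts in time. *)
Lemma energy_identity :
  k / aM * nrm dth ^+ 2 + nrm (wder th1) ^+ 2 - nrm (wder th0) ^+ 2 <=
    dM / aM * (th1 1 ^+ 2 - th0 1 ^+ 2) + k / aM * nrm load ^+ 2
    + 2 * ((eM * diff_residual + dM * trace_residual) / aM) * (th1 1 - th0 1)
    - 2 * (avg_residual th1 - avg_residual th0).
Proof.
have Ldth := ShL dthS.
have cs : 2 * inner load dth <= nrm dth ^+ 2 + nrm load ^+ 2.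
  have := le_trans (ler_norm _) (cauchy_schwarz load_L2 Ldth).
  move: (inner _ _) (nrm load) (nrm dth) => x y z h.
  by have := sqr_ge0 (y - z); nra.
have EB : 2 * (k * bform ath dth) = nrm (wder th1) ^+ 2 - nrm (wder th0) ^+ 2.
  have H1' := ShH th1S; have H0' := ShH th0S.
  have e0 : bform ath dth = k^-1 * bform ath th1 + (- k^-1) * bform ath th0 :=
    bform_combr k^-1 (- k^-1) H1' H0' (ShH athS).
  have e1 : bform ath th1 = 2^-1 * bform th1 th1 + 2^-1 * bform th0 th1 :=
    bform_combl 2^-1 2^-1 H1' H0' H1'.
  have e2 : bform ath th0 = 2^-1 * bform th1 th0 + 2^-1 * bform th0 th0 :=
    bform_combl 2^-1 2^-1 H1' H0' H0'.
  have e3 := bformC th0 th1; have e4 := bform_sqr th1; have e5 := bform_sqr th0.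
  exact: average_times_difference k0 e0 e1 e2 e3 e4 e5.
have E := error_equation dthS; rewrite -nrm_sqr in E.
have ER := avg_residual_dth.
have dz : k * dth 1 = th1 1 - th0 1 by rewrite /dth /comb2 mulNr -mulrBr mulrA kV mul1r.
have az : 2 * ath 1 = th1 1 + th0 1 by rewrite /ath /comb2; field.
exact: tested_error_energy k0 aM0 eM0 E ER dz az EB cs.
Qed.

(** The increase of the L^2 norm is the quotient times the average, so that it can
   be paid with an arbitrarily small multiple of the squared quotient. *)
Lemma L2_norm_step (l : R) : 0 < l ->
  nrm th1 ^+ 2 - nrm th0 ^+ 2 <= k * (l * nrm dth ^+ 2 + l^-1 * (nrm th1 ^+ 2 + nrm th0 ^+ 2)).
Proof.
move=> l0; have L1 := ShL th1S; have L0 := ShL th0S.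
have Ldth := ShL dthS; have Lath := ShL athS.
have E : nrm th1 ^+ 2 - nrm th0 ^+ 2 = k * (2 * inner dth ath).
  have e0 : inner dth ath = k^-1 * inner th1 ath + (- k^-1) * inner th0 ath :=
    inner_combl k^-1 (- k^-1) L1 L0 Lath.
  have e1 : inner th1 ath = 2^-1 * inner th1 th1 + 2^-1 * inner th1 th0 :=
    inner_combr 2^-1 2^-1 L1 L0 L1.
  have e2 : inner th0 ath = 2^-1 * inner th0 th1 + 2^-1 * inner th0 th0 :=
    inner_combr 2^-1 2^-1 L1 L0 L0.
  have e3 := innerC th1 th0; have e4 := esym (nrm_sqr th1); have e5 := esym (nrm_sqr th0).
  by rewrite -(average_times_difference k0 e0 e1 e2 e3 e4 e5) mulrCA.
have cs := le_trans (ler_norm _) (cauchy_schwarz Ldth Lath).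
have av := nrm_avg_sqr L1 L0.
rewrite E ler_pM2l //.
exact: (young_average l0 (sqr_ge0 _) (sqr_ge0 _) cs av).
Qed.

Lemma load_bound (Om : R) : 0 <= b -> nrm omega <= Om ->
  nrm load ^+ 2 <= b ^+ 2 * (nrm th1 ^+ 2 + nrm th0 ^+ 2) + 2 * Om ^+ 2.
Proof.
move=> b0 hO; have Lath := ShL athS.
have av : nrm ath ^+ 2 <= _ := nrm_avg_sqr (ShL th1S) (ShL th0S).
have h1 : nrm load <= nrm (fun x => bM x * ath x) + nrm omega := nrmD (LbM Lath) omega_L2.
have h2 : nrm (fun x => bM x * ath x) <= b * nrm ath := nrm_mul_bounded mb hb b0 Lath.
have n0 := nrm_ge0 load; have n1 := nrm_ge0 omega; have n2 := nrm_ge0 (fun x => bM x * ath x).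
have n3 := nrm_ge0 ath.
exact: sqr_sum_bound b0 h1 h2 hO av n0 n1 n2 n3.
Qed.

End one_step.

(** * The exact solution over one time step *)

Lemma average_form (R : realFieldType) (x y z n U k : R) :
  `|(x + y) / 2 - z| <= U * n * k ^+ 2 / 4 ->
  `|2^-1 * x + 2^-1 * y - z| <= U * k ^+ 2 / 4 * n.
Proof.
have -> : 2^-1 * x + 2^-1 * y - z = (x + y) / 2 - z by field.
by have -> : U * k ^+ 2 / 4 * n = U * n * k ^+ 2 / 4 by ring.
Qed.

Lemma difference_form (R : realFieldType) (x y z n U k : R) :
  `|(x - y) / k - z| <= U * n * k ^+ 2 / 4 ->
  `|z - (k^-1 * x + (- k^-1) * y)| <= U * k ^+ 2 / 4 * n.
Proof.
have -> : k^-1 * x + (- k^-1) * y = (x - y) / k by ring.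
by rewrite distrC; have -> : U * k ^+ 2 / 4 * n = U * n * k ^+ 2 / 4 by ring.
Qed.

Lemma boundary_substitution (R : realFieldType) (a w e t d v g y x c Ib If : R) :
  a * w = e * t + d * v + g -> x + y = c * w ->
  a * x + (Ib + If) = (e * t + d * v + g) * c - a * y + Ib + If.
Proof. by move=> <- /(canRL (addrK y)) ->; ring. Qed.

Section exact_solution.
Variables (R : realType) (r : nat) (T : R) (u : R -> R -> R) (W : nat -> nat -> R -> R -> R).
Hypotheses (r1 : (1 <= r)%N) (T0 : 0 < T) (reg : regular r T u) (FW : fields r T u W).
Local Notation Ups := (Upsilon r T u).
Implicit Types (t x M k : R) (phi chi : R -> R).

(** The duality that turns residuals depending on x into scalar functions of t. *)
Lemma inner_curve n m phi : (forall j, (j <= n)%N -> reg_idx r j m) -> L2 phi ->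
  curve T n (fun j t => inner (W j m t) phi).
Proof.
move=> I Lp j jn.
have Ij := I j (ltnW jn); have Ij1 := I j.+1 jn.
have [B B0 HB] := W_bounded FW Ij; have [B' B0' HB'] := W_bounded FW Ij1.
split.
  exact: (under_integral_cont HB (W_cont_t FW Ij) (W_cont_x FW Ij) Lp).
apply: (under_integral_derive HB' (W_cont_x FW Ij) (W_cont_x FW Ij1) Lp).
by move=> t x tT _; exact: (W_dt FW Ij Ij1 x tT).
Qed.

Lemma reg_idx_low m j : (m <= 1)%N -> (j <= 3)%N -> reg_idx r j m.
Proof. by move=> h1 h2; rewrite /reg_idx h1 h2 orbT. Qed.

Lemma reg_idx_high m j : (m <= r.+1)%N -> (j <= 1)%N -> reg_idx r j m.
Proof. by move=> h1 h2; rewrite /reg_idx h1 h2. Qed.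

Lemma oo_cc t : 0 < t < T -> t \in `[0, T].
Proof. by rewrite in_itv /= => /andP[/ltW -> /ltW ->]. Qed.

Lemma Ups_ge0 : 0 <= Ups. Proof. by have [] := Upsilon_parts T0 reg FW. Qed.

Lemma inner_W_le l m phi t : (2 <= l <= 3)%N -> (m <= 1)%N -> L2 phi -> 0 < t < T ->
  `|inner (W l m t) phi| <= Ups * nrm phi.
Proof.
move=> l23 m1 Lp tT; have [_ _ _ H _] := Upsilon_parts T0 reg FW.
have Il : reg_idx r l m by apply: reg_idx_low => //; case/andP: l23.
apply: (le_trans (cauchy_schwarz (W_L2 FW t Il) Lp)).
apply: ler_wpM2r; first exact: nrm_ge0.
by apply: H => //; exact: oo_cc.
Qed.

Lemma inner_W1_le m phi t : (m <= r.+1)%N -> L2 phi -> 0 < t < T ->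
  `|inner (W 1%N m t) phi| <= Ups * nrm phi.
Proof.
move=> m1 Lp tT; have [_ H _ _ _] := Upsilon_parts T0 reg FW.
have Il : reg_idx r 1 m by apply: reg_idx_high.
apply: (le_trans (cauchy_schwarz (W_L2 FW t Il) Lp)).
apply: ler_wpM2r; first exact: nrm_ge0.
by apply: H => //; exact: oo_cc.
Qed.

(** The fourth time derivative exists at the right end only, hence the separate
   case. *)
Definition bdry (l : nat) (t : R) : R :=
  if (l < 4)%N then W l 0%N t 1 else dtn 4 T u (clamp 0 T t) 1.

Lemma one_in01 : (1 : R) \in `[0, 1]. Proof. by rewrite in_itv /= ler01 lexx. Qed.

Lemma bdry_curve : curve T 4 bdry.
Proof.
move=> j j4; have I := @reg_idx_low 0 j isT j4.
have -> : bdry j = (fun t => W j 0%N t 1) by rewrite /bdry j4.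
split; first exact: (W_cont_t FW I).
rewrite /bdry.
move=> t tT; move: (j4); rewrite ltnS leq_eqVlt => /orP[/eqP j3|j3]; last first.
  by rewrite (j3 : (j.+1 < 4)%N); exact: (W_dt FW I (@reg_idx_low 0 j.+1 isT j3) 1 tT).
rewrite j3 /=; have [_ [d4 _]] := reg.
have tT' := oo_cc tT.
rewrite (clamp_id tT').
apply: (near_eq_is_derive _ (is_deriv_in_interior tT (d4 t tT'))).
have /andP[t0 t1] := tT.
near=> s; apply: (W_dtn FW) => //; last exact: one_in01.
rewrite in_itv /=; apply/andP; split; apply: ltW; near: s; [exact: near_gt|exact: near_lt].
Unshelve. all: by end_near. Qed.

Lemma bdry_le l t : (2 <= l <= 4)%N -> 0 < t < T -> `|bdry l t| <= Ups.
Proof.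
move=> l24 tT; have [_ _ _ _ H] := Upsilon_parts T0 reg FW.
have tT' := oo_cc tT; have := H l l24 t tT'; rewrite /bdry.
have /andP[_] := l24; rewrite leq_eqVlt => /orP[/eqP ->|l4].
  by rewrite /= (clamp_id tT').
by rewrite l4 (W_dtn FW) //; exact: one_in01.
Qed.

Section time_step.
Variables (M k : R).
Hypotheses (k0 : 0 < k) (L0 : 0 <= M - k / 2) (RT : M + k / 2 <= T).
Let B phi := Ups * nrm phi.

Let B0 phi : 0 <= B phi. Proof. by apply: mulr_ge0; [exact: Ups_ge0|exact: nrm_ge0]. Qed.

Lemma avg_inner m phi : (m <= 1)%N -> L2 phi ->
  `|(inner (W 0%N m (M + k / 2)) phi + inner (W 0%N m (M - k / 2)) phi) / 2
     - inner (W 0%N m M) phi| <= Ups * nrm phi * k ^+ 2 / 4.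
Proof.
move=> m1 Lp; apply: (average_rule k0 L0 RT (B0 phi) (inner_curve (n := 2) _ Lp)).
  by move=> j j2; apply: reg_idx_low => //; exact: leq_trans j2 _.
by move=> t tT; exact: inner_W_le.
Qed.

Lemma diff_inner phi : L2 phi ->
  `|(inner (W 0%N 0%N (M + k / 2)) phi - inner (W 0%N 0%N (M - k / 2)) phi) / k
     - inner (W 1%N 0%N M) phi| <= Ups * nrm phi * k ^+ 2 / 4.
Proof.
move=> Lp; apply: (difference_rule k0 L0 RT (B0 phi) (inner_curve (n := 3) _ Lp)).
  by move=> j j2; apply: reg_idx_low.
by move=> t tT; exact: inner_W_le.
Qed.

Lemma nrm_avg_error :
  nrm (fun x => comb2 2^-1 2^-1 (W 0%N 0%N (M + k / 2)) (W 0%N 0%N (M - k / 2)) x - W 0%N 0%N M x)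
    <= Ups * k ^+ 2 / 4.
Proof.
have I : reg_idx r 0 0 by [].
have LW t : L2 (W 0%N 0%N t) := W_L2 FW t I.
have Lc := L2_comb 2^-1 2^-1 (LW (M + k / 2)) (LW (M - k / 2)).
apply: le_nrm_inner; first exact: L2B.
  by have := Ups_ge0; have := sqr_ge0 k; nra.
move=> phi Lp; rewrite (innerBl Lc (LW M) Lp) (inner_combl 2^-1 2^-1 (LW _) (LW _) Lp).
exact: average_form (avg_inner (m := 0) isT Lp).
Qed.

Lemma nrm_diff_error :
  nrm (fun x => W 1%N 0%N M x - comb2 k^-1 (- k^-1) (W 0%N 0%N (M + k / 2)) (W 0%N 0%N (M - k / 2)) x)
    <= Ups * k ^+ 2 / 4.
Proof.
have I : reg_idx r 0 0 by [].
have LW t : L2 (W 0%N 0%N t) := W_L2 FW t I.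
have LW1 : L2 (W 1%N 0%N M) := W_L2 FW M (@reg_idx_low 0 1 isT isT).
have Lc := L2_comb k^-1 (- k^-1) (LW (M + k / 2)) (LW (M - k / 2)).
apply: le_nrm_inner; first exact: L2B.
  by have := Ups_ge0; have := sqr_ge0 k; nra.
move=> phi Lp; rewrite (innerBl LW1 Lc Lp) (inner_combl k^-1 (- k^-1) (LW _) (LW _) Lp).
exact: difference_form (diff_inner Lp).
Qed.

Let L := M - k / 2.
Let R' := M + k / 2.
Let dW m := comb2 k^-1 (- k^-1) (W 0%N m R') (W 0%N m L).

Lemma quot_chain m : (m < r.+1)%N -> C1pair (dW m) (dW m.+1).
Proof.
move=> mr; have I : reg_idx r 0 m by apply: reg_idx_high => //; exact: ltnW.
have I1 : reg_idx r 0 m.+1 by apply: reg_idx_high.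
have [c1 c2 d1] := W_dx FW I I1 R'; have [c3 c4 d3] := W_dx FW I I1 L.
split; [by rewrite /dW /comb2; cts|by rewrite /dW /comb2; cts|].
move=> x x01; have e1 := d1 x x01; have e2 := d3 x x01.
have -> : dW m = k^-1 \*: W 0%N m R' + (- k^-1) \*: W 0%N m L by [].
exact: is_deriveD.
Qed.

(** The projection is linear, so that the projection error of the difference
   quotient is controlled by the first time derivative of [u] in H^(r+1), without
   the factor 1 / k. *)
Lemma quot_sobolev : (forall t, t \in `[0, T] -> u t 0 = 0) ->
  sobolev0 r.+1 (dW 0%N) /\ Hnorm r.+1 (dW 0%N) <= (r.+2)%:R * Ups.
Proof.
move=> u0.
have LT : L \in `[0, T] by rewrite in_itv /= /L; move: k0 L0 RT => ? ? ?; apply/andP; split; lra.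
have RT' : R' \in `[0, T] by rewrite in_itv /= /R'; move: k0 L0 RT => ? ? ?; apply/andP; split; lra.
have z01 : (0 : R) \in `[0, 1] by rewrite in_itv /= lexx ler01.
have U0 := Ups_ge0.
split.
  split; first exact: (chain_sobolev quot_chain).
  have H t : t \in `[0, T] -> W 0%N 0%N t 0 = 0.
    by move=> tT; rewrite -(W_dtn FW (isT : (0 <= 3)%N) tT z01) /dtn /= u0.
  by rewrite /dW /comb2 !H // !mulr0 addr0.
rewrite (chain_Hnorm quot_chain) //.
have nb m : (m <= r.+1)%N -> nrm (dW m) <= Ups.
  move=> mr; have I j : (j <= 1)%N -> reg_idx r j m by move=> j1; apply: reg_idx_high.
  have LW t : L2 (W 0%N m t) := W_L2 FW t (I 0%N isT).
  apply: le_nrm_inner; [exact: L2_comb|exact: U0|] => phi Lp.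
  rewrite (inner_combl k^-1 (- k^-1) (LW _) (LW _) Lp) mulNr -mulrBr.
  have Bp : 0 <= Ups * nrm phi by apply: mulr_ge0 => //; exact: nrm_ge0.
  have := curve_lipschitz Bp (inner_curve I Lp) LT RT' (fun t tT => inner_W1_le mr Lp tT).
  have -> : R' - L = k by rewrite /R' /L; field.
  rewrite normrM (gtr0_norm k0) gtr0_norm ?invr_gt0 // => h.
  by rewrite -ler_pdivlMl ?invr_gt0 // invrK mulrC.
apply: (@le_trans _ _ (Num.sqrt (((r.+2)%:R * Ups) ^+ 2))); last first.
  by rewrite sqrtr_sqr ger0_norm // mulr_ge0.
rewrite ler_sqrt ?sqr_ge0 //.
apply: (@le_trans _ _ (\sum_(m < r.+2) Ups ^+ 2)).
  apply: ler_sum => m _; rewrite -nrm_sqr lerXn2r ?nnegrE ?nrm_ge0 //.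
  by apply: nb; rewrite -ltnS.
rewrite sumr_const card_ord -[leLHS]mulr_natl exprMn ler_wpM2r ?sqr_ge0 //.
by rewrite expr2 ler_peMr // ler1n.
Qed.

End time_step.

(** The equation multiplied by [chi] and integrated by parts; the boundary
   condition replaces the flux at 1, and [chi 0 = 0] removes the one at 0. *)
Lemma weak_form a beta eps delta f g u0 M chi :
  solution T a beta eps delta f g u0 u -> M \in `[0, T] ->
  L2 (f M) -> (forall phi, L2 phi -> L2 (fun x => beta M x * phi x)) ->
  H1 chi -> chi 0 = 0 ->
  inner (W 1%N 0%N M) chi = (eps M * W 1%N 0%N M 1 + delta M * W 0%N 0%N M 1 + g M) * chi 1
    - a M * inner (W 0%N 1%N M) (wder chi) + inner (fun x => beta M x * W 0%N 0%N M x) chi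
    + inner (f M) chi.
Proof.
move=> [pde _ bc _] MT Lf Lb Hc c0.
have I00 : reg_idx r 0 0 by [].
have I01 : reg_idx r 0 1 := @reg_idx_low 1 0 isT isT.
have I02 : reg_idx r 0 2 by apply: reg_idx_high.
have I10 : reg_idx r 1 0 := @reg_idx_low 0 1 isT isT.
have Lc := H1_L2 Hc.
have L00 := W_L2 FW M I00; have L02 := W_L2 FW M I02.
have Lb0 := Lb _ L00.
have E : {in @Defs.dom R, W 1%N 0%N M =1
   (fun x => a M * W 0%N 2%N M x + (beta M x * W 0%N 0%N M x + f M x))}.
  move=> x /set_mem /dom_cc x01; have := pde M x MT x01.
  have -> : dt T u M x = W 1%N 0%N M x := W_dtn FW (isT : (1 <= 3)%N) MT x01.
  have <- : u M x = W 0%N 0%N M x := W_dtn FW (isT : (0 <= 3)%N) MT x01.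
  by rewrite (W_dx2 FW I02 MT x01) -addrA.
rewrite (eq_innerl chi E) (inner_linl (a M) L02 (L2D Lb0 Lf) Lc) (innerDl Lb0 Lf Lc).
have ibp := H1_ibp Hc (W_dx FW I01 I02 M); rewrite c0 mul0r subr0 in ibp.
rewrite (innerC chi) (innerC (wder chi)) in ibp.
have bcM := bc M MT; rewrite (W_dx1 FW MT one_in01) in bcM.
have e1 : dt T u M 1 = W 1%N 0%N M 1 := W_dtn FW (isT : (1 <= 3)%N) MT one_in01.
have e0 : u M 1 = W 0%N 0%N M 1 := W_dtn FW (isT : (0 <= 3)%N) MT one_in01.
rewrite e1 e0 in bcM.
exact: boundary_substitution bcM ibp.
Qed.

End exact_solution.

(** * Time residuals and their increments; coefficients; partitions *)

Section residuals.
Variables (R : realType) (r : nat) (T : R) (u : R -> R -> R) (W : nat -> nat -> R -> R -> R).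
Hypotheses (T0 : 0 < T) (reg : regular r T u) (FW : fields r T u W).
Local Notation Ups := (Upsilon r T u).
Local Notation bd := (bdry T u W).
Let U0 : 0 <= Ups. Proof. exact: (Ups_ge0 T0 reg FW). Qed.

Lemma shift_curve n m (G : nat -> R -> R) : curve T (m + n) G -> curve T n (fun j => G (m + j)%N).
Proof. by move=> cG j jn; rewrite addnS; apply: cG; rewrite ltn_add2l. Qed.

Lemma sub_curve n m (G : nat -> R -> R) : (n <= m)%N -> curve T m G -> curve T n G.
Proof. by move=> nm cG j jn; apply: cG; exact: leq_trans jn nm. Qed.

(** The boundary and average residuals of a step, as functions of its midpoint
   [M] and its length [k], which is how consecutive ones are compared. *)
Definition diff_res (M k : R) : R := (bd 0%N (M + k / 2) - bd 0%N (M - k / 2)) / k - bd 1%N M.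
Definition trace_res (M k : R) : R := (bd 0%N (M + k / 2) + bd 0%N (M - k / 2)) / 2 - bd 0%N M.
Definition avg_res (phi : R -> R) (M k : R) : R :=
  (inner (W 0%N 1%N (M + k / 2)) phi + inner (W 0%N 1%N (M - k / 2)) phi) / 2
  - inner (W 0%N 1%N M) phi.

Let bc := bdry_curve reg FW.

Lemma diff_res_le M k : 0 < k -> 0 <= M - k / 2 -> M + k / 2 <= T -> `|diff_res M k| <= Ups * k ^+ 2 / 4.
Proof.
move=> k0 L0 RT; apply: (difference_rule k0 L0 RT U0 (@sub_curve 3 4 _ isT bc)).
by move=> t tT; exact: (bdry_le T0 reg FW).
Qed.

Lemma trace_res_le M k : 0 < k -> 0 <= M - k / 2 -> M + k / 2 <= T -> `|trace_res M k| <= Ups * k ^+ 2 / 4.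
Proof.
move=> k0 L0 RT; apply: (average_rule k0 L0 RT U0 (@sub_curve 2 4 _ isT bc)).
by move=> t tT; exact: (bdry_le T0 reg FW).
Qed.

Lemma avg_res_le phi M k : L2 phi -> 0 < k -> 0 <= M - k / 2 -> M + k / 2 <= T ->
  `|avg_res phi M k| <= Ups * nrm phi * k ^+ 2 / 4.
Proof. by move=> Lp k0 L0 RT; exact: (avg_inner T0 reg FW k0 L0 RT (m := 1)). Qed.

(** The unprimed step is followed by the primed one. *)
Section adjacent.
Variables (M M' k k' K Cs : R).
Hypotheses (Cs0 : 0 <= Cs) (hk : 0 < k <= K) (hk' : 0 < k' <= K).
Hypotheses (L0 : 0 <= M - k / 2) (RL : M + k / 2 = M' - k' / 2) (RT : M' + k' / 2 <= T).
Hypothesis dk : `|k' - k| <= Cs * K ^+ 2.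

Let k0 : 0 < k. Proof. by case/andP: hk. Qed.
Let k0' : 0 < k'. Proof. by case/andP: hk'. Qed.
Let RT1 : M + k / 2 <= T. Proof. by move: k0' RL RT => *; lra. Qed.
Let L0' : 0 <= M' - k' / 2. Proof. by move: k0 RL L0 => *; lra. Qed.
Let MM : M' - M = (k + k') / 2. Proof. by move: RL => *; lra. Qed.
Let MT : M \in `[0, T].
Proof. by rewrite in_itv /=; move: k0 L0 RT1 => *; apply/andP; split; lra. Qed.
Let MT' : M' \in `[0, T].
Proof. by rewrite in_itv /=; move: k0' L0' RT => *; apply/andP; split; lra. Qed.
Let MI' : 0 < M' < T.
Proof. by move: k0' L0' RT => *; apply/andP; split; lra. Qed.

Lemma diff_res_diff : `|diff_res M' k' - diff_res M k| <= (1 + Cs) * Ups * K ^+ 2 * (k + k').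
Proof.
have c24 : 0 <= (1 / 24 : R) <= 1 / 8 by apply/andP; split; lra.
have B4 t : 0 < t < T -> `|bd 4%N t| <= Ups by exact: (bdry_le T0 reg FW).
have lip := curve_lipschitz U0 (@shift_curve 1 3 _ bc) MT MT' B4.
have e1 := difference_expansion k0 L0 RT1 U0 bc B4.
have e2 := difference_expansion k0' L0' RT U0 bc B4.
have H3 : `|bd 3%N M'| <= Ups by apply: (bdry_le T0 reg FW) => //; exact: MI'.
apply: (residual_difference Cs0 U0 c24 hk hk' MM dk lip H3).
  by have -> : 1 / 24 * k ^+ 2 * bd 3%N M = k ^+ 2 / 24 * bd 3%N M by ring.
by have -> : 1 / 24 * k' ^+ 2 * bd 3%N M' = k' ^+ 2 / 24 * bd 3%N M' by ring.
Qed.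

Lemma trace_res_diff : `|trace_res M' k' - trace_res M k| <= (1 + Cs) * Ups * K ^+ 2 * (k + k').
Proof.
have c8 : 0 <= (1 / 8 : R) <= 1 / 8 by apply/andP; split; lra.
have B3 t : 0 < t < T -> `|bd 3%N t| <= Ups by exact: (bdry_le T0 reg FW).
have bc3 := @sub_curve 3 4 _ isT bc.
have lip := curve_lipschitz U0 (@shift_curve 1 2 _ bc3) MT MT' B3.
have e1 := average_expansion k0 L0 RT1 U0 bc3 B3.
have e2 := average_expansion k0' L0' RT U0 bc3 B3.
have H3 : `|bd 2%N M'| <= Ups by apply: (bdry_le T0 reg FW) => //; exact: MI'.
apply: (residual_difference Cs0 U0 c8 hk hk' MM dk lip H3).
  by have -> : 1 / 8 * k ^+ 2 * bd 2%N M = k ^+ 2 / 8 * bd 2%N M by ring.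
by have -> : 1 / 8 * k' ^+ 2 * bd 2%N M' = k' ^+ 2 / 8 * bd 2%N M' by ring.
Qed.

Lemma avg_res_diff phi : L2 phi ->
  `|avg_res phi M' k' - avg_res phi M k| <= (1 + Cs) * (Ups * nrm phi) * K ^+ 2 * (k + k').
Proof.
move=> Lp; have B0 : 0 <= Ups * nrm phi by apply: mulr_ge0 U0 (nrm_ge0 _).
have c8 : 0 <= (1 / 8 : R) <= 1 / 8 by apply/andP; split; lra.
have B3 t : 0 < t < T -> `|inner (W 3%N 1%N t) phi| <= Ups * nrm phi.
  by move=> tT; exact: (inner_W_le T0 reg FW).
have c3 : curve T 3 (fun j t => inner (W j 1%N t) phi).
  by apply: (inner_curve FW) => // j j3; exact: reg_idx_low.
have lip := curve_lipschitz B0 (@shift_curve 1 2 _ c3) MT MT' B3.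
have e1 := average_expansion k0 L0 RT1 B0 c3 B3.
have e2 := average_expansion k0' L0' RT B0 c3 B3.
have H3 : `|inner (W 2%N 1%N M') phi| <= Ups * nrm phi by apply: (inner_W_le T0 reg FW) => //; exact: MI'.
apply: (residual_difference Cs0 B0 c8 hk hk' MM dk lip H3).
  by have -> : 1 / 8 * k ^+ 2 * inner (W (2 + 0)%N 1%N M) phi = k ^+ 2 / 8 * inner (W 2%N 1%N M) phi by ring.
by have -> : 1 / 8 * k' ^+ 2 * inner (W (2 + 0)%N 1%N M') phi = k' ^+ 2 / 8 * inner (W 2%N 1%N M') phi by ring.
Qed.

End adjacent.
End residuals.

Section coefficient_facts.
Variable R : realType.

Lemma quotient_lipschitz (T a0 La Lf : R) (a f : R -> R) : 0 < a0 -> 0 <= La -> 0 <= Lf ->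
  (forall t, t \in `[0, T] -> a0 <= a t) ->
  (forall s t, s \in `[0, T] -> t \in `[0, T] -> `|a t - a s| <= La * `|t - s|) ->
  (forall t, t \in `[0, T] -> `|f t| <= Lf) ->
  (forall s t, s \in `[0, T] -> t \in `[0, T] -> `|f t - f s| <= Lf * `|t - s|) ->
  let L := Lf / a0 + Lf * La / a0 ^+ 2 in
  [/\ 0 <= L, forall t, t \in `[0, T] -> `|f t / a t| <= L &
    forall s t, s \in `[0, T] -> t \in `[0, T] -> `|f t / a t - f s / a s| <= L * `|t - s|].
Proof.
move=> a00 La0 Lf0 ha la hf lf L.
have p1 : 0 <= Lf / a0 by rewrite divr_ge0 // ltW.
have p2 : 0 <= Lf * La / a0 ^+ 2 by rewrite divr_ge0 ?mulr_ge0 // ?exprn_ge0 // ltW.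
have ap t : t \in `[0, T] -> 0 < a t by move=> /ha; exact: lt_le_trans.
have ai t : t \in `[0, T] -> (a t)^-1 <= a0^-1.
  by move=> tT; rewrite lef_pV2 ?posrE ?ap // ha.
have ai0 t : t \in `[0, T] -> 0 <= (a t)^-1 by move=> /ap h; rewrite invr_ge0 ltW.
split; first by rewrite /L addr_ge0.
- move=> t tT; rewrite normrM (ger0_norm (ai0 t tT)).
  apply: (@le_trans _ _ (Lf / a0)); last by rewrite /L lerDl.
  by apply: ler_pM => //; [exact: ai0|exact: hf|exact: ai].
- move=> s t sT tT; have at0 := ap t tT; have as0 := ap s sT.
  have -> : f t / a t - f s / a s = (f t - f s) * (a t)^-1 - f s * (a t - a s) * ((a t)^-1 * (a s)^-1).
    by field; rewrite !gt_eqF.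
  apply: le_trans (ler_normB _ _) _; rewrite /L [leRHS]mulrDl; apply: lerD.
    rewrite normrM (ger0_norm (ai0 t tT)) [leRHS]mulrAC.
    by apply: ler_pM => //; [exact: ai0|exact: lf|exact: ai].
  rewrite !normrM (ger0_norm (ai0 t tT)) (ger0_norm (ai0 s sT)).
  have -> : Lf * La / a0 ^+ 2 * `|t - s| = Lf * (La * `|t - s|) * (a0^-1 * a0^-1).
    by rewrite expr2 invfM; ring.
  apply: ler_pM; rewrite ?mulr_ge0 ?ai0 //.
    by apply: ler_pM => //; [exact: hf|exact: la].
  by apply: ler_pM; rewrite ?ai0 ?ai.
Qed.

Lemma smooth2_slice (T : R) (f : R -> R -> R) t : smooth2 T f -> t \in `[0, T] ->
  {within `[0, 1], continuous (f t)}.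
Proof.
move=> [w [w0 wI]] tT; have [cw _ _] := wI 0%N 0%N isT.
have c : continuous (fun x => w 0%N 0%N t (clamp 0 1 x)).
  apply: (@rect_path_cont R T (fun p => w 0%N 0%N p.1 p.2) (fun x => (t, clamp 0 1 x))) => //.
    by apply: pair_cont; [exact: cont_cst|exact: clamp_cont].
  by move=> s; split => //; exact: clamp_in ler01.
apply: (@subspace_eq_continuous _ _ _ (fun x => w 0%N 0%N t (clamp 0 1 x))); last exact: continuous_subspaceT.
by move=> x /set_mem x01; rewrite /= clamp_id // w0.
Qed.

Lemma smooth2_bounded (T : R) (f : R -> R -> R) : smooth2 T f ->
  exists2 M : R, 0 <= M & forall t x, t \in `[0, T] -> x \in `[0, 1] -> `|f t x| <= M.
Proof.
move=> [w [w0 wI]]; have [cw _ _] := wI 0%N 0%N isT.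
have [M M0 HM] := rect_bounded cw; exists M => // t x tT x01.
by rewrite -w0 //; exact: HM.
Qed.

Section partition.
Variables (T : R) (N : nat) (t : nat -> R).
Hypothesis pt : is_partition T N t.

Lemma partition_le n m : (n <= m)%N -> (m <= N)%N -> t n <= t m.
Proof.
have [_ _ H] := pt; elim: m => [|m IH]; first by rewrite leqn0 => /eqP ->.
rewrite leq_eqVlt => /orP[/eqP -> //|nm] mN.
by apply: le_trans (IH nm (ltnW mN)) (ltW (H m mN)).
Qed.

Lemma partition_in n : (n <= N)%N -> t n \in `[0, T].
Proof.
move=> nN; have [t0 tN _] := pt; rewrite in_itv /=.
have := partition_le (leq0n n) nN; have := partition_le nN (leqnn N).
by rewrite t0 tN => -> ->.
Qed.

Lemma step_gt0 n : (1 <= n <= N)%N -> 0 < step t n.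
Proof. by case: n => // n /andP[_ nN]; rewrite /step subr_gt0; have [_ _] := pt; apply. Qed.

Lemma step_le_mesh n : (1 <= n <= N)%N -> step t n <= mesh N t.
Proof.
move=> nN; rewrite /mesh; apply: (@Order.TotalTheory.le_bigmax_seq _ _ _ _ _ n) => //.
by rewrite mem_index_iota ltnS.
Qed.

Lemma mid_left n : midpoint t n - step t n / 2 = t n.-1.
Proof. by rewrite /midpoint /step; field. Qed.

Lemma mid_right n : midpoint t n + step t n / 2 = t n.
Proof. by rewrite /midpoint /step; field. Qed.

End partition.
End coefficient_facts.

(** * Consistency of the projected solution *)

Section projected_solution.
Variable R : realType.

(** Makes the difference quotient of projection errors a projection error. *)
Lemma projection_comb (Sh : set (R -> R)) (a b : R) (v v' w w' : R -> R) :
  Sh (fun=> 0) -> (forall c v w, Sh v -> Sh w -> Sh (fun x => c * v x + w x)) ->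
  (forall v, Sh v -> sobolev0 1 v) -> H1 v -> H1 v' ->
  is_elliptic_projection Sh v w -> is_elliptic_projection Sh v' w' ->
  is_elliptic_projection Sh (comb2 a b v v') (comb2 a b w w').
Proof.
move=> S0 Sl SH hv hv' [wS h] [wS' h']; split; first exact: (Sh_comb S0 Sl a b wS wS').
move=> phi hp; have Hp := Sh_is_H1 SH hp.
have Hw := Sh_is_H1 SH wS; have Hw' := Sh_is_H1 SH wS'.
by rewrite (bform_combl a b Hw Hw' Hp) (bform_combl a b hv hv' Hp) (h _ hp) (h' _ hp).
Qed.

Variables (r : nat) (T : R) (u : R -> R -> R) (W : nat -> nat -> R -> R -> R).
Hypotheses (T0 : 0 < T) (reg : regular r T u) (FW : fields r T u W).
Hypothesis u0 : forall t, t \in `[0, T] -> u t 0 = 0.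
Local Notation Ups := (Upsilon r T u).
Local Notation V := (W 0%N 0%N).

Lemma V_sobolev0 t : t \in `[0, T] -> sobolev0 r.+1 (V t).
Proof.
move=> tT; have I m : (m <= r.+1)%N -> reg_idx r 0 m by move=> h; apply: reg_idx_high.
split; first exact: (chain_sobolev (W_chain FW t I)).
have z01 : (0 : R) \in `[0, 1] by rewrite in_itv /= lexx ler01.
by rewrite -(W_dtn FW (isT : (0 <= 3)%N) tT z01) /dtn /= u0.
Qed.

Lemma V_H1 t : H1 (V t).
Proof.
have I0 : reg_idx r 0 0 by [].
have I1 : reg_idx r 0 1 := @reg_idx_low r 1 0 isT isT.
exact: H1_C1 (W_dx FW I0 I1 t).
Qed.

Lemma V_Hnorm t : t \in `[0, T] -> Hnorm r.+1 (V t) <= Ups.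
Proof.
move=> tT; have [_ _ H _ _] := Upsilon_parts T0 reg FW.
rewrite -(@eq_Hnorm R r.+1 (dtn 0 T u t)); first exact: H.
by move=> x x01; exact: (W_dtn FW).
Qed.

Section omega_estimate.
Variables (Sh : set (R -> R)) (H : R).
Hypothesis Sh0 : Sh (fun=> 0).
Hypothesis Sh_lin : forall c v w, Sh v -> Sh w -> Sh (fun x => c * v x + w x).
Hypothesis Sh_H1 : forall v, Sh v -> sobolev0 1 v.
Hypothesis H0 : 0 <= H.
Hypothesis proj_err : forall v w, sobolev0 r.+1 v -> is_elliptic_projection Sh v w ->
  nrm (fun x => v x - w x) <= H * Hnorm r.+1 v.

(** The difference quotient and the average of the exact solution are inserted:
   the time errors are O(k^2) by the midpoint rules, and the remaining
   differences are projection errors. *)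
Lemma omega_bound (M k b : R) (bM Po Pn : R -> R) : 0 < k -> 0 <= M - k / 2 -> M + k / 2 <= T ->
  measurable_fun (@Defs.dom R) bM -> (forall x, Defs.dom x -> `|bM x| <= b) -> 0 <= b ->
  is_elliptic_projection Sh (V (M - k / 2)) Po -> is_elliptic_projection Sh (V (M + k / 2)) Pn ->
  nrm (omega k bM (V M) (W 1%N 0%N M) Po Pn) <=
    (1 + b) * (Ups * k ^+ 2 / 4 + H * (r.+2%:R * Ups)).
Proof.
move=> k0 L0 RT mb hb b0 hPo hPn.
have LT : M - k / 2 \in `[0, T] by rewrite in_itv /=; apply/andP; split; lra.
have RT' : M + k / 2 \in `[0, T] by rewrite in_itv /=; apply/andP; split; lra.
have I00 : reg_idx r 0 0 by [].
have I10 : reg_idx r 1 0 := @reg_idx_low r 0 1 isT isT.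
have LV s : L2 (V s) := W_L2 FW s I00.
have LV1 : L2 (W 1%N 0%N M) := W_L2 FW M I10.
have [PoS _] := hPo; have [PnS _] := hPn.
have LPo := H1_L2 (Sh_is_H1 Sh_H1 PoS); have LPn := H1_L2 (Sh_is_H1 Sh_H1 PnS).
set VL := V (M - k / 2) in hPo *; set VR := V (M + k / 2) in hPn *.
have LVL : L2 VL := LV _; have LVR : L2 VR := LV _.
pose dV := comb2 k^-1 (- k^-1) VR VL; pose aV := comb2 2^-1 2^-1 VR VL.
pose dP := comb2 k^-1 (- k^-1) Pn Po; pose aP := comb2 2^-1 2^-1 Pn Po.
have LdV : L2 dV := L2_comb _ _ LVR LVL; have LaV : L2 aV := L2_comb _ _ LVR LVL.
have LdP : L2 dP := L2_comb _ _ LPn LPo; have LaP : L2 aP := L2_comb _ _ LPn LPo.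
have U0 := Ups_ge0 T0 reg FW.
have rU : 0 <= r.+2%:R * Ups by exact: mulr_ge0.
have n1 : nrm (fun x => W 1%N 0%N M x - dP x) <= Ups * k ^+ 2 / 4 + H * (r.+2%:R * Ups).
  have -> : (fun x => W 1%N 0%N M x - dP x) =
     (fun x => (W 1%N 0%N M x - dV x) + (dV x - dP x)) by apply/funext => x; ring.
  apply: le_trans (nrmD (L2B LV1 LdV) (L2B LdV LdP)) _; apply: lerD.
    exact: (nrm_diff_error T0 reg FW k0 L0 RT).
  have [dVs dVn] := quot_sobolev T0 reg FW k0 L0 RT u0.
  have pc := projection_comb k^-1 (- k^-1) Sh0 Sh_lin Sh_H1 (V_H1 _) (V_H1 _) hPn hPo.
  apply: le_trans (proj_err dVs pc) _.
  by apply: ler_wpM2l.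
have pe s P : s \in `[0, T] -> is_elliptic_projection Sh (V s) P ->
    nrm (fun x => V s x - P x) <= H * (r.+2%:R * Ups).
  move=> sT hP; apply: le_trans (proj_err (V_sobolev0 sT) hP) _.
  apply: ler_wpM2l => //; apply: le_trans (V_Hnorm sT) _.
  by rewrite ler_peMl // ler1n.
have n2 : nrm (fun x => aP x - V M x) <= Ups * k ^+ 2 / 4 + H * (r.+2%:R * Ups).
  have -> : (fun x => aP x - V M x) =
     (fun x => (aV x - V M x) + comb2 (- 2^-1) (- 2^-1) (fun x => VR x - Pn x) (fun x => VL x - Po x) x).
    by apply/funext => x; rewrite /aP /aV /comb2; ring.
  have L3 := L2_comb (- 2^-1) (- 2^-1) (L2B LVR LPn) (L2B LVL LPo).
  apply: le_trans (nrmD (L2B LaV (LV M)) L3) _; apply: lerD.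
    exact: (nrm_avg_error T0 reg FW k0 L0 RT).
  apply: le_trans (nrm_comb (- 2^-1) (- 2^-1) (L2B LVR LPn) (L2B LVL LPo)) _.
  rewrite normrN ger0_norm ?invr_ge0 //.
  have := pe _ _ RT' hPn; have := pe _ _ LT hPo; rewrite -/VL -/VR; lra.
have LbaP : L2 (fun x => bM x * (aP x - V M x)) := L2_mul_bounded mb hb (L2B LaP (LV M)).
apply: le_trans (nrmD (L2B LV1 LdP) LbaP) _.
rewrite mulrDl mul1r; apply: lerD n1 _.
apply: le_trans (nrm_mul_bounded mb hb b0 (L2B LaP (LV M))) _.
exact: ler_wpM2l.
Qed.

End omega_estimate.
End projected_solution.

(** * The bound on the discrete part of the error *)

(** Both factors vary from one step to the next: the residuals by third order, the
   coefficients by the distance of the midpoints. *)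
Lemma residual_product (R : realFieldType) (L Q k km e e' d d' q q' s s' Cs : R) :
  0 <= L -> 0 <= Q -> 0 <= Cs -> 0 < k -> 0 < km <= 2 * k ->
  `|e| <= L -> `|d| <= L -> `|e - e'| <= L * ((km + k) / 2) -> `|d - d'| <= L * ((km + k) / 2) ->
  `|q'| <= Q / 4 -> `|s'| <= Q / 4 ->
  `|q - q'| <= (1 + Cs) * Q * (km + k) -> `|s - s'| <= (1 + Cs) * Q * (km + k) ->
  `|(e * q + d * s) - (e' * q' + d' * s')| <= 7 * (1 + L) * (1 + Cs) * Q * k.
Proof.
move=> L0 Q0 C0 k0 /andP[km0 kmk] he hd de dd hq hs dq ds.
have -> : (e * q + d * s) - (e' * q' + d' * s') =
  (e * (q - q') + (e - e') * q') + (d * (s - s') + (d - d') * s') by ring.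
have kk : km + k <= 3 * k by lra.
have P0 : 0 <= (1 + Cs) * Q by rewrite mulr_ge0 //; lra.
have b1 x y : `|x| <= L -> `|y| <= (1 + Cs) * Q * (km + k) -> `|x * y| <= L * ((1 + Cs) * Q * (3 * k)).
  move=> hx hy; rewrite normrM; apply: ler_pM => //; apply: (le_trans hy).
  by rewrite ler_wpM2l.
have b2 x y : `|x| <= L * ((km + k) / 2) -> `|y| <= Q / 4 -> `|x * y| <= L * (3 / 2 * k) * (Q / 4).
  move=> hx hy; rewrite normrM; apply: ler_pM => //; apply: (le_trans hx).
  by rewrite ler_wpM2l //; lra.
apply: le_trans (ler_normD _ _) _.
apply: le_trans (lerD (ler_normD _ _) (ler_normD _ _)) _.
apply: le_trans (lerD (lerD (b1 _ _ he dq) (b2 _ _ de hq)) (lerD (b1 _ _ hd ds) (b2 _ _ dd hs))) _.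
have p1 : 0 <= L * Q * k by rewrite !mulr_ge0 // ltW.
have p2 : 0 <= Cs * Q * k by rewrite !mulr_ge0 // ltW.
have p3 : 0 <= Q * k by rewrite !mulr_ge0 // ltW.
have p4 : 0 <= L * (Cs * Q * k) by rewrite mulr_ge0.
nra.
Qed.

Lemma residual_size (R : realFieldType) (L Q e d q s : R) : 0 <= L -> 0 <= Q ->
  `|e| <= L -> `|d| <= L -> `|q| <= Q / 4 -> `|s| <= Q / 4 -> `|e * q + d * s| <= L * Q.
Proof.
move=> L0 Q0 he hd hq hs; apply: le_trans (ler_normD _ _) _; rewrite !normrM.
have h1 : `|e| * `|q| <= L * (Q / 4) by apply: ler_pM.
have h2 : `|d| * `|s| <= L * (Q / 4) by apply: ler_pM.
by have : 0 <= L * Q; [rewrite mulr_ge0|lra].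
Qed.

Lemma sqr_le_of_norm (R : realFieldType) (x y : R) : `|x| <= y -> x ^+ 2 <= y ^+ 2.
Proof.
by move=> h; rewrite -(real_normK (num_real x)) lerXn2r ?nnegrE // (le_trans (normr_ge0 x) h).
Qed.

Lemma young_step (R : realFieldType) (k c e x y : R) : 0 <= k -> `|x| <= c * e * k ->
  2 * (x * y) <= k * (c ^+ 2 * e ^+ 2 + y ^+ 2).
Proof.
move=> k0 h.
have h1 : x * y <= c * e * k * `|y|.
  by apply: (le_trans (ler_norm _)); rewrite normrM ler_wpM2r.
have h2 : 0 <= k * (c * e - `|y|) ^+ 2 by rewrite mulr_ge0 // sqr_ge0.
have h3 : `|y| ^+ 2 = y ^+ 2 by rewrite real_normK // num_real.
rewrite -h3; nra.
Qed.

Lemma young_step_norm (R : realFieldType) (k c e x y : R) : 0 <= k -> `|x| <= c * e * k * y ->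
  2 * x <= k * (c ^+ 2 * e ^+ 2 + y ^+ 2).
Proof.
move=> k0 h; have h1 := le_trans (ler_norm _) h.
by have h2 : 0 <= k * (c * e - y) ^+ 2 by [rewrite mulr_ge0 // sqr_ge0]; nra.
Qed.

(** If [km] were larger than [k], the difference would be at most Cs km^2, which
   the smallness of the step makes at most km / 3. This is why Cs enters the
   step size restriction. *)
Lemma step_ratio (R : realFieldType) (k km Cs C2 : R) : 0 < k -> 0 < km -> 0 <= Cs -> 0 <= C2 ->
  km * (C2 + Cs) <= 3^-1 -> `|k - km| <= Cs * Num.max (km ^+ 2) (k ^+ 2) -> km <= 2 * k.
Proof.
move=> k0 km0 C0 C20 sm h; have [kk|kk] := leP km k; first by lra.
have q : k ^+ 2 <= km ^+ 2 by rewrite lerXn2r ?nnegrE //; exact: ltW.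
rewrite max_l // distrC gtr0_norm ?subr_gt0 // expr2 in h.
have : km * (km * Cs) <= km * 3^-1.
  by rewrite ler_pM2l //; apply: le_trans sm; rewrite ler_pM2l // lerDr.
have -> : km * (km * Cs) = Cs * (km * km) by ring.
lra.
Qed.

Section convergence.
Variable R : realType.
Variables (r : nat) (T : R) (u : R -> R -> R) (W : nat -> nat -> R -> R -> R).
Hypotheses (r1 : (1 <= r)%N) (T0 : 0 < T) (reg : regular r T u) (FW : fields r T u W).
Local Notation Ups := (Upsilon r T u).
Local Notation V := (W 0%N 0%N).
Variables (a eps delta g : R -> R) (beta f : R -> R -> R) (u_init : R -> R).
Hypothesis sol : solution T a beta eps delta f g u_init u.

(* [L] bounds eps / a and delta / a as well as their Lipschitz constants, [b]
   bounds beta, and [h1] stands for the power of h in the projection error. The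
   exponent [m] makes the trace inequality fit the size of delta / a. *)
Variables (a0 a1 L b Cs h1 CR : R) (m : nat).
Hypotheses (a00 : 0 < a0) (L0 : 0 <= L) (b0 : 0 <= b) (Cs0 : 0 <= Cs) (h10 : 0 <= h1) (CR0 : 0 <= CR).
Hypothesis ha : forall t, t \in `[0, T] -> a0 <= a t <= a1.
Hypothesis eps0 : forall t, t \in `[0, T] -> eps t <= 0.
Hypothesis heps : forall t, t \in `[0, T] -> `|eps t / a t| <= L.
Hypothesis leps : forall s t, s \in `[0, T] -> t \in `[0, T] ->
  `|eps t / a t - eps s / a s| <= L * `|t - s|.
Hypothesis hdel : forall t, t \in `[0, T] -> `|delta t / a t| <= L.
Hypothesis ldel : forall s t, s \in `[0, T] -> t \in `[0, T] ->
  `|delta t / a t - delta s / a s| <= L * `|t - s|.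
Hypothesis cbeta : forall t, t \in `[0, T] -> {within `[0, 1], continuous (beta t)}.
Hypothesis hbeta : forall t x, t \in `[0, T] -> x \in `[0, 1] -> `|beta t x| <= b.
Hypothesis cf : forall t, t \in `[0, T] -> {within `[0, 1], continuous (f t)}.
Hypothesis hm : L * (2 / (m.+1).*2.+1%:R) <= 1 / 4.

Variable Sh : set (R -> R).
Hypothesis Sh0 : Sh (fun=> 0).
Hypothesis Sh_lin : forall c v w, Sh v -> Sh w -> Sh (fun x => c * v x + w x).
Hypothesis Sh_H1 : forall v, Sh v -> sobolev0 1 v.
Hypothesis Sid : Sh (fun x => x).
Hypothesis proj_err : forall v w, sobolev0 r.+1 v -> is_elliptic_projection Sh v w ->
  nrm (fun x => v x - w x) <= CR * h1 * Hnorm r.+1 v.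

Variables (N : nat) (t : nat -> R).
Hypothesis pt : is_partition T N t.
Hypothesis adj : forall n, (1 <= n <= N.-1)%N ->
  `|step t n.+1 - step t n| <= Cs * Num.max (step t n ^+ 2) (step t n.+1 ^+ 2).

Definition energy_constant : R := 7 * (1 + L) * (1 + Cs).
Definition load_constant : R := (1 + b) * (1 + CR * r.+2%:R).
Definition trace_constant : R := 2 * m.+1%:R ^+ 2.
Definition step_constant : R :=
  2 * (2 * L + 2) + (L * trace_constant + 1) ^+ 2 / a1^-1 + a0^-1 * b ^+ 2
  + 2 * energy_constant ^+ 2 + a0^-1 * (2 * load_constant ^+ 2).
Let c := energy_constant.
Let C2 := step_constant.

Hypothesis small : forall n, (1 <= n <= N)%N -> step t n * (C2 + Cs) <= 3^-1.

Variables U P : nat -> R -> R.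
Hypothesis scheme : CN_scheme Sh N t a beta eps delta f g u_init U.
Hypothesis hP : forall n, is_elliptic_projection Sh (V (t n)) (P n).

Let K := mesh N t.
Let eta := (K ^+ 2 + h1) * Ups.
Let th n := theta (U n) (P n).
Let mid n := midpoint t n.

Let U0 : 0 <= Ups. Proof. exact: (Ups_ge0 T0 reg FW). Qed.
Let eta0 : 0 <= eta.
Proof. by rewrite /eta mulr_ge0 // addr_ge0 // sqr_ge0. Qed.
Let KU : Ups * K ^+ 2 <= eta.
Proof. by rewrite /eta mulrC ler_wpM2r // lerDl. Qed.
Let c0 : 0 <= c.
Proof. by rewrite /c /energy_constant; move: L0 Cs0 => ? ?; rewrite !mulr_ge0 //; lra. Qed.
Let sg n : (1 <= n <= N)%N -> 0 < step t n. Proof. exact: (step_gt0 pt). Qed.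
Let sm n : (1 <= n <= N)%N -> 0 < step t n <= K.
Proof. by move=> h; apply/andP; split; [exact: sg|exact: step_le_mesh]. Qed.
Let tin n : (n <= N)%N -> t n \in `[0, T]. Proof. exact: (partition_in pt). Qed.

Let ends n : (1 <= n <= N)%N ->
  [/\ 0 <= mid n - step t n / 2, mid n + step t n / 2 <= T & mid n \in `[0, T]].
Proof.
move=> hn; have k0 := sg hn; rewrite /mid mid_left mid_right.
have nN : (n <= N)%N by case/andP: hn.
have := tin nN; have := tin (leq_trans (leq_pred n) nN).
rewrite !in_itv /= => /andP[l1 l2] /andP[l3 l4]; split => //.
rewrite /midpoint; move: k0; rewrite /step => k0; apply/andP; split; lra.
Qed.

Let thS n : (n <= N)%N -> Sh (th n).
Proof.
move=> nN; have [US _ _] := scheme; have [PS _] := hP n.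
exact: (ShB Sh_lin (US n nN) PS).
Qed.

Let thH1 n : (n <= N)%N -> H1 (th n). Proof. by move=> nN; exact: (Sh_is_H1 Sh_H1 (thS nN)). Qed.
Let th_at0 n : (n <= N)%N -> th n 0 = 0. Proof. by move=> nN; exact: (Sh_at0 Sh_H1 (thS nN)). Qed.

Let V0 s : s \in `[0, T] -> V s 0 = 0.
Proof. by move=> sT; have [_ u0 _ _] := sol; have [_] := V_sobolev0 FW u0 sT. Qed.

(* The scheme starts from the projection of the initial value. *)
Let th0_zero : nrm (wder (th 0)) = 0.
Proof.
have [US [_ hU0] _] := scheme; have [PS hP0] := hP 0%N.
have U0S := US 0%N isT.
have t00 : t 0%N = 0 by case: pt.
have z0 : (0 : R) \in `[0, T] by rewrite in_itv /= lexx ltW.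
have E : wder u_init = wder (V (t 0%N)).
  apply: eq_H1_wder => x x01; have [_ _ _ ic] := sol.
  by rewrite t00 -(W_dtn FW (isT : (0 <= 3)%N) z0 x01) /dtn /= ic.
have S0 := thS (leq0n N); have Hth := thH1 (leq0n N).
have HU := Sh_is_H1 Sh_H1 U0S; have HPP := Sh_is_H1 Sh_H1 PS.
have : bform (th 0) (th 0) = 0.
  apply: etrans (bformBl HU HPP Hth) _.
  by rewrite (hU0 _ S0) (hP0 _ S0) !bformE E subrr.
by rewrite bform_sqr => /eqP; rewrite sqrf_eq0 => /eqP.
Qed.

Let X n := nrm (wder (th n)) ^+ 2.
Let Y n := nrm (th n) ^+ 2.
Let z n := th n 1.
Let D n := nrm (comb2 (step t n)^-1 (- (step t n)^-1) (th n) (th n.-1)) ^+ 2.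
Let om n := omega (step t n) (beta (mid n)) (V (mid n)) (W 1%N 0%N (mid n)) (P n.-1) (P n).
Let Wl n := nrm (fun x => beta (mid n) x * comb2 2^-1 2^-1 (th n) (th n.-1) x + om n x) ^+ 2.
Let al n := (a (mid n))^-1.
Let gam n := delta (mid n) / a (mid n).
Let rho n := eps (mid n) / a (mid n) * diff_res T u W (mid n) (step t n)
  + gam n * trace_res T u W (mid n) (step t n).
Let tau n k := avg_res W (wder (th k)) (mid n) (step t n).

Let mbeta n : (1 <= n <= N)%N -> measurable_fun (@Defs.dom R) (beta (mid n)) /\
  (forall x, Defs.dom x -> `|beta (mid n) x| <= b).
Proof.
move=> hn; have [_ _ MT] := ends hn; split; first exact: within01_measurable (cbeta MT).
by move=> x /dom_cc; exact: hbeta.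
Qed.

Let hPn n : is_elliptic_projection Sh (V (mid n + step t n / 2)) (P n).
Proof. by rewrite /mid mid_right. Qed.
Let hPo n : is_elliptic_projection Sh (V (mid n - step t n / 2)) (P n.-1).
Proof. by rewrite /mid mid_left. Qed.

Let energy_step n : (1 <= n <= N)%N ->
  step t n * al n * D n + X n - X n.-1 <=
       gam n * (z n ^+ 2 - z n.-1 ^+ 2) + step t n * al n * Wl n + 2 * rho n * (z n - z n.-1)
       - 2 * (tau n n - tau n n.-1).
Proof.
move=> hn; have k0 := sg hn; have [Lh Rh MT] := ends hn.
have nN : (n <= N)%N by case/andP: hn.
have nN' : (n.-1 <= N)%N := leq_trans (leq_pred n) nN.
have [US _ CN] := scheme; have [mb hb] := mbeta hn.
have aM : 0 < a (mid n) by have /andP[h _] := ha MT; exact: lt_le_trans a00 h.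
have I00 : reg_idx r 0 0 by [].
have I01 : reg_idx r 0 1 := @reg_idx_low r 1 0 isT isT.
have I10 : reg_idx r 1 0 := @reg_idx_low r 0 1 isT isT.
have LV s : L2 (V s) := W_L2 FW s I00.
have LVx s : L2 (W 0%N 1%N s) := W_L2 FW s I01.
have LVt s : L2 (W 1%N 0%N s) := W_L2 FW s I10.
have wV s : weq (wder (V s)) (W 0%N 1%N s) := C1pair_wder (W_dx FW I00 I01 s).
have at1 s Q : s \in `[0, T] -> is_elliptic_projection Sh (V s) Q -> Q 1 = V s 1.
  by move=> sT; exact: (projection_at1 Sid (V_H1 FW s) (V0 sT) Sh_H1).
have Lf : L2 (f (mid n)) by exact: L2_within (cf MT).
have Lb phi : L2 phi -> L2 (fun x => beta (mid n) x * phi x) := L2_mul_bounded mb hb.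
have wp chi : Sh chi -> _ := fun hc => weak_form r1 FW sol MT Lf Lb
  (Sh_is_H1 Sh_H1 hc) (Sh_at0 Sh_H1 hc).
have LT := tin nN'; have RT := tin nN.
have E := energy_identity Sh0 Sh_lin Sh_H1 k0 aM (eps0 MT) mb hb (LV _) (LVt _) (LVx _)
  (LVx _) (LVx _) (wV _) (wV _) (US _ nN') (US _ nN) (hP n.-1) (hP n)
  (at1 _ _ LT (hP n.-1)) (at1 _ _ RT (hP n)) (CN n hn) wp.
have dE : diff_res T u W (mid n) (step t n) =
   diff_residual (step t n) (V (t n.-1)) (V (t n)) (W 1%N 0%N (mid n)).
  by rewrite /diff_res /mid mid_left mid_right.
have tE : trace_res T u W (mid n) (step t n) = trace_residual (V (t n.-1)) (V (t n)) (V (mid n)).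
  by rewrite /trace_res /mid mid_left mid_right.
have aE k : tau n k = avg_residual (W 0%N 1%N (t n.-1)) (W 0%N 1%N (t n)) (W 0%N 1%N (mid n)) (th k).
  by rewrite /tau /avg_res /mid mid_left mid_right.
have rE : rho n = (eps (mid n) * diff_res T u W (mid n) (step t n)
   + delta (mid n) * trace_res T u W (mid n) (step t n)) / a (mid n).
  by rewrite /rho /gam; ring.
rewrite rE dE tE !aE; exact: E.
Qed.

Let a1_gt0 : 0 < a1.
Proof.
have z0 : (0 : R) \in `[0, T] by rewrite in_itv /= lexx ltW.
by have /andP[h h'] := ha z0; exact: lt_le_trans a00 (le_trans h h').
Qed.

Let C2_ge0 : 0 <= C2.
Proof.
have i1 : 0 < a1^-1 by rewrite invr_gt0.
have i0 : 0 < a0^-1 by rewrite invr_gt0.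
have p1 := divr_ge0 (sqr_ge0 (L * trace_constant + 1)) (ltW i1).
have p2 := mulr_ge0 (ltW i0) (sqr_ge0 b).
have p3 := sqr_ge0 energy_constant.
have p4 := mulr_ge0 (ltW i0) (mulr_ge0 (ler0n R 2) (sqr_ge0 load_constant)).
by rewrite /C2 /step_constant; move: L0 => ?; lra.
Qed.

Let small1 n : (1 <= n <= N)%N -> step t n * C2 <= 3^-1.
Proof.
move=> hn; apply: le_trans (small hn); rewrite ler_wpM2l ?(ltW (sg hn)) //.
by rewrite lerDl.
Qed.

Let QE : 0 <= Ups * K ^+ 2. Proof. by rewrite mulr_ge0 // sqr_ge0. Qed.

Let Lc : L <= c.
Proof. by rewrite /c /energy_constant; move: L0 Cs0 => ? ?; nra. Qed.

Let csc : 3 * (1 + Cs) <= c.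
Proof. by rewrite /c /energy_constant; move: L0 Cs0 => ? ?; nra. Qed.

Let c1 : 1 <= c. Proof. by move: csc Cs0 => ? ?; lra. Qed.

Let sq_step n : (1 <= n <= N)%N -> Ups * step t n ^+ 2 <= Ups * K ^+ 2.
Proof.
move=> hn; have /andP[k0 kK] := sm hn; rewrite ler_wpM2l // lerXn2r ?nnegrE ?(ltW k0) //.
exact: le_trans (ltW k0) kK.
Qed.

Let dq n : (1 <= n <= N)%N -> `|diff_res T u W (mid n) (step t n)| <= Ups * K ^+ 2 / 4.
Proof.
move=> hn; have [Lh Rh _] := ends hn.
apply: le_trans (diff_res_le T0 reg FW (sg hn) Lh Rh) _.
by rewrite ler_wpM2r // sq_step.
Qed.

Let tq n : (1 <= n <= N)%N -> `|trace_res T u W (mid n) (step t n)| <= Ups * K ^+ 2 / 4.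
Proof.
move=> hn; have [Lh Rh _] := ends hn.
apply: le_trans (trace_res_le T0 reg FW (sg hn) Lh Rh) _.
by rewrite ler_wpM2r // sq_step.
Qed.

Let bounds n : (n <= N)%N -> [/\ 0 <= X n, 0 <= Y n, z n ^+ 2 <= X n &
  z n ^+ 2 <= 2 / (m.+1).*2.+1%:R * X n + trace_constant * Y n].
Proof.
move=> nN; split; [exact: sqr_ge0|exact: sqr_ge0| |].
  apply: sqr_le_of_norm; apply: (H1_bound (thH1 nN) (th_at0 nN)).
  by rewrite ler01 lexx.
by have := trace_ineq m (thH1 nN); rewrite addrC.
Qed.

Let local_bounds n : (1 <= n <= N)%N -> [/\ 0 <= D n, a1^-1 <= al n <= a0^-1, `|gam n| <= L,
  rho n ^+ 2 <= c ^+ 2 * eta ^+ 2 & tau n n ^+ 2 <= (c * eta) ^+ 2 * X n].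
Proof.
move=> hn; have [Lh Rh MT] := ends hn; have nN : (n <= N)%N by case/andP: hn.
have /andP[l1 l2] := ha MT; have am : 0 < a (mid n) := lt_le_trans a00 l1.
split; [exact: sqr_ge0| |exact: hdel| |].
- by rewrite /al !lef_pV2 ?posrE // l1 l2.
- rewrite -exprMn; apply: sqr_le_of_norm.
  apply: le_trans (residual_size L0 QE (heps MT) (hdel MT) (dq hn) (tq hn)) _.
  by apply: ler_pM.
- have Lp := H1_wder_L2 (thH1 nN).
  rewrite -exprMn; apply: sqr_le_of_norm.
  apply: le_trans (avg_res_le T0 reg FW Lp (sg hn) Lh Rh) _.
  have -> : Ups * nrm (wder (th n)) * step t n ^+ 2 / 4 = (Ups * step t n ^+ 2 / 4) * nrm (wder (th n)) by ring.
  apply: ler_wpM2r; first exact: nrm_ge0.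
  have := sq_step hn; have : eta <= c * eta by rewrite ler_peMl.
  have : 0 <= Ups * step t n ^+ 2 by rewrite mulr_ge0 // sqr_ge0.
  by move: KU; lra.
Qed.

Let load_step n : (1 <= n <= N)%N ->
  0 <= Wl n <= b ^+ 2 * (Y n + Y n.-1) + 2 * load_constant ^+ 2 * eta ^+ 2.
Proof.
move=> hn; have [Lh Rh MT] := ends hn; have [mb hb] := mbeta hn.
have nN : (n <= N)%N by case/andP: hn.
have [US _ _] := scheme; have [_ u0 _ _] := sol.
rewrite sqr_ge0 /=.
have I00 : reg_idx r 0 0 by [].
have I10 : reg_idx r 1 0 := @reg_idx_low r 0 1 isT isT.
have Om : nrm (om n) <= load_constant * eta.
  have HH : 0 <= CR * h1 by exact: mulr_ge0.
  apply: le_trans (omega_bound T0 reg FW u0 Sh0 Sh_lin Sh_H1 HH proj_err (sg hn) Lh Rh mb hb b0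
    (hPo n) (hPn n)) _.
  rewrite /load_constant -[leRHS]mulrA; apply: ler_wpM2l; first by move: b0; lra.
  have q1 := sq_step hn; have q2 : 0 <= Ups * step t n ^+ 2 by rewrite mulr_ge0 // sqr_ge0.
  have q3 : 0 <= CR * r.+2%:R by exact: mulr_ge0.
  have q4 : h1 * Ups <= eta by rewrite /eta ler_wpM2r // lerDr sqr_ge0.
  have q5 : CR * r.+2%:R * (h1 * Ups) <= CR * r.+2%:R * eta by exact: ler_wpM2l.
  have -> : CR * h1 * (r.+2%:R * Ups) = CR * r.+2%:R * (h1 * Ups) by ring.
  have -> : (1 + CR * r.+2%:R) * eta = eta + CR * r.+2%:R * eta by ring.
  by move: KU; lra.
have -> : 2 * load_constant ^+ 2 * eta ^+ 2 = 2 * (load_constant * eta) ^+ 2 by ring.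
exact: (load_bound Sh0 Sh_lin Sh_H1 mb hb (W_L2 FW (mid n) I00) (W_L2 FW (mid n) I10)
  (US _ (leq_trans (leq_pred n) nN)) (US _ nN) (hPo n) (hPn n) b0 Om).
Qed.

Let Y_step n : (1 <= n <= N)%N -> forall l, 0 < l ->
  Y n - Y n.-1 <= step t n * (l * D n + l^-1 * (Y n + Y n.-1)).
Proof.
move=> hn l l0; have nN : (n <= N)%N by case/andP: hn.
have [US _ _] := scheme.
exact: (L2_norm_step Sh0 Sh_lin Sh_H1 (sg hn) (US _ (leq_trans (leq_pred n) nN)) (US _ nN)
  (hPo n) (hPn n) l0).
Qed.

Let X00 : X 0%N = 0. Proof. by rewrite /X th0_zero expr0n. Qed.
Let z00 : z 0%N = 0.
Proof.
have [_ _ h _] := bounds (leq0n N); rewrite X00 in h.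
by apply/eqP; rewrite -sqrf_eq0 eq_le h sqr_ge0.
Qed.
Let Y00 : Y 0%N = 0.
Proof.
have h := poincare (thH1 (leq0n N)) (th_at0 (leq0n N)); rewrite th0_zero in h.
have /eqP h0 : nrm (th 0) == 0 by rewrite eq_le h nrm_ge0.
by rewrite /Y h0 expr0n.
Qed.
Let tau_0 n : tau n 0%N = 0.
Proof.
have Lp := H1_wder_L2 (thH1 (leq0n N)).
have I01 : reg_idx r 0 1 := @reg_idx_low r 1 0 isT isT.
have H s : inner (W 0%N 1%N s) (wder (th 0)) = 0.
  apply/eqP; rewrite -normr_le0; apply: le_trans (cauchy_schwarz (W_L2 FW s I01) Lp) _.
  by rewrite th0_zero mulr0.
by rewrite /tau /avg_res !H addr0 mul0r subrr.
Qed.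

Let increments n : (1 <= n <= N)%N ->
  [/\ (gam n.-1 - gam n) * z n.-1 ^+ 2 <= 2 * L * step t n * X n.-1,
      - 2 * (rho n - rho n.-1) * z n.-1 <= step t n * (c ^+ 2 * eta ^+ 2 + X n.-1) &
      2 * (tau n n.-1 - tau n.-1 n.-1) <= step t n * (c ^+ 2 * eta ^+ 2 + X n.-1)].
Proof.
case: n => [//|[|j]] hn.
  have k0 := ltW (sg hn).
  rewrite /= z00 X00 !tau_0 expr0n /= !mulr0 subrr mulr0 addr0.
  have p : 0 <= c ^+ 2 * eta ^+ 2 := mulr_ge0 (sqr_ge0 c) (sqr_ge0 eta).
  by split=> //; exact: mulr_ge0.
have hn' : (1 <= j.+1 <= N)%N by case/andP: hn => _ /ltnW ->.
rewrite /=; set k := step t j.+2; set km := step t j.+1.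
have k0 : 0 < k := sg hn; have km0 : 0 < km := sg hn'.
have hj : (1 <= j.+1 <= N.-1)%N by case/andP: hn => _ h; rewrite /= ltn_predRL.
have aj := adj hj; rewrite -/k -/km in aj.
have /andP[_ kK] := sm hn; have /andP[_ kmK] := sm hn'.
have mx : Num.max (km ^+ 2) (k ^+ 2) <= K ^+ 2.
  rewrite ge_max !lerXn2r ?nnegrE ?(ltW k0) ?(ltW km0) //; exact: le_trans (ltW k0) kK.
have dk : `|k - km| <= Cs * K ^+ 2 by apply: (le_trans aj); exact: ler_wpM2l.
have ratio : km <= 2 * k := step_ratio k0 km0 Cs0 C2_ge0 (small hn') aj.
have [Lh Rh MT] := ends hn; have [Lh' Rh' MT'] := ends hn'.
have RL : mid j.+1 + km / 2 = mid j.+2 - k / 2 by rewrite /mid /km /k mid_left mid_right.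
have dm : `|mid j.+2 - mid j.+1| = (km + k) / 2.
  have -> : mid j.+2 - mid j.+1 = (km + k) / 2 by move: RL => *; lra.
  by rewrite gtr0_norm // divr_gt0 // addr_gt0.
have [X0 Y0 zX _] := bounds (leq_trans (leqnSn j.+1) (proj2 (andP hn))).
have Xz : 0 <= z j.+1 ^+ 2 := sqr_ge0 _.
have hk : 0 < km <= K by rewrite km0.
have hk' : 0 < k <= K by rewrite k0.
have Qc x : x <= (1 + Cs) * (Ups * K ^+ 2) * (km + k) -> x <= c * eta * k.
  move=> h; apply: (le_trans h).
  apply: (@le_trans _ _ ((1 + Cs) * (Ups * K ^+ 2) * (3 * k))).
    apply: ler_wpM2l; last by lra.
    by rewrite mulr_ge0 //; move: Cs0; lra.
  have -> : (1 + Cs) * (Ups * K ^+ 2) * (3 * k) = 3 * (1 + Cs) * (Ups * K ^+ 2) * k by ring.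
  rewrite ler_pM2r //; apply: ler_pM => //.
  by move: Cs0; lra.
split.
- apply: (@le_trans _ _ (L * ((km + k) / 2) * z j.+1 ^+ 2)).
    apply: ler_wpM2r => //; apply: le_trans (ler_norm _) _; rewrite distrC -dm.
    exact: ldel.
  apply: (@le_trans _ _ (L * ((km + k) / 2) * X j.+1)).
    by apply: ler_wpM2l => //; rewrite mulr_ge0 //; lra.
  apply: ler_wpM2r => //.
  have -> : 2 * L * k = L * (2 * k) by ring.
  by apply: ler_wpM2l => //; lra.
- have rr : `|- (rho j.+2 - rho j.+1)| <= c * eta * k.
    rewrite normrN /rho.
    have kmk : 0 < km <= 2 * k by rewrite km0.
    have e1 : `|eps (mid j.+2) / a (mid j.+2) - eps (mid j.+1) / a (mid j.+1)| <= L * ((km + k) / 2).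
      by rewrite -dm; exact: leps.
    have e2 : `|gam j.+2 - gam j.+1| <= L * ((km + k) / 2) by rewrite -dm; exact: ldel.
    have d1 := diff_res_diff T0 reg FW Cs0 hk hk' Lh' RL Rh dk.
    have d2 := trace_res_diff T0 reg FW Cs0 hk hk' Lh' RL Rh dk.
    rewrite -!mulrA (mulrA (1 + Cs)) in d1 d2.
    have d1' : `|diff_res T u W (mid j.+2) k - diff_res T u W (mid j.+1) km| <= (1 + Cs) * (Ups * K ^+ 2) * (km + k).
      by apply: (le_trans d1); rewrite !mulrA.
    have d2' : `|trace_res T u W (mid j.+2) k - trace_res T u W (mid j.+1) km| <= (1 + Cs) * (Ups * K ^+ 2) * (km + k).
      by apply: (le_trans d2); rewrite !mulrA.
    apply: le_trans (residual_product L0 QE Cs0 k0 kmk (heps MT) (hdel MT) e1 e2 (dq hn') (tq hn') d1' d2') _.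
    by rewrite ler_pM2r // /c /energy_constant; apply: ler_wpM2l => //.
  have -> : - 2 * (rho j.+2 - rho j.+1) * z j.+1 = 2 * (- (rho j.+2 - rho j.+1) * z j.+1) by ring.
  apply: le_trans (young_step (z j.+1) (ltW k0) rr) _.
  by rewrite ler_pM2l // lerD2l.
- have nN : (j.+1 <= N)%N by case/andP: hn'.
  have Lp := H1_wder_L2 (thH1 nN).
  apply: young_step_norm; first exact: ltW.
  apply: le_trans (avg_res_diff T0 reg FW Cs0 hk hk' Lh' RL Rh dk Lp) _.
  have -> : (1 + Cs) * (Ups * nrm (wder (th j.+1))) * K ^+ 2 * (km + k) =
     (1 + Cs) * (Ups * K ^+ 2) * (km + k) * nrm (wder (th j.+1)) by ring.
  by apply: ler_wpM2r; [exact: nrm_ge0|exact: Qc].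
Qed.

(** The sequences above satisfy the hypotheses of the abstract energy argument:
   energy inequality, size of the residuals and of the load, and increments of
   the quantities summed by parts. *)
Lemma theta_bound n : (n <= N)%N ->
  nrm (wder (theta (U n) (P n))) ^+ 2 <= 2 * (expR (3 * C2 * t n) * (16 * c ^+ 2 + 1) * eta ^+ 2).
Proof.
have i1 : 0 < a1^-1 by rewrite invr_gt0.
have i0 : 0 <= a0^-1 by rewrite invr_ge0 ltW.
have t00 : t 0%N = 0 by case: pt.
have tX : 0 <= 2 / (m.+1).*2.+1%:R :> R by exact: divr_ge0.
have tY : 0 <= trace_constant by exact: mulr_ge0 (ler0n R 2) (sqr_ge0 _).
have cW : 0 <= 2 * load_constant ^+ 2 := mulr_ge0 (ler0n R 2) (sqr_ge0 _).
have L2' : 0 <= 2 * L by exact: mulr_ge0.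
exact: (@discrete_energy R N t X Y z D Wl al gam rho tau a1^-1 a0^-1 L (2 * L)
  (2 / (m.+1).*2.+1%:R) trace_constant (b ^+ 2) (2 * load_constant ^+ 2) c eta
  (L * trace_constant + 1) C2 i1 i0 L0 L2' tX tY (sqr_ge0 b) cW c0 hm erefl erefl t00
  (fun n hn => conj (sg hn) (small1 hn)) X00 Y00 z00 (tau_0 0) bounds local_bounds
  load_step Y_step increments energy_step).
Qed.

End convergence.

(** * The error estimate *)

Section final.
Variable R : realType.

Lemma nrmB (f g : R -> R) : L2 f -> L2 g -> nrm (fun x => f x - g x) <= nrm f + nrm g.
Proof.
move=> Lf Lg; have := nrmD Lf (L2Z (-1) Lg); rewrite (nrmZ _ Lg) normrN1 mul1r.
by under eq_fun do rewrite mulN1r.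
Qed.

Lemma nrm_wderB (v w : R -> R) : H1 v -> H1 w ->
  nrm (wder (fun x => v x - w x)) <= nrm (wder v) + nrm (wder w).
Proof.
move=> hv hw; have Lv := H1_wder_L2 hv; have Lw := H1_wder_L2 hw.
rewrite (weq_nrm (H1_wder_L2 (H1B hv hw)) (L2B Lv Lw)); first exact: nrmB.
by move=> phi Lp; rewrite (wderB hv hw Lp) (innerBl Lv Lw Lp).
Qed.

Lemma Hnorm1_le (v : R -> R) : Hnorm 1 v <= nrm v + nrm (wder v).
Proof.
have h0 := nrm_ge0 v; have h1 := nrm_ge0 (wder v).
rewrite Hnorm1E -[leRHS]ger0_norm ?addr_ge0 // -sqrtr_sqr ler_sqrt ?sqr_ge0 //.
by rewrite sqrrD lerD2r lerDl pmulrn mulrn_wge0 // mulr_ge0.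
Qed.

Lemma bigmax_nat_le (F : nat -> R) m n B : 0 <= B ->
  (forall i, (m <= i < n)%N -> F i <= B) -> \big[Num.max/0]_(m <= i < n) F i <= B.
Proof.
move=> B0 H; rewrite big_nat; apply: (big_ind (fun x => x <= B)) => //.
by move=> x y hx hy; rewrite ge_max hx hy.
Qed.

Lemma le_bigmax_nat_elem (F : nat -> R) m n i : (m <= i < n)%N ->
  F i <= \big[Num.max/0]_(m <= j < n) F j.
Proof.
by move=> hi; apply: (@Order.TotalTheory.le_bigmax_seq _ _ _ _ _ i) => //; rewrite mem_index_iota.
Qed.

Lemma small_power (L : R) : 0 <= L -> exists m : nat, L * (2 / (m.+1).*2.+1%:R) <= 1 / 4.
Proof.
move=> L0; have /filter_ex[m Hm] := nbhs_infty_ger (8 * L); exists m.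
have M0 : 0 < (m.+1).*2.+1%:R :> R by rewrite ltr0n.
have mM : m%:R <= (m.+1).*2.+1%:R :> R.
  by rewrite ler_nat -addnn !addSn !addnS; do 3 apply: leqW; exact: leq_addr.
rewrite mulrA ler_pdivrMr //; lra.
Qed.

Lemma add_projection_error0 (Cf CR hs K2 q U A : R) : 0 <= Cf -> 0 <= CR -> 0 < hs -> 0 <= K2 -> 0 <= q -> 0 <= U ->
  A <= Cf * ((K2 + q) * U) + CR * q * U ->
  A <= (2 * Cf + CR + 1) * (1 + hs) * (K2 + q) * U.
Proof.
move=> Cf0 CR0 hs0 K0 q0 U0 h; apply: (le_trans h).
have p1 : 0 <= K2 * U by rewrite mulr_ge0.
have p2 : 0 <= q * U by rewrite mulr_ge0.
have -> : Cf * ((K2 + q) * U) + CR * q * U = Cf * (K2 * U) + (Cf + CR) * (q * U) by ring.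
have -> : (2 * Cf + CR + 1) * (1 + hs) * (K2 + q) * U =
  (2 * Cf + CR + 1) * (1 + hs) * (K2 * U) + (2 * Cf + CR + 1) * (1 + hs) * (q * U) by ring.
have c1 : Cf + CR <= (2 * Cf + CR + 1) * (1 + hs) by nra.
have c2 : Cf <= (2 * Cf + CR + 1) * (1 + hs) by nra.
by apply: lerD; apply: ler_wpM2r.
Qed.

(** In the H^1 norm the projection error loses one power of [h], here [q] against
   [h * q]. *)
Lemma add_projection_error1 (Cf CR hs h K2 q U A B : R) : 0 <= Cf -> 0 <= CR -> 0 < h <= hs -> 0 <= K2 -> 0 <= q ->
  0 <= U -> A <= Cf * ((K2 + h * q) * U) + CR * (h * q) * U ->
  B <= Cf * ((K2 + h * q) * U) + CR * q * U ->
  A + B <= (2 * Cf + CR + 1) * (1 + hs) * (K2 + q) * U.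
Proof.
move=> Cf0 CR0 /andP[h0 hhs] K0 q0 U0 hA hB; apply: (le_trans (lerD hA hB)).
have p1 : 0 <= K2 * U by rewrite mulr_ge0.
have p2 : 0 <= q * U by rewrite mulr_ge0.
have -> : Cf * ((K2 + h * q) * U) + CR * (h * q) * U + (Cf * ((K2 + h * q) * U) + CR * q * U) =
   2 * Cf * (K2 * U) + (2 * Cf * h + CR * (1 + h)) * (q * U) by ring.
have -> : (2 * Cf + CR + 1) * (1 + hs) * (K2 + q) * U =
  (2 * Cf + CR + 1) * (1 + hs) * (K2 * U) + (2 * Cf + CR + 1) * (1 + hs) * (q * U) by ring.
have Ch : 2 * Cf * h <= 2 * Cf * hs by rewrite ler_wpM2l // mulr_ge0.
have Ch' : CR * h <= CR * hs by rewrite ler_wpM2l.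
have hs0 : 0 < hs by exact: lt_le_trans hhs.
have c1 : 2 * Cf * h + CR * (1 + h) <= (2 * Cf + CR + 1) * (1 + hs) by lra.
have c2 : 2 * Cf <= (2 * Cf + CR + 1) * (1 + hs) by nra.
by apply: lerD; apply: ler_wpM2r.
Qed.

End final.

Unset Implicit Arguments.

Theorem theorem4p7 (R : realType) (r : nat) (hstar : R) (S : R -> set (R -> R))
  (T : R) (a : R -> R) (beta : R -> R -> R) (eps delta : R -> R) (Cstar : R)
  (r_ge1 : (1 <= r)%N) (hstar_gt0 : 0 < hstar)
  (S_fe : fe_family r hstar S)
  (coeffs : coefficients T a beta eps delta)
  (eps_le0 : forall t, t \in `[0, T] -> eps t <= 0)
  (Cstar_ge0 : 0 <= Cstar) :
  exists CD C : R, [/\ 0 <= CD, 0 < C &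
    forall (f : R -> R -> R) (g u0 : R -> R) (u : R -> R -> R),
      sources T f g u0 ->
      solution T a beta eps delta f g u0 u ->
      regular r T u ->
    forall (N : nat) (t : nat -> R),
      is_partition T N t ->
      (forall n, (1 <= n <= N.-1)%N ->
         `|step t n.+1 - step t n|
           <= Cstar * Num.max (step t n ^+ 2) (step t n.+1 ^+ 2)) ->
      \big[Num.max/0]_(1 <= n < N.+1) (step t n * CD) <= 3^-1 ->
    forall h, 0 < h <= hstar ->
    forall U : nat -> R -> R,
      CN_scheme (S h) N t a beta eps delta f g u0 U ->
    forall l, (l <= 1)%N ->
      \big[Num.max/0]_(0 <= n < N.+1) Hnorm l (U n \- u (t n))
        <= C * (mesh N t ^+ 2 + h ^+ (r + 1 - l)) * Upsilon r T u].
Proof.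
have [T0 [sa sb] [se sd] apos ainf] := coeffs.
pose a0 := inf [set a t | t in `[0, T]].
have a00 : 0 < a0 := ainf.
have [La La0 [hLa lLa]] := smooth1_lipschitz T0 sa.
have [Le Le0 [hLe lLe]] := smooth1_lipschitz T0 se.
have [Ld Ld0 [hLd lLd]] := smooth1_lipschitz T0 sd.
have [b b0 hb] := smooth2_bounded sb.
have [CR CR0 HCR] := elliptic_error r_ge1 S_fe.
have ha0 t : t \in `[0, T] -> a0 <= a t.
  move=> tT; apply: ge_inf; last by exists t.
  by exists 0 => _ [s sT <-]; exact: ltW (apos s sT).
have ha t : t \in `[0, T] -> a0 <= a t <= La.
  by move=> tT; rewrite ha0 //= (le_trans (ler_norm _)) // hLa.
have [L1 hL1 lL1] := quotient_lipschitz a00 La0 Le0 ha0 lLa hLe lLe.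
have [L2 hL2 lL2] := quotient_lipschitz a00 La0 Ld0 ha0 lLa hLd lLd.
move: L1 hL1 lL1; set Lq1 := (_ + _) => L1 hL1 lL1.
move: L2 hL2 lL2; set Lq2 := (_ + _) => L2 hL2 lL2.
pose L := Lq1 + Lq2.
have L0 : 0 <= L by rewrite addr_ge0.
have LL1 : Lq1 <= L by rewrite lerDl.
have LL2 : Lq2 <= L by rewrite lerDr.
(* The exponent in the trace inequality is fitted to the size of delta / a. *)
have [m hm] := small_power L0.
pose C2 := step_constant r a0 La L b Cstar CR m.
pose c := energy_constant L Cstar.
have La_gt0 : 0 < La.
  have z0 : (0 : R) \in `[0, T] by rewrite in_itv /= lexx ltW.
  by have /andP[h1 h2] := ha _ z0; exact: lt_le_trans a00 (le_trans h1 h2).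
have C20 : 0 <= C2.
  rewrite /C2 /step_constant.
  have q1 : 0 <= (L * trace_constant R m + 1) ^+ 2 / La^-1 by rewrite divr_ge0 ?sqr_ge0 // invr_ge0 ltW.
  have q2 : 0 <= a0^-1 * b ^+ 2 by apply: mulr_ge0; [rewrite invr_ge0 ltW|exact: sqr_ge0].
  have q3 : 0 <= a0^-1 * (2 * load_constant r b CR ^+ 2).
    by apply: mulr_ge0; [rewrite invr_ge0 ltW|apply: mulr_ge0 => //; exact: sqr_ge0].
  by have q4 := sqr_ge0 (energy_constant L Cstar); lra.
pose E2 := 2 * (expR (3 * C2 * T) * (16 * c ^+ 2 + 1)).
have E20 : 0 <= E2.
  by rewrite mulr_ge0 // mulr_ge0 ?expR_ge0 // addr_ge0 // mulr_ge0 // sqr_ge0.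
pose Cf := Num.sqrt E2; have Cf0 : 0 <= Cf := sqrtr_ge0 _.
have Cpos : 0 < (2 * Cf + CR + 1) * (1 + hstar).
  have p : 0 <= 2 * Cf + CR by rewrite addr_ge0 // mulr_ge0.
  by rewrite mulr_gt0 // ?ltr_wpDl // addr_gt0.
(* C2 serves the discrete Gronwall lemma, and Cstar the comparison of adjacent
   steps. *)
exists (C2 + Cstar), ((2 * Cf + CR + 1) * (1 + hstar)); split.
- exact: addr_ge0.
- exact: Cpos.
move=> f g u0 u [sf sg su] sol reg N t pt adj sm h hh U scheme l l1.
have [W FW] := regular_fields T0 reg.
have [fe _] := S_fe; have [[S0 Slin] fd SH _ Sid] := fe h hh.
have h0 : 0 < h by case/andP: hh.
have U0 : 0 <= Upsilon r T u := Ups_ge0 T0 reg FW.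
have VH s : H1 (W 0%N 0%N s) := V_H1 FW s.
have [P HP] : exists P : nat -> R -> R, forall n,
    is_elliptic_projection (S h) (W 0%N 0%N (t n)) (P n).
  have ex n := elliptic_projection_exists S0 Slin SH fd (VH (t n)).
  by have [P HP] := choice ex; exists P.
have h10 : 0 <= h ^+ r.+1 by rewrite exprn_ge0 // ltW.
have proj_err v w : sobolev0 r.+1 v -> is_elliptic_projection (S h) v w ->
    nrm (fun x => v x - w x) <= CR * h ^+ r.+1 * Hnorm r.+1 v.
  by move=> vs wv; have [] := HCR h hh v w vs wv.
have small n : (1 <= n <= N)%N -> step t n * (C2 + Cstar) <= 3^-1.
  by move=> hn; apply: le_trans (le_bigmax_nat_elem _ _) sm; rewrite ltnS.
have tb n (hn : (n <= N)%N) := theta_bound r_ge1 T0 reg FW sol a00 L0 b0 Cstar_ge0 h10 CR0 ha eps_le0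
  (fun s sT => le_trans (hL1 s sT) LL1)
  (fun s s' sT sT' => le_trans (lL1 s s' sT sT') (ler_wpM2r (normr_ge0 _) LL1))
  (fun s sT => le_trans (hL2 s sT) LL2)
  (fun s s' sT sT' => le_trans (lL2 s s' sT sT') (ler_wpM2r (normr_ge0 _) LL2))
  (fun s sT => smooth2_slice sb sT) hb (fun s sT => smooth2_slice sf sT) hm
  S0 Slin SH Sid proj_err pt adj small scheme HP hn.
set eta := (mesh N t ^+ 2 + h ^+ r.+1) * Upsilon r T u in tb.
have K20 : 0 <= mesh N t ^+ 2 := sqr_ge0 _.
have eta0 : 0 <= eta by rewrite mulr_ge0 // addr_ge0.
have [US _ _] := scheme.
have thH n (hn : (n <= N)%N) : H1 (theta (U n) (P n)).
  by have [PS _] := HP n; exact: (Sh_is_H1 SH (ShB Slin (US n hn) PS)).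
have th1 n : (n <= N)%N -> nrm (wder (theta (U n) (P n))) <= Cf * eta.
  move=> hn; rewrite -(@ler_pXn2r _ 2) ?nnegrE ?nrm_ge0 ?(mulr_ge0 Cf0 eta0) //.
  apply: le_trans (tb n hn) _; rewrite [leRHS]exprMn sqr_sqrtr // /E2.
  rewrite [leLHS]mulrA ler_wpM2r ?sqr_ge0 // ler_wpM2l // ler_wpM2r //.
    by rewrite addr_ge0 // mulr_ge0 // sqr_ge0.
  rewrite ler_expR; apply: ler_wpM2l; first by rewrite mulr_ge0.
  by have := partition_in pt hn; rewrite in_itv /= => /andP[].
have th0 n : (n <= N)%N -> nrm (theta (U n) (P n)) <= Cf * eta.
  move=> hn; apply: le_trans (poincare (thH n hn) _) (th1 n hn).
  by have [PS _] := HP n; exact: (Sh_at0 SH (ShB Slin (US n hn) PS)).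
have [_ ubc _ _] := sol.
apply: bigmax_nat_le.
  rewrite mulr_ge0 // mulr_ge0 ?(ltW Cpos) // addr_ge0 //.
  exact: exprn_ge0 (ltW h0).
move=> n /andP[_]; rewrite ltnS => hn.
have tT := partition_in pt hn.
pose e x := W 0%N 0%N (t n) x - P n x.
have eH : H1 e by have [PS _] := HP n; exact: (H1B (VH _) (Sh_is_H1 SH PS)).
have [e0 e1] := HCR h hh _ _ (V_sobolev0 FW ubc tT) (HP n).
have vn := V_Hnorm T0 reg FW tT.
have {}e0 : nrm e <= CR * h ^+ r.+1 * Upsilon r T u.
  by apply: le_trans e0 _; apply: ler_wpM2l => //; rewrite mulr_ge0.
have {}e1 : nrm (wder e) <= CR * h ^+ r * Upsilon r T u.
  by apply: le_trans e1 _; apply: ler_wpM2l => //; rewrite mulr_ge0 // exprn_ge0 // ltW.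
have E : Hnorm l (U n \- u (t n)) = Hnorm l (fun x => theta (U n) (P n) x - e x).
  apply: eq_Hnorm => x x01; rewrite /theta /e /= -(W_dtn FW (isT : (0 <= 3)%N) tT x01) /dtn /=.
  by rewrite opprB addrA subrK.
have A := le_trans (nrmB (H1_L2 (thH n hn)) (H1_L2 eH)) (lerD (th0 n hn) e0).
have B := le_trans (nrm_wderB (thH n hn) eH) (lerD (th1 n hn) e1).
rewrite E; case: l l1 {E} => [|[|//]] _.
  rewrite Hnorm0E subn0 addn1.
  exact: (add_projection_error0 Cf0 CR0 hstar_gt0 K20 h10 U0 A).
rewrite addn1 subn1 /=; apply: le_trans (Hnorm1_le _) _.
have q0 : 0 <= h ^+ r by rewrite exprn_ge0 // ltW.
rewrite /eta (exprS h) in A B.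
exact: (add_projection_error1 Cf0 CR0 hh K20 q0 U0 A B).
Qed.
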